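(* There is a unique Hopf algebra isomorphism $\theta_{r,s}\colon U_{r,s}(\mathfrak{gl}_{n+1})\to U(R_{r,s})$, where $R_{r,s}$ is the two-parameter $R$-matrix of type $A_n$, such that $$\theta_{r,s}(a_j)=(\ell_{jj}^+)^{-1},\qquad\theta_{r,s}(a_j')=(\ell_{jj}^-)^{-1}\qquad(1\le j\le n+1),$$ $$\theta_{r,s}(e_i)=\frac1{r-s}\ell_{i+1,i}^+(\ell_{ii}^+)^{-1},\qquad\theta_{r,s}(f_i)=\frac1{s-r}(\ell_{ii}^-)^{-1}\ell_{i,i+1}^-\qquad(1\le i\le n).$$
   Context: $\mathbb K$ is an algebraically closed field, $r,s\in\mathbb K$ are transcendental with $rs^{-1}$ not a root of unity. $U_{r,s}(\mathfrak{gl}_{n+1})$ is the $\mathbb K$-algebra generated by $e_i,f_i$ ($1\le i\le n$) and $a_j^{\pm1},(a_j')^{\pm1}$ ($1\le j\le n+1$) with relations: all $a_i,a_j'$ commute and are invertible; $a_i$ and $a_i'$ commute with $e_j,f_j$ if $i<j$ or $i>j+1$; for $1\le i\le n$: $a_ie_i=s^{-1}e_ia_i$, $a_if_i=sf_ia_i$, $a_i'e_i=r^{-1}e_ia_i'$, $a_i'f_i=rf_ia_i'$, $a_{i+1}e_i=r^{-1}e_ia_{i+1}$, $a_{i+1}f_i=rf_ia_{i+1}$, $a_{i+1}'e_i=s^{-1}e_ia_{i+1}'$, $a_{i+1}'f_i=sf_ia_{i+1}'$; $[e_i,f_j]=\delta_{ij}\frac{a_ia_{i+1}^{-1}-a_i'(a_{i+1}')^{-1}}{r-s}$;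 and the Serre relations for $i\ne j$: $\sum_{k=0}^{1-a_{ij}}(-1)^k\binom{1-a_{ij}}{k}_{r,s}(rs)^{\frac12k(k-1)+k\langle\alpha_j,\alpha_i\rangle}e_i^{1-a_{ij}-k}e_je_i^k=0$ and the same with $f_i^kf_jf_i^{1-a_{ij}-k}$ in place of the $e$-monomial. Here $(a_{ij})$ is the Cartan matrix of $\mathfrak{sl}_{n+1}$, $\langle\alpha_i,\alpha_j\rangle=a_{ij}$ for $i<j$, $1$ for $i=j$, $0$ for $i>j$, $[m]_{r,s}=\frac{r^m-s^m}{r-s}$ and $\binom mk_{r,s}$ is the corresponding binomial coefficient. Hopf structure: $a_j,a_j'$ grouplike, $\Delta(e_i)=e_i\otimes1+\omega_i\otimes e_i$, $\Delta(f_i)=1\otimes f_i+f_i\otimes\omega_i'$, $\epsilon(e_i)=\epsilon(f_i)=0$, $S(e_i)=-\omega_i^{-1}e_i$, $S(f_i)=-f_i(\omega_i')^{-1}$ with $\omega_i=a_ia_{i+1}^{-1}$, $\omega_i'=a_i'(a_{i+1}')^{-1}$. $R_{r,s}=\hat R_{r,s}\circ\tau$, $\tau$ the flip on $\mathbb K^{n+1}\otimes\mathbb K^{n+1}$, $\hat R_{r,s}=\sum_iE_{ii}\otimes E_{ii}+r\sum_{i<j}E_{ji}\otimes E_{ij}+s^{-1}\sum_{i<j}E_{ij}\otimes E_{ji}+(1-rs^{-1})\sum_{i<j}E_{jj}\otimes E_{ii}$ (indices in $1,\dots,n+1$; $E_{ij}$ matrix units). With $N=n+1$, $U(R)$ is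 the $\mathbb K$-algebra generated by $\ell_{ji}^+,\ell_{ij}^-$ ($1\le i\le j\le N$) and $(\ell_{ii}^\pm)^{-1}$ with relations $RL_1^\pm L_2^\pm=L_2^\pm L_1^\pm R$, $RL_1^+L_2^-=L_2^-L_1^+R$, $\ell_{ii}^\pm(\ell_{ii}^\pm)^{-1}=(\ell_{ii}^\pm)^{-1}\ell_{ii}^\pm=1$, where $L_1^\pm=\sum E_{ij}\otimes1\otimes\ell_{ij}^\pm$, $L_2^\pm=\sum1\otimes E_{ij}\otimes\ell_{ij}^\pm$ and $\ell_{ij}^+=0=\ell_{ji}^-$ for $i<j$; Hopf structure $\Delta(\ell_{ij}^\pm)=\sum_k\ell_{ik}^\pm\otimes\ell_{kj}^\pm$, $\epsilon(\ell_{ij}^\pm)=\delta_{ij}$, $S(L^\pm)=(L^\pm)^{-1}$. *)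

(* Defs.v *)
From HB Require Import structures.
From mathcomp Require Import all_boot all_order all_algebra.
From mathcomp Require Import finmap boolp monalg.

Set Implicit Arguments.
Unset Strict Implicit.
Unset Printing Implicit Defensive.

Import GRing.Theory.
Local Open Scope ring_scope.
Local Open Scope quotient_scope.

(* Linear extension of h : T -> Z to the free module {malg K[T]}. *)

HB.lock Definition malg_lift (K : fieldType) (T : choiceType) (Z : lmodType K)
    (h : T -> Z) (g : {malg K[T]}) : Z := \sum_(t <- msupp g) g@_t *: h t.

Section MalgLift.
Variables (K : fieldType) (T : choiceType) (Z : lmodType K) (h : T -> Z).
Local Notation malg_lift := (malg_lift h).

Lemma malg_liftEw (d : {fset T}) (g : {malg K[T]}) :
  (msupp g `<=` d)%fset -> malg_lift g = \sum_(t <- d) g@_t *: h t.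
Proof.
move=> le_gd; rewrite malg_lift.unlock (big_fset_incl _ le_gd) //.
by move=> t _ /mcoeff_outdom ->; rewrite scale0r.
Qed.

Lemma malg_lift_linear : linear malg_lift.
Proof.
move=> c g1 g2; set d := (msupp g1 `|` msupp g2 `|` msupp (c *: g1 + g2)%R)%fset.
have d1 : (msupp g1 `<=` d)%fset by rewrite /d -fsetUA fsubsetUl.
have d2 : (msupp g2 `<=` d)%fset by rewrite /d (fsetUC (msupp g1)) -fsetUA fsubsetUl.
have d3 : (msupp (c *: g1 + g2)%R `<=` d)%fset by rewrite /d fsubsetUr.
rewrite (malg_liftEw d1) (malg_liftEw d2) (malg_liftEw d3).
rewrite scaler_sumr -big_split; apply: eq_bigr => t _ /=.
by rewrite mcoeffD mcoeffZ scalerDl scalerA.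
Qed.

HB.instance Definition _ :=
  GRing.isLinear.Build K {malg K[T]} Z _ malg_lift malg_lift_linear.

Lemma malg_liftU t : malg_lift << t >> = h t.
Proof.
by rewrite malg_lift.unlock msuppU oner_eq0 big_seq_fset1 mcoeffUU scale1r.
Qed.

End MalgLift.

Lemma malgU_scale (K : fieldType) (T : choiceType) (c : K) (t : T) :
  << c *g t >> = c *: << t >> :> {malg K[T]}.
Proof. by apply/malgP => m; rewrite mcoeffZ !mcoeffU mulr_natr. Qed.

Lemma malg_scaleAr (K : fieldType) (M : monomType) (k : K)
    (x y : {malg K[M]}) : k *: (x * y) = x * (k *: y).
Proof.
apply/malgP => m; rewrite mcoeffZ mcoeffMl.
rewrite (mcoeffMlw _ (fsubset_refl _) (msuppZ_le _ _)) mulr_sumr.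
apply: eq_bigr => m1 _; rewrite mulr_sumr; apply: eq_bigr => m2 _.
by rewrite mcoeffZ mulrCA mulrnAr.
Qed.

Section QuotientModule.
Variables (K : fieldType) (V : lmodType K) (S : V -> Prop).

Inductive subspan : V -> Prop :=
  | subspan0 : subspan 0
  | subspan_gen v : S v -> subspan v
  | subspanD v w : subspan v -> subspan w -> subspan (v + w)
  | subspanZ k v : subspan v -> subspan (k *: v).

Definition subspan_pred (v : V) : bool := `[< subspan v >].

Lemma subspan_zmod_closed : zmod_closed subspan_pred.
Proof.
split=> [|v w /asboolP Sv /asboolP Sw]; apply/asboolP; first exact: subspan0.
by rewrite -scaleN1r; apply/subspanD/subspanZ.
Qed.

HB.instance Definition _ := GRing.isZmodClosed.Build V subspan_pred
  subspan_zmod_closed.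

Local Notation quotmod_zmod := (Quotient.quot (GRing.ZmodClosed.clone V subspan_pred _)).
Definition quotmod : Type := quotmod_zmod.
HB.instance Definition _ := GRing.Zmodule.on quotmod.

Definition qmpi : V -> quotmod := \pi_quotmod_zmod.
HB.instance Definition _ := GRing.Additive.on qmpi.

Lemma qmpi_eq v w : qmpi v = qmpi w <-> subspan (v - w).
Proof.
split=> [/eqP|Svw]; first by rewrite -Quotient.idealrBE => /asboolP.
by apply/eqP; rewrite -Quotient.idealrBE; apply/asboolP.
Qed.

Lemma qmpi_gen0 v : S v -> qmpi v = 0.
Proof.
move=> Sv; rewrite -(raddf0 qmpi); apply/qmpi_eq.
by rewrite subr0; apply: subspan_gen.
Qed.

Lemma qmpi_surj x : exists v, x = qmpi v.
Proof. by exists (repr x); rewrite /qmpi reprK. Qed.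

Definition quotmod_scale (k : K) (x : quotmod) : quotmod :=
  qmpi (k *: repr (x : quotmod_zmod)).

Lemma quotmod_scaleE k v : quotmod_scale k (qmpi v) = qmpi (k *: v).
Proof.
apply/qmpi_eq; rewrite -scalerBr; apply: subspanZ; apply/qmpi_eq.
by rewrite /qmpi reprK.
Qed.

Fact quotmod_scaleA a b x :
  quotmod_scale a (quotmod_scale b x) = quotmod_scale (a * b) x.
Proof. by have [v ->] := qmpi_surj x; rewrite !quotmod_scaleE scalerA. Qed.

Fact quotmod_scale1 : left_id 1 quotmod_scale.
Proof. by move=> x; have [v ->] := qmpi_surj x; rewrite quotmod_scaleE scale1r. Qed.

Fact quotmod_scaleDr : right_distributive quotmod_scale +%R.
Proof.
move=> a x y; have [v ->] := qmpi_surj x; have [w ->] := qmpi_surj y.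
by rewrite -raddfD !quotmod_scaleE scalerDr raddfD.
Qed.

Fact quotmod_scaleDl x : {morph quotmod_scale^~ x : a b / a + b}.
Proof.
by move=> a b; have [v ->] := qmpi_surj x; rewrite !quotmod_scaleE scalerDl raddfD.
Qed.

HB.instance Definition _ := GRing.Zmodule_isLmodule.Build K quotmod
  quotmod_scaleA quotmod_scale1 quotmod_scaleDr quotmod_scaleDl.

Lemma qmpi_scalable : scalable qmpi.
Proof. by move=> k v; rewrite -quotmod_scaleE. Qed.

HB.instance Definition _ := GRing.isScalable.Build K V quotmod _ qmpi
  qmpi_scalable.

End QuotientModule.

(* f is evaluated on a representative: meaningful when f kills S. *)
HB.lock Definition quotmod_lift (K : fieldType) (V : lmodType K)
    (S : V -> Prop) (Z : Type) (f : V -> Z) (x : quotmod S) : Z :=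
  f (repr (x : Quotient.quot (GRing.ZmodClosed.clone V (subspan_pred S) _))).

Section QuotientModuleLift.
Variables (K : fieldType) (V : lmodType K) (S : V -> Prop).

Lemma quotmod_liftE (Z : lmodType K) (f : {linear V -> Z}) v :
  (forall u, S u -> f u = 0) -> quotmod_lift f (qmpi S v) = f v.
Proof.
move=> fS; rewrite quotmod_lift.unlock; apply/eqP.
rewrite -subr_eq0 -linearB; apply/eqP.
set u := repr _; have : subspan S (u - v).
  by apply/qmpi_eq; rewrite /qmpi reprK.
elim=> [|x /fS //|x w _ fx _ fw|k x _ fx]; rewrite ?linear0 //.
  by rewrite linearD fx fw addr0.
by rewrite linearZ_LR fx scaler0.
Qed.

End QuotientModuleLift.

(* The two-sided ideal generated by S is the span of the products x * u * y   *)
(* with u in S; the quotient may be the zero ring, hence only a pzRingType.   *)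

Section QuotientAlgebra.
Variables (K : fieldType) (A : algType K) (S : A -> Prop).

Definition idealgen (z : A) : Prop := exists x u y, S u /\ z = x * u * y.

Definition quotalg : Type := quotmod idealgen.
HB.instance Definition _ := GRing.Lmodule.on quotalg.

Definition qapi : A -> quotalg := @qmpi K A idealgen.
HB.instance Definition _ := GRing.Linear.on qapi.

Lemma idealgen_mull x z : subspan idealgen z -> subspan idealgen (x * z).
Proof.
elim=> [|_ [a [u [b [Su ->]]]]|v w _ Sv _ Sw|k v _ Sv].
- by rewrite mulr0; apply: subspan0.
- by apply: subspan_gen; exists (x * a), u, b; rewrite !mulrA.
- by rewrite mulrDr; apply: subspanD.
- by rewrite -scalerAr; apply: subspanZ.
Qed.

Lemma idealgen_mulr x z : subspan idealgen z -> subspan idealgen (z * x).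
Proof.
elim=> [|_ [a [u [b [Su ->]]]]|v w _ Sv _ Sw|k v _ Sv].
- by rewrite mul0r; apply: subspan0.
- by apply: subspan_gen; exists a, u, (b * x); rewrite !mulrA.
- by rewrite mulrDl; apply: subspanD.
- by rewrite -scalerAl; apply: subspanZ.
Qed.

Lemma qapi_surj (x : quotalg) : exists a, x = qapi a.
Proof. exact: qmpi_surj. Qed.

End QuotientAlgebra.

HB.lock Definition quotalg_mul (K : fieldType) (A : algType K) (S : A -> Prop)
    (x y : quotalg S) : quotalg S :=
  quotmod_lift (fun a => quotmod_lift (fun b => qapi S (a * b)) y) x.

Section QuotientAlgebraRing.
Variables (K : fieldType) (A : algType K) (S : A -> Prop).
Local Notation quotalg := (quotalg S).
Local Notation qapi := (qapi S).
Local Notation idealgen := (idealgen S).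
Local Notation quotalg_mul := (@quotalg_mul K A S).

Lemma quotalg_mulE a b : quotalg_mul (qapi a) (qapi b) = qapi (a * b).
Proof.
rewrite quotalg_mul.unlock quotmod_lift.unlock.
set a' := repr _; set b' := repr _.
have Ia : subspan idealgen (a' - a) by apply/qmpi_eq; rewrite /qmpi reprK.
have Ib : subspan idealgen (b' - b) by apply/qmpi_eq; rewrite /qmpi reprK.
apply/qmpi_eq; have -> : a' * b' - a * b = (a' - a) * b' + a * (b' - b).
  by rewrite mulrBl mulrBr addrA addrNK.
by apply: subspanD; [apply: idealgen_mulr | apply: idealgen_mull].
Qed.

Fact quotalg_mulA : associative quotalg_mul.
Proof.
move=> x y z; have [a ->] := qapi_surj x; have [b ->] := qapi_surj y.
by have [c ->] := qapi_surj z; rewrite !quotalg_mulE mulrA.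
Qed.

Fact quotalg_mul1l : left_id (qapi 1) quotalg_mul.
Proof. by move=> x; have [a ->] := qapi_surj x; rewrite quotalg_mulE mul1r. Qed.

Fact quotalg_mul1r : right_id (qapi 1) quotalg_mul.
Proof. by move=> x; have [a ->] := qapi_surj x; rewrite quotalg_mulE mulr1. Qed.

Fact quotalg_mulDl : left_distributive quotalg_mul +%R.
Proof.
move=> x y z; have [a ->] := qapi_surj x; have [b ->] := qapi_surj y.
by have [c ->] := qapi_surj z; rewrite -raddfD !quotalg_mulE mulrDl raddfD.
Qed.

Fact quotalg_mulDr : right_distributive quotalg_mul +%R.
Proof.
move=> x y z; have [a ->] := qapi_surj x; have [b ->] := qapi_surj y.
by have [c ->] := qapi_surj z; rewrite -raddfD !quotalg_mulE mulrDr raddfD.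
Qed.

HB.instance Definition _ := GRing.Zmodule_isPzRing.Build quotalg
  quotalg_mulA quotalg_mul1l quotalg_mul1r quotalg_mulDl quotalg_mulDr.

Lemma qapi_monoid_morphism : monoid_morphism qapi.
Proof. by split=> // a b; rewrite -quotalg_mulE. Qed.

HB.instance Definition _ := GRing.isMonoidMorphism.Build A quotalg qapi
  qapi_monoid_morphism.

Lemma quotalg_scaleAl (k : K) (x y : quotalg) : k *: (x * y) = (k *: x) * y.
Proof.
have [a ->] := qapi_surj x; have [b ->] := qapi_surj y.
by rewrite -(rmorphM qapi) -!(linearZ_LR qapi) -(rmorphM qapi) scalerAl.
Qed.

Lemma quotalg_scaleAr (k : K) (x y : quotalg) : k *: (x * y) = x * (k *: y).
Proof.
have [a ->] := qapi_surj x; have [b ->] := qapi_surj y.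
by rewrite -(rmorphM qapi) -!(linearZ_LR qapi) -(rmorphM qapi) scalerAr.
Qed.

Lemma quotalg_neq0 (B : algType K) (phi : {lrmorphism A -> B}) :
  (forall u, S u -> phi u = 0) -> (1 : quotalg) != 0.
Proof.
move=> phiS; apply/eqP => one0.
have /qmpi_eq : qapi 1 = qapi 0 by rewrite raddf0 rmorph1.
rewrite subr0 => I1.
have: phi 1 = 0.
  elim: I1 => [|_ [a [u [b [Su ->]]]]|v w _ Sv _ Sw|k v _ Sv].
  - exact: rmorph0.
  - by rewrite !rmorphM /= (phiS _ Su) mulr0 mul0r.
  - by rewrite rmorphD /= Sv Sw addr0.
  - by rewrite linearZ /= Sv scaler0.
by move/eqP; rewrite rmorph1 oner_eq0.
Qed.

End QuotientAlgebraRing.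

Definition freealg (K : fieldType) (X : choiceType) : Type :=
  {malg K[{fmonom X}]}.

(* The operations are those of {malg K[{fmonom X}]}; the product is locked    *)
(* since comparing distinct unlocked monomials by conversion does not         *)
(* terminate in practice.                                                     *)
HB.lock Definition freealg_mul (K : fieldType) (X : choiceType)
    (x y : freealg K X) : freealg K X :=
  (x : {malg K[{fmonom X}]}) * (y : {malg K[{fmonom X}]}).

Section FreeAlgebra.
Variables (K : fieldType) (X : choiceType).
Local Notation freealg := (freealg K X).
Local Notation malgX := {malg K[{fmonom X}]}.
Local Notation freealg_mul := (@freealg_mul K X).

HB.instance Definition _ := GRing.Lmodule.copy freealg malgX.

Fact freealg_mulA : associative freealg_mul.
Proof. by move=> x y z; rewrite freealg_mul.unlock (@mulrA malgX). Qed.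

Fact freealg_mul1l : left_id (1 : malgX) freealg_mul.
Proof. by move=> x; rewrite freealg_mul.unlock (@mul1r malgX). Qed.

Fact freealg_mul1r : right_id (1 : malgX) freealg_mul.
Proof. by move=> x; rewrite freealg_mul.unlock (@mulr1 malgX). Qed.

Fact freealg_mulDl : left_distributive freealg_mul +%R.
Proof. by move=> x y z; rewrite freealg_mul.unlock; apply: (@mulrDl malgX). Qed.

Fact freealg_mulDr : right_distributive freealg_mul +%R.
Proof. by move=> x y z; rewrite freealg_mul.unlock; apply: (@mulrDr malgX). Qed.

Fact freealg_1_neq0 : (1 : malgX) != 0 :> freealg.
Proof. exact: (@oner_neq0 malgX). Qed.

HB.instance Definition _ := GRing.Zmodule_isNzRing.Build freealg
  freealg_mulA freealg_mul1l freealg_mul1r freealg_mulDl freealg_mulDr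
  freealg_1_neq0.

Lemma freealg_mulE (x y : freealg) : x * y = (x : malgX) * (y : malgX).
Proof. by rewrite -[LHS]/(freealg_mul x y) freealg_mul.unlock. Qed.

Lemma freealg_scaleAl (k : K) (x y : freealg) :
  k *: (x * y) = (k *: x : freealg) * y.
Proof. by rewrite !freealg_mulE; apply: (@scalerAl K malgX). Qed.

Lemma freealg_scaleAr (k : K) (x y : freealg) :
  k *: (x * y) = x * (k *: y : freealg).
Proof.
by rewrite !freealg_mulE; apply: (@malg_scaleAr K {fmonom X}).
Qed.

HB.instance Definition _ := GRing.Lmodule_isLalgebra.Build K freealg
  freealg_scaleAl.
HB.instance Definition _ := GRing.Lalgebra_isAlgebra.Build K freealg
  freealg_scaleAr.

End FreeAlgebra.

HB.lock Definition fvar (K : fieldType) (X : choiceType) (x : X) : freealg K X :=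
  << fmu x >>.

Section FreeAlgebraEval.
Variables (K : fieldType) (X : choiceType).
Local Notation freealg := (freealg K X).
Local Notation fvar := (fvar K).
Variables (B : algType K) (f : X -> B).

Definition freealg_eval : freealg -> B :=
  malg_lift (fun m : {fmonom X} => \prod_(x <- m) f x).

Lemma freealg_eval_linear : linear freealg_eval.
Proof. exact: malg_lift_linear. Qed.

Lemma freealg_evalX x : freealg_eval (fvar x) = f x.
Proof. by rewrite fvar.unlock /freealg_eval malg_liftU fmU big_seq1. Qed.

Lemma freealg_eval_monoid_morphism : monoid_morphism freealg_eval.
Proof.
split=> [|g1 g2].
  by rewrite /freealg_eval malg_liftU fm1 big_nil.
have evE g : freealg_eval g = \sum_(m <- msupp g) g@_m *: \prod_(x <- m) f x.
  by rewrite /freealg_eval malg_lift.unlock.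
rewrite freealg_mulE malgME (evE g1) (evE g2) /freealg_eval linear_sum /= mulr_suml; apply: eq_bigr => m1 _.
rewrite linear_sum /= mulr_sumr; apply: eq_bigr => m2 _.
rewrite malgU_scale linearZ /= malg_liftU fmM big_cat /=.
by rewrite -scalerAl -scalerAr scalerA.
Qed.

HB.instance Definition _ := GRing.isLinear.Build K freealg B _ freealg_eval
  freealg_eval_linear.
HB.instance Definition _ := GRing.isMonoidMorphism.Build freealg B freealg_eval
  freealg_eval_monoid_morphism.

End FreeAlgebraEval.

(* Algebra generated by X subject to the equations u = v for all u, v with    *)
(* E u v.                                                                     *)

Section Presented.
Variables (K : fieldType) (X : choiceType).
Variable E : freealg K X -> freealg K X -> Prop.

Definition relators (z : freealg K X) : Prop := exists u v, E u v /\ z = u - v.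

Definition presalg : Type := quotalg relators.
HB.instance Definition _ := GRing.PzRing.on presalg.
HB.instance Definition _ := GRing.Lmodule.on presalg.

Lemma presalg_neq0 (B : algType K) (f : X -> B) :
  (forall u v, E u v -> freealg_eval f u = freealg_eval f v) ->
  (1 : presalg) != 0.
Proof.
move=> fE; apply: (@quotalg_neq0 _ _ _ B (freealg_eval f)) => _ [u [v [Euv ->]]].
by rewrite rmorphB /= (fE u v Euv) subrr.
Qed.

End Presented.

HB.lock Definition pgen (K : fieldType) (X : choiceType)
    (E : freealg K X -> freealg K X -> Prop) (x : X) : presalg E :=
  qapi (relators E) (fvar K x).

Section Tensor.
Variables (K : fieldType) (V W : lmodType K).

Inductive bilinear_relator : {malg K[(V * W)%type]} -> Prop :=
  | bilinear_relatorDl v v' w :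
      bilinear_relator (<< (v + v', w) >> - << (v, w) >> - << (v', w) >>)
  | bilinear_relatorDr v w w' :
      bilinear_relator (<< (v, w + w') >> - << (v, w) >> - << (v, w') >>)
  | bilinear_relatorZl k v w :
      bilinear_relator (<< (k *: v, w) >> - k *: << (v, w) >>)
  | bilinear_relatorZr k v w :
      bilinear_relator (<< (v, k *: w) >> - k *: << (v, w) >>).

Definition tens : Type := quotmod bilinear_relator.
HB.instance Definition _ := GRing.Lmodule.on tens.

Definition tpure (v : V) (w : W) : tens := qmpi bilinear_relator << (v, w) >>.

Lemma tpure_bilinear : bilinear_for *:%R *:%R tpure.
Proof.
have pi0 u : bilinear_relator u -> qmpi bilinear_relator u = 0.
  exact: qmpi_gen0.
split=> [w k v v'|v k w w'] /=; rewrite /tpure.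
  have /eqP := pi0 _ (bilinear_relatorDl (k *: v) v' w).
  have /eqP := pi0 _ (bilinear_relatorZl k v w).
  rewrite raddfB /= linearZ_LR subr_eq0 => /eqP <-.
  by rewrite !raddfB /= -addrA -opprD subr_eq0 => /eqP.
have /eqP := pi0 _ (bilinear_relatorDr v (k *: w) w').
have /eqP := pi0 _ (bilinear_relatorZr k v w).
rewrite raddfB /= linearZ_LR subr_eq0 => /eqP <-.
by rewrite !raddfB /= -addrA -opprD subr_eq0 => /eqP.
Qed.

Lemma tens_ind (P : tens -> Prop) :
  P 0 -> (forall v w, P (tpure v w)) -> (forall x y, P x -> P y -> P (x + y)) ->
  forall x, P x.
Proof.
move=> P0 Ppure PD x; have [g ->] := qmpi_surj x.
rewrite (monalgE g) raddf_sum /=; apply: big_ind => // -[v w] _.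
rewrite malgU_scale linearZ_LR -[_ << (v, w) >>]/(tpure v w).
have := (tpure_bilinear.1 w) g@_(v, w) v 0; rewrite /= addr0.
have -> : tpure 0 w = 0.
  by have := (tpure_bilinear.1 w) (-1) 0 0; rewrite /= scaler0 addr0 scaleN1r addNr.
by rewrite addr0 => <-.
Qed.

End Tensor.

(* The linear map v (x) w |-> f v w; meaningful for bilinear f only. *)
HB.lock Definition tlift (K : fieldType) (V W Z : lmodType K)
    (f : V -> W -> Z) : tens V W -> Z :=
  quotmod_lift (malg_lift (fun p => f p.1 p.2)).

Section Lift.
Variables (K : fieldType) (V W Z : lmodType K) (f : V -> W -> Z).
Hypothesis f_bil : bilinear_for *:%R *:%R f.

Let F : {linear {malg K[(V * W)%type]} -> Z} := malg_lift (fun p => f p.1 p.2).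

Let F_relator u : bilinear_relator u -> F u = 0.
Proof.
have fD w v v' : f (v + v') w = f v w + f v' w.
  by have := f_bil.1 w 1 v v'; rewrite /= !scale1r.
have gD v w w' : f v (w + w') = f v w + f v w'.
  by have := f_bil.2 v 1 w w'; rewrite /= !scale1r.
have f0 w : f 0 w = 0 by apply: (addIr (f 0 w)); rewrite -fD !add0r.
have g0 v : f v 0 = 0 by apply: (addIr (f v 0)); rewrite -gD !add0r.
case=> [v v' w|v w w'|k v w|k v w]; rewrite !linearB /= ?linearZ /= !malg_liftU /=.
- by rewrite fD (addrC (f v w)) addrK subrr.
- by rewrite gD (addrC (f v w)) addrK subrr.
- by have := f_bil.1 w k v 0; rewrite /= f0 !addr0 => ->; rewrite scalerN subrr.
- by have := f_bil.2 v k w 0; rewrite /= g0 !addr0 => ->; rewrite scalerN subrr.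
Qed.

Lemma tliftE v w : tlift f (tpure v w) = f v w.
Proof. by rewrite tlift.unlock /tpure (quotmod_liftE (f := F) _ F_relator) /= malg_liftU. Qed.

Lemma tlift_linear : linear (tlift f).
Proof.
move=> k x y; have [g ->] := qmpi_surj x; have [h ->] := qmpi_surj y.
rewrite -linearP tlift.unlock !(quotmod_liftE (f := F) _ F_relator) linearP.
by [].
Qed.

End Lift.

Definition tmap (K : fieldType) (V W V' W' : lmodType K) (f : V -> V')
    (g : W -> W') : tens V W -> tens V' W' :=
  tlift (fun v w => tpure (f v) (g w)).

Definition tassoc (K : fieldType) (V W X : lmodType K) :
    tens (tens V W) X -> tens V (tens W X) :=
  tlift (fun vw x => tlift (fun v w => tpure v (tpure w x)) vw).

HB.lock Definition tens_mul (K : fieldType) (A B : algType K)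
    (x y : tens A B) : tens A B :=
  tlift (fun a b => tlift (fun c d => tpure (a * c) (b * d)) y) x.

Section TensorAlgebra.
Variables (K : fieldType) (A B : algType K).
Local Notation T := (tens A B).
Local Notation tens_mul := (@tens_mul K A B).

Let inner_bil (a : A) (b : B) :
  bilinear_for *:%R *:%R (fun c d => tpure (a * c) (b * d) : T).
Proof.
split=> [d k c c'|c k d d'] /=; rewrite mulrDr -scalerAr.
  exact: ((tpure_bilinear A B).1 (b * d) k (a * c) (a * c')).
exact: ((tpure_bilinear A B).2 (a * c) k (b * d) (b * d')).
Qed.

Let inner_lin (a : A) (b : B) := tlift_linear (inner_bil a b).

Let linear_comb_eq (k : K) (L1 L2 L3 : T -> T) :
    linear L1 -> linear L2 -> linear L3 ->
    (forall c d, L1 (tpure c d) = k *: L2 (tpure c d) + L3 (tpure c d)) ->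
  forall y, L1 y = k *: L2 y + L3 y.
Proof.
have lin0 (L : T -> T) : linear L -> L 0 = 0.
  by move=> linL; have := linL (-1) 0 0; rewrite !scaleN1r !addNr.
have linD (L : T -> T) : linear L -> {morph L : u v / u + v}.
  by move=> linL u v; have := linL 1 u v; rewrite !scale1r.
move=> l1 l2 l3 Lpure y; elim/tens_ind: y => // [|u v IHu IHv].
  by rewrite (lin0 L1) // (lin0 L2) // (lin0 L3) // scaler0 addr0.
by rewrite (linD L1) // (linD L2) // (linD L3) // IHu IHv scalerDr addrACA.
Qed.

Let outer_bil (y : T) : bilinear_for *:%R *:%R
  (fun a b => tlift (fun c d => tpure (a * c) (b * d) : T) y).
Proof.
split=> [b k a a'|a k b b'] /=.
  apply: linear_comb_eq y; try exact: inner_lin.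
  move=> c d; rewrite !(tliftE (inner_bil _ _)) mulrDl -scalerAl.
  exact: ((tpure_bilinear A B).1 (b * d) k (a * c) (a' * c)).
apply: linear_comb_eq y; try exact: inner_lin.
move=> c d; rewrite !(tliftE (inner_bil _ _)) mulrDl -scalerAl.
exact: ((tpure_bilinear A B).2 (a * c) k (b * d) (b' * d)).
Qed.

Lemma tens_mulE a b c d :
  tens_mul (tpure a b) (tpure c d) = tpure (a * c) (b * d).
Proof.
by rewrite tens_mul.unlock (tliftE (outer_bil _)) (tliftE (inner_bil _ _)).
Qed.

Fact tens_mulDl : left_distributive tens_mul +%R.
Proof.
move=> x y z; rewrite tens_mul.unlock.
by have := tlift_linear (outer_bil z) 1 x y; rewrite !scale1r.
Qed.

Fact tens_mulDr : right_distributive tens_mul +%R.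
Proof.
move=> x y z; elim/tens_ind: x => [|a b|x x' IH IH'].
- have tm0 u : tens_mul 0 u = 0.
    rewrite tens_mul.unlock; have := tlift_linear (outer_bil u) (-1) 0 0.
    by rewrite /= scaler0 addr0 scaleN1r addNr.
  by rewrite !tm0 addr0.
- have mulE u : tens_mul (tpure a b) u = tlift (fun c d => tpure (a * c) (b * d)) u.
    by rewrite tens_mul.unlock; exact: tliftE (outer_bil u) a b.
  by have := inner_lin a b 1 y z; rewrite !scale1r -!mulE.
- by rewrite (tens_mulDl x x' (y + z)) (tens_mulDl x x' y) (tens_mulDl x x' z) IH IH' addrACA.
Qed.

Let tens_mul0l x : tens_mul 0 x = 0.
Proof. by apply: (addIr (tens_mul 0 x)); rewrite -tens_mulDl !add0r. Qed.

Let tens_mul0r x : tens_mul x 0 = 0.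
Proof. by apply: (addIr (tens_mul x 0)); rewrite -tens_mulDr !add0r. Qed.

Fact tens_mulA : associative tens_mul.
Proof.
move=> x y z; elim/tens_ind: x => [|a b|x x' IH IH'].
- by rewrite !tens_mul0l.
- elim/tens_ind: y => [|c d|y y' IH IH'].
  + by rewrite tens_mul0l !tens_mul0r tens_mul0l.
  + elim/tens_ind: z => [|e f|z z' IH IH'].
    * by rewrite !tens_mul0r.
    * by rewrite !tens_mulE !mulrA.
    * by rewrite !tens_mulDr IH IH'.
  + by rewrite tens_mulDl !tens_mulDr IH IH' tens_mulDl.
- by rewrite !tens_mulDl IH IH'.
Qed.

Fact tens_mul1l : left_id (tpure 1 1) tens_mul.
Proof.
move=> x; elim/tens_ind: x => [|a b|x x' IH IH']; first exact: tens_mul0r.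
  by rewrite tens_mulE !mul1r.
by rewrite tens_mulDr IH IH'.
Qed.

Fact tens_mul1r : right_id (tpure 1 1) tens_mul.
Proof.
move=> x; elim/tens_ind: x => [|a b|x x' IH IH']; first exact: tens_mul0l.
  by rewrite tens_mulE !mulr1.
by rewrite tens_mulDl IH IH'.
Qed.

HB.instance Definition _ := GRing.Zmodule_isPzRing.Build T
  tens_mulA tens_mul1l tens_mul1r tens_mulDl tens_mulDr.

End TensorAlgebra.

Section Hopf.
Variable K : fieldType.

Record hopf (A : algType K) := Hopf {
  comul : {linear A -> tens A A};
  counit : {scalar A};
  antipode : {linear A -> A};
  comul_mult : monoid_morphism comul;
  counit_mult : monoid_morphism counit;
  comul_coassoc x :
    tassoc (tmap comul id (comul x)) = tmap id comul (comul x);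
  counit_l x : tlift (fun a b => counit a *: b) (comul x) = x;
  counit_r x : tlift (fun a b => counit b *: a) (comul x) = x;
  antipode_l x : tlift (fun a b => antipode a * b) (comul x) = (counit x)%:A;
  antipode_r x : tlift (fun a b => a * antipode b) (comul x) = (counit x)%:A
}.

Definition hopf_isomorphism (A B : algType K) (HA : hopf A) (HB : hopf B)
    (f : {lrmorphism A -> B}) : Prop :=
  [/\ bijective f,
      forall x, comul HB (f x) = tmap f f (comul HA x),
      forall x, counit HB (f x) = counit HA x
    & forall x, antipode HB (f x) = f (antipode HA x)].

End Hopf.

Definition transcendental (K : fieldType) (x : K) : Prop :=
  forall p : {poly int},
    root (map_poly intr p) x -> map_poly intr p = 0 :> {poly K}.

Section RSNumbers.
Variables (K : fieldType) (r s : K).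

Definition rs_int (m : nat) : K := (r ^+ m - s ^+ m) / (r - s).
Definition rs_fact (m : nat) : K := \prod_(1 <= i < m.+1) rs_int i.
Definition rs_bin (m k : nat) : K := rs_fact m / (rs_fact k * rs_fact (m - k)).

End RSNumbers.

Definition cartanA (n : nat) (i j : 'I_n) : int :=
  if i == j then 2 else if (i.+1 == j) || (j.+1 == i) then -1 else 0.

Definition eulerA (n : nat) (i j : 'I_n) : int :=
  if (i < j)%N then cartanA i j else if i == j then 1 else 0.

Inductive gl_gen (n : nat) : Type :=
  | Ge of 'I_n | Gf of 'I_n
  | Ga of 'I_n.+1 | GaV of 'I_n.+1
  | Ga' of 'I_n.+1 | Ga'V of 'I_n.+1.

HB.instance Definition _ n := gen_eqMixin (gl_gen n).
HB.instance Definition _ n := gen_choiceMixin (gl_gen n).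

Section UglDef.
Variables (K : fieldType) (n : nat) (r s : K).

Definition lo (i : 'I_n) : 'I_n.+1 := widen_ord (leqnSn n) i.
Definition hi (i : 'I_n) : 'I_n.+1 := lift ord0 i.

Local Notation F := (freealg K (gl_gen n)).
Local Notation e i := (fvar K (Ge i)).
Local Notation f i := (fvar K (Gf i)).
Local Notation a j := (fvar K (Ga j)).
Local Notation aV j := (fvar K (GaV j)).
Local Notation a' j := (fvar K (Ga' j)).
Local Notation a'V j := (fvar K (Ga'V j)).

Definition serre_deg (i j : 'I_n) : nat := `|1 - cartanA i j|%N.

Definition serre_coef (i j : 'I_n) (k : nat) : K :=
  (-1) ^+ k * rs_bin r s (serre_deg i j) k
  * (r * s) ^ (((k * k.-1)./2)%:Z + k%:Z * eulerA j i).

Inductive gl_eq : F -> F -> Prop :=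
  | gl_aaV j : gl_eq (a j * aV j) 1
  | gl_aVa j : gl_eq (aV j * a j) 1
  | gl_a'a'V j : gl_eq (a' j * a'V j) 1
  | gl_a'Va' j : gl_eq (a'V j * a' j) 1
  | gl_aa i j : gl_eq (a i * a j) (a j * a i)
  | gl_aa' i j : gl_eq (a i * a' j) (a' j * a i)
  | gl_a'a' i j : gl_eq (a' i * a' j) (a' j * a' i)
  | gl_ae_far (i : 'I_n.+1) (j : 'I_n) : (i < j)%N || (j.+1 < i)%N ->
      gl_eq (a i * e j) (e j * a i)
  | gl_af_far (i : 'I_n.+1) (j : 'I_n) : (i < j)%N || (j.+1 < i)%N ->
      gl_eq (a i * f j) (f j * a i)
  | gl_a'e_far (i : 'I_n.+1) (j : 'I_n) : (i < j)%N || (j.+1 < i)%N ->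
      gl_eq (a' i * e j) (e j * a' i)
  | gl_a'f_far (i : 'I_n.+1) (j : 'I_n) : (i < j)%N || (j.+1 < i)%N ->
      gl_eq (a' i * f j) (f j * a' i)
  | gl_ae_lo i : gl_eq (a (lo i) * e i) (s^-1 *: (e i * a (lo i)))
  | gl_af_lo i : gl_eq (a (lo i) * f i) (s *: (f i * a (lo i)))
  | gl_a'e_lo i : gl_eq (a' (lo i) * e i) (r^-1 *: (e i * a' (lo i)))
  | gl_a'f_lo i : gl_eq (a' (lo i) * f i) (r *: (f i * a' (lo i)))
  | gl_ae_hi i : gl_eq (a (hi i) * e i) (r^-1 *: (e i * a (hi i)))
  | gl_af_hi i : gl_eq (a (hi i) * f i) (r *: (f i * a (hi i)))
  | gl_a'e_hi i : gl_eq (a' (hi i) * e i) (s^-1 *: (e i * a' (hi i)))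
  | gl_a'f_hi i : gl_eq (a' (hi i) * f i) (s *: (f i * a' (hi i)))
  | gl_ef i j : gl_eq (e i * f j - f j * e i)
      ((i == j)%:R *: ((r - s)^-1 *:
        (a (lo i) * aV (hi i) - a' (lo i) * a'V (hi i))))
  | gl_serre_e i j : i != j ->
      gl_eq (\sum_(k < (serre_deg i j).+1)
        serre_coef i j k *: (e i ^+ (serre_deg i j - k) * e j * e i ^+ k)) 0
  | gl_serre_f i j : i != j ->
      gl_eq (\sum_(k < (serre_deg i j).+1)
        serre_coef i j k *: (f i ^+ k * f j * f i ^+ (serre_deg i j - k))) 0.

Definition Ugl : Type := presalg gl_eq.
HB.instance Definition _ := GRing.PzRing.on Ugl.
HB.instance Definition _ := GRing.Lmodule.on Ugl.

Let aug (x : gl_gen n) : K^o :=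
  match x with Ge _ => 0 | Gf _ => 0 | _ => 1 end.

Fact Ugl_neq0 : (1 : Ugl) != 0.
Proof.
apply: (@presalg_neq0 _ _ _ K^o aug) => u v E.
pose phi : {lrmorphism F -> K^o} := freealg_eval aug.
rewrite -[freealg_eval aug]/(phi : F -> K^o).
have phiX x : phi (fvar K x) = aug x by apply: freealg_evalX.
move: phi phiX => phi phiX.
have phiM x y : phi (x * y) = phi x * phi y by apply: rmorphM.
have phiZ k x : phi (k *: x) = k * phi x by rewrite linearZ.
have phiB x y : phi (x - y) = phi x - phi y by apply: raddfB.
have serre0 (m : nat) (c : nat -> K) (x y z : nat -> F) :
    (forall k, phi (y k) = 0) ->
  phi (\sum_(k < m) c k *: (x k * y k * z k)) = phi 0.
  move=> y0; rewrite raddf_sum raddf0 big1 //= => k _.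
  by rewrite phiZ !phiM y0 mulr0 mul0r mulr0.
case: E => [j|j|j|j|i j|i j|i j|i j _|i j _|i j _|i j _|i|i|i|i|i|i|i|i|i j
  |i j _|i j _].
1-4: by rewrite (phiM _ _) !phiX (rmorph1 phi) mulr1.
1-3: by rewrite !phiM !phiX.
1-4: by rewrite !phiM !phiX mulr0 mul0r.
1-8: by rewrite phiZ !phiM !phiX mulr0 mul0r mulr0.
- by rewrite !phiZ !phiB !phiM !phiX !mulr0 !mulr1 !subrr !mulr0.
- apply: (serre0 _ (serre_coef i j) (fun k => e i ^+ (serre_deg i j - k))
    (fun=> e j) (fun k => e i ^+ k)) => k; exact: phiX.
- apply: (serre0 _ (serre_coef i j) (fun k => f i ^+ k)
    (fun=> f j) (fun k => f i ^+ (serre_deg i j - k))) => k; exact: phiX.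
Qed.

HB.instance Definition _ := GRing.PzSemiRing_isNonZero.Build Ugl Ugl_neq0.
HB.instance Definition _ := GRing.Lmodule_isLalgebra.Build K Ugl
  (@quotalg_scaleAl _ _ _).
HB.instance Definition _ := GRing.Lalgebra_isAlgebra.Build K Ugl
  (@quotalg_scaleAr _ _ _).

Definition gl_e (i : 'I_n) : Ugl := pgen gl_eq (Ge i).
Definition gl_f (i : 'I_n) : Ugl := pgen gl_eq (Gf i).
Definition gl_a (j : 'I_n.+1) : Ugl := pgen gl_eq (Ga j).
Definition gl_aV (j : 'I_n.+1) : Ugl := pgen gl_eq (GaV j).
Definition gl_a' (j : 'I_n.+1) : Ugl := pgen gl_eq (Ga' j).
Definition gl_a'V (j : 'I_n.+1) : Ugl := pgen gl_eq (Ga'V j).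

Definition gl_w (i : 'I_n) : Ugl := gl_a (lo i) * gl_aV (hi i).
Definition gl_wV (i : 'I_n) : Ugl := gl_a (hi i) * gl_aV (lo i).
Definition gl_w' (i : 'I_n) : Ugl := gl_a' (lo i) * gl_a'V (hi i).
Definition gl_w'V (i : 'I_n) : Ugl := gl_a' (hi i) * gl_a'V (lo i).

Record Ugl_hopf_spec (H : hopf Ugl) : Prop := {
  comul_a j : comul H (gl_a j) = tpure (gl_a j) (gl_a j);
  comul_a' j : comul H (gl_a' j) = tpure (gl_a' j) (gl_a' j);
  comul_e i : comul H (gl_e i) = tpure (gl_e i) 1 + tpure (gl_w i) (gl_e i);
  comul_f i : comul H (gl_f i) = tpure 1 (gl_f i) + tpure (gl_f i) (gl_w' i);
  counit_a j : counit H (gl_a j) = 1;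
  counit_a' j : counit H (gl_a' j) = 1;
  counit_e i : counit H (gl_e i) = 0;
  counit_f i : counit H (gl_f i) = 0;
  antipode_a j : antipode H (gl_a j) = gl_aV j;
  antipode_a' j : antipode H (gl_a' j) = gl_a'V j;
  antipode_e i : antipode H (gl_e i) = - (gl_wV i * gl_e i);
  antipode_f i : antipode H (gl_f i) = - (gl_f i * gl_w'V i)
}.

End UglDef.

(* 'M[T]_#|{: 'I_N * 'I_N}| stands for End(K^N) (x) End(K^N) (x) T, where the *)
(* pair enum_val p indexes the basis vector v_(enum_val p).1 (x)              *)
(* v_(enum_val p).2 of K^N (x) K^N.                                           *)

Section Kronecker.
Variables (T : pzRingType) (N : nat).

Definition kron (A B : 'M[T]_N) : 'M[T]_#|{: 'I_N * 'I_N}| :=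
  \matrix_(p, q) (A (enum_val p).1 (enum_val q).1
                  * B (enum_val p).2 (enum_val q).2).

End Kronecker.

Section RMatrix.
Variables (K : fieldType) (N : nat) (r s : K).

Local Notation E i j := (delta_mx i j : 'M[K]_N).

Definition flip : 'M[K]_#|{: 'I_N * 'I_N}| :=
  \sum_(i < N) \sum_(j < N) kron (E i j) (E j i).

Definition Rhat : 'M[K]_#|{: 'I_N * 'I_N}| :=
  \sum_(i < N) kron (E i i) (E i i)
  + r *: (\sum_(i < N) \sum_(j < N | (i < j)%N) kron (E j i) (E i j))
  + s^-1 *: (\sum_(i < N) \sum_(j < N | (i < j)%N) kron (E i j) (E j i))
  + (1 - r * s^-1) *:
      (\sum_(i < N) \sum_(j < N | (i < j)%N) kron (E j j) (E i i)).

Definition Rmx : 'M[K]_#|{: 'I_N * 'I_N}| := Rhat *m flip.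

End RMatrix.

(* (i, j) : tri N indexes both ell^+_(j i) and ell^-_(i j). *)
Definition tri (N : nat) : Type := {p : 'I_N * 'I_N | (p.1 <= p.2)%N}.

Inductive frt_gen (N : nat) : Type :=
  | Glp of tri N | Glm of tri N | GlpV of 'I_N | GlmV of 'I_N.

HB.instance Definition _ N := gen_eqMixin (frt_gen N).
HB.instance Definition _ N := gen_choiceMixin (frt_gen N).

Section FRTDef.
Variables (K : fieldType) (N : nat) (R : 'M[K]_#|{: 'I_N * 'I_N}|).

Local Notation F := (freealg K (frt_gen N)).

Definition upper_mx (A : pzRingType) (l : tri N -> A) : 'M[A]_N :=
  \matrix_(i, j) if insub (i, j) is Some p then l p else 0.

Definition free_Lp : 'M[F]_N := (upper_mx (fun p => fvar K (Glp p)))^T.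
Definition free_Lm : 'M[F]_N := upper_mx (fun p => fvar K (Glm p)).

Definition RLL_l (L M : 'M[F]_N) : 'M[F]_#|{: 'I_N * 'I_N}| :=
  map_mx (in_alg F) R *m kron L 1%:M *m kron 1%:M M.
Definition RLL_r (L M : 'M[F]_N) : 'M[F]_#|{: 'I_N * 'I_N}| :=
  kron 1%:M M *m kron L 1%:M *m map_mx (in_alg F) R.

Inductive frt_eq : F -> F -> Prop :=
  | frt_pp x y : frt_eq (RLL_l free_Lp free_Lp x y) (RLL_r free_Lp free_Lp x y)
  | frt_mm x y : frt_eq (RLL_l free_Lm free_Lm x y) (RLL_r free_Lm free_Lm x y)
  | frt_pm x y : frt_eq (RLL_l free_Lp free_Lm x y) (RLL_r free_Lp free_Lm x y)
  | frt_pV i : frt_eq (free_Lp i i * fvar K (GlpV i)) 1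
  | frt_Vp i : frt_eq (fvar K (GlpV i) * free_Lp i i) 1
  | frt_mV i : frt_eq (free_Lm i i * fvar K (GlmV i)) 1
  | frt_Vm i : frt_eq (fvar K (GlmV i) * free_Lm i i) 1.

Definition UR : Type := presalg frt_eq.
HB.instance Definition _ := GRing.PzRing.on UR.
HB.instance Definition _ := GRing.Lmodule.on UR.

Let aug (x : frt_gen N) : K^o :=
  match x with
  | Glp p | Glm p => ((val p).1 == (val p).2)%:R
  | _ => 1
  end.

Fact UR_neq0 : (1 : UR) != 0.
Proof.
apply: (@presalg_neq0 _ _ _ K^o aug) => u v E.
have upE (c : tri N -> frt_gen N) i j :
    (forall p, aug (c p) = ((val p).1 == (val p).2)%:R) ->
    freealg_eval aug (upper_mx (fun p => fvar K (c p)) i j) = (i == j)%:R.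
  move=> augc; rewrite mxE; case: insubP => [p _ pE|/= nle].
    by rewrite freealg_evalX augc pE.
  by rewrite raddf0; case: eqP nle => // ->; rewrite leqnn.
have LpE : map_mx (freealg_eval aug) free_Lp = 1%:M.
  by apply/matrixP => i j; rewrite mxE [free_Lp i j]mxE upE // mxE eq_sym.
have LmE : map_mx (freealg_eval aug) free_Lm = 1%:M.
  by apply/matrixP => i j; rewrite mxE upE // mxE.
have kronE (L M : 'M[F]_N) : map_mx (freealg_eval aug) (kron L M)
    = kron (map_mx (freealg_eval aug) L) (map_mx (freealg_eval aug) M).
  by apply/matrixP => x y; rewrite !mxE rmorphM.
have kron1 : kron 1%:M 1%:M = 1%:M :> 'M[K^o]_#|{: 'I_N * 'I_N}|.
  apply/matrixP => x y; rewrite !mxE -natrM mulnb.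
  rewrite -(inj_eq enum_val_inj).
  by case: (enum_val x) (enum_val y) => [i j] [k l]; rewrite xpair_eqE.
have RLL (L M : 'M[F]_N) x y : map_mx (freealg_eval aug) L = 1%:M ->
    map_mx (freealg_eval aug) M = 1%:M ->
    freealg_eval aug (RLL_l L M x y) = freealg_eval aug (RLL_r L M x y).
  move=> LE ME; have := congr1 (fun A : 'M[K^o]__ => A x y)
    (_ : map_mx (freealg_eval aug) (RLL_l L M)
         = map_mx (freealg_eval aug) (RLL_r L M)).
  rewrite !mxE; apply.
  rewrite /RLL_l /RLL_r !map_mxM !kronE LE ME !map_mx1 !kron1.
  by rewrite !mulmx1 !mul1mx.
have LpiE i : freealg_eval aug (free_Lp i i) = 1.
  by have := congr1 (fun A : 'M[K^o]_N => A i i) LpE; rewrite !mxE eqxx.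
have LmiE i : freealg_eval aug (free_Lm i i) = 1.
  by have := congr1 (fun A : 'M[K^o]_N => A i i) LmE; rewrite !mxE eqxx.
case: E => *; rewrite ?RLL // rmorphM rmorph1 /= ?LpiE ?LmiE freealg_evalX;
  by rewrite mulr1.
Qed.

HB.instance Definition _ := GRing.PzSemiRing_isNonZero.Build UR UR_neq0.
HB.instance Definition _ := GRing.Lmodule_isLalgebra.Build K UR
  (@quotalg_scaleAl _ _ _).
HB.instance Definition _ := GRing.Lalgebra_isAlgebra.Build K UR
  (@quotalg_scaleAr _ _ _).

Definition Lp : 'M[UR]_N := (upper_mx (fun p => pgen frt_eq (Glp p) : UR))^T.
Definition Lm : 'M[UR]_N := upper_mx (fun p => pgen frt_eq (Glm p) : UR).
Definition LpV (i : 'I_N) : UR := pgen frt_eq (GlpV i).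
Definition LmV (i : 'I_N) : UR := pgen frt_eq (GlmV i).

Record UR_hopf_spec (H : hopf UR) : Prop := {
  comul_Lp i j : comul H (Lp i j) = \sum_k tpure (Lp i k) (Lp k j);
  comul_Lm i j : comul H (Lm i j) = \sum_k tpure (Lm i k) (Lm k j);
  counit_Lp i j : counit H (Lp i j) = (i == j)%:R;
  counit_Lm i j : counit H (Lm i j) = (i == j)%:R;
  antipode_Lp : Lp *m map_mx (antipode H) Lp = 1%:M
                /\ map_mx (antipode H) Lp *m Lp = 1%:M;
  antipode_Lm : Lm *m map_mx (antipode H) Lm = 1%:M
                /\ map_mx (antipode H) Lm *m Lm = 1%:M
}.

End FRTDef.

(* Main.v *)
(* Iterated (r, s)-commutators of the e_i, multiplied by diagonal elements,   *)
(* are the entries of a lower triangular matrix satisfying R L1 L2 = L2 L1 R; *)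
(* the f_i give an upper triangular one, by the same computation in the       *)
(* opposite algebra with r and s exchanged. The relation between the two      *)
(* matrices is propagated from [e_i, f_j] along root vectors. Conversely, the *)
(* diagonal and first off-diagonal entries of L^+ and L^- satisfy the         *)
(* relations of U_{r,s}(gl_{n+1}), and they determine the other entries, so   *)
(* the two algebra maps are mutually inverse. On U(R) the coproduct exists    *)
(* because a product of two commuting solutions of the RLL relations is a     *)
(* solution, and the antipode because L^{-1} is a solution in the opposite    *)
(* algebra. This Hopf structure is transported to U_{r,s}(gl_{n+1}).          *)

From HB Require Import structures.
From mathcomp Require Import all_boot all_order all_algebra.
From mathcomp Require Import finmap boolp monalg zify ring.
Require Import Defs.

Set Implicit Arguments.
Unset Strict Implicit.
Unset Printing Implicit Defensive.

Import GRing.Theory.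
Local Open Scope ring_scope.
Set Bullet Behavior "Strict Subproofs".

(** * Linear combinations of noncommutative identities *)

(** Written entry by entry, R L1 L2 = L2 L1 R is a list of quadratic relations ([qmat]); for a lower
    triangular L with invertible diagonal it says that the entries are root vectors times diagonal
    elements.

    From e to ell^+. Put E i (j+1) = r e_j E i j - E i j e_j ([rootvec]). The Serre relations imply
    the quadratic relations between root vectors whose intervals share an end, are disjoint, abut,
    are nested or cross. The heart of this is [rootvec_cross_of_ends]: computing E i k E j l in two
    ways shows that r + s kills the commutator of two nested root vectors, and r + s is nonzero
    because r s^-1 is not a root of unity. Hence the lower triangular matrix with diagonal a_i^-1
    and entries (r - s) E i j a_i^-1 is a solution ([borelL_qmat]). The same statement in the
    opposite algebra, with r and s exchanged, gives ell^- from the f_i.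

    The mixed relation R L1^+ L2^- = L2^- L1^+ R is the same as R^-1 L2^- L1^+ = L1^+ L2^- R^-1,
    which says that L^+ intertwines two actions of the entries of L^-. For ell^-_jj and
    ell^-_(j,j+1) this is a computation with [e_i, f_j] along root vectors ([rllV_diag],
    [rllV_next]). The other entries follow ([rllV_all]), since (r - s) ell^-_ll ell^-_(j,l+1) is the
    commutator of ell^-_(l,l+1) and ell^-_jl, the actions respect this identity, and ell^-_ll is
    invertible. So [frt_of_gl] yields an algebra map from U(R) to U_{r,s}(gl_{n+1}).

    Back from L^+ and L^-. The Serre relations, the weights and the commutators [e_i, f_j] are all
    contained in entries of the RLL relations ([mat_borel], [cross_xy]), so [gl_of_frt] yields the
    map theta in the other direction. One composite visibly fixes the generators a, a', e, f. The
    other fixes every ell because the entries off the diagonal satisfy the recursion of root vectors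
    ([matE_rootvec]).

    Hopf structures. By the universal property of U(R), the coproduct exists because a product of
    two commuting solutions is a solution ([rll_mx_prod]), and the antipode because inverses are
    solutions in the opposite algebra ([rll_mx_op]). The axioms need checking only on entries of
    comultiplicative matrices ([hopf_of_coefficients]). Transporting this structure makes theta a
    Hopf isomorphism by construction; triangularity of L^+ and L^- then shows that the a_j, a'_j are
    grouplike and the e_i, f_i skew primitive with the prescribed coproducts, which forces counit
    and antipode ([gl_counit_antipode]). *)

Section NCReflection.
Variables (K : fieldType) (A : algType K).

(** Noncommutative polynomials in the atoms of a list. The normal form is a list of coefficients and
    words, so that an identity in A is reduced to identities between coefficients in the commutative
    field K. *)
Inductive ncexpr : Type :=
  | NCvar of nat | NCzero | NCone
  | NCadd of ncexpr & ncexpr | NCopp of ncexpr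
  | NCmul of ncexpr & ncexpr | NCscale of K & ncexpr.

Fixpoint nc_eval (vs : seq A) (e : ncexpr) : A :=
  match e with
  | NCvar n => nth 0 vs n
  | NCzero => 0
  | NCone => 1
  | NCadd a b => nc_eval vs a + nc_eval vs b
  | NCopp a => - nc_eval vs a
  | NCmul a b => nc_eval vs a * nc_eval vs b
  | NCscale c a => c *: nc_eval vs a
  end.

Fixpoint nc_app (s t : seq nat) : seq nat :=
  match s with [::] => t | x :: s' => x :: nc_app s' t end.

Fixpoint nc_cat (l m : seq (K * seq nat)) : seq (K * seq nat) :=
  match l with [::] => m | x :: l' => x :: nc_cat l' m end.

Fixpoint nc_scale (c : K) (l : seq (K * seq nat)) : seq (K * seq nat) :=
  match l with [::] => [::] | (d, w) :: l' => (c * d, w) :: nc_scale c l' end.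

Fixpoint nc_mul1 (c : K) (v : seq nat) (l : seq (K * seq nat)) :
    seq (K * seq nat) :=
  match l with
  | [::] => [::] | (d, w) :: l' => (c * d, nc_app v w) :: nc_mul1 c v l'
  end.

Fixpoint nc_mul (l m : seq (K * seq nat)) : seq (K * seq nat) :=
  match l with
  | [::] => [::] | (c, v) :: l' => nc_cat (nc_mul1 c v m) (nc_mul l' m)
  end.

Fixpoint nc_norm (e : ncexpr) : seq (K * seq nat) :=
  match e with
  | NCvar n => [:: (1, [:: n])]
  | NCzero => [::]
  | NCone => [:: (1, [::])]
  | NCadd a b => nc_cat (nc_norm a) (nc_norm b)
  | NCopp a => nc_scale (-1) (nc_norm a)
  | NCmul a b => nc_mul (nc_norm a) (nc_norm b)
  | NCscale c a => nc_scale c (nc_norm a)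
  end.

Fixpoint nc_eqn (m n : nat) : bool :=
  match m, n with
  | O, O => true | S m', S n' => nc_eqn m' n' | _, _ => false
  end.

Fixpoint nc_eqw (s t : seq nat) : bool :=
  match s, t with
  | [::], [::] => true
  | x :: s', y :: t' => if nc_eqn x y then nc_eqw s' t' else false
  | _, _ => false
  end.

Fixpoint nc_coef (c : K) (w : seq nat) (l : seq (K * seq nat)) : K :=
  match l with
  | [::] => c
  | (d, v) :: l' => nc_coef (if nc_eqw w v then c + d else c) w l'
  end.

Fixpoint nc_del (w : seq nat) (l : seq (K * seq nat)) : seq (K * seq nat) :=
  match l with
  | [::] => [::]
  | (d, v) :: l' => if nc_eqw w v then nc_del w l' else (d, v) :: nc_del w l'
  end.

(** The conjunction of the equations saying that the total coefficient of each word vanishes. Each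
    round removes all occurrences of the head word, so the length of the list is enough fuel. *)
Fixpoint nc_null (fuel : nat) (l : seq (K * seq nat)) : Prop :=
  match fuel with
  | O => l = [::]
  | S fuel' =>
      match l with
      | [::] => True
      | (c, w) :: l' => nc_coef c w l' = 0 /\ nc_null fuel' (nc_del w l')
      end
  end.

Fixpoint nc_len (l : seq (K * seq nat)) : nat :=
  match l with [::] => O | _ :: l' => S (nc_len l') end.

Definition nc_word (vs : seq A) (w : seq nat) : A :=
  foldr (fun n x => nth 0 vs n * x) 1 w.

Definition nc_sum (vs : seq A) (l : seq (K * seq nat)) : A :=
  foldr (fun p x => p.1 *: nc_word vs p.2 + x) 0 l.

Lemma nc_word_app vs s t : nc_word vs (nc_app s t) = nc_word vs s * nc_word vs t.
Proof. by elim: s => [|x s IH] /=; rewrite ?mul1r // IH mulrA. Qed.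

Lemma nc_sum_cat vs l m : nc_sum vs (nc_cat l m) = nc_sum vs l + nc_sum vs m.
Proof. by elim: l => [|x l IH] /=; rewrite ?add0r // IH addrA. Qed.

Lemma nc_sum_scale vs c l : nc_sum vs (nc_scale c l) = c *: nc_sum vs l.
Proof.
by elim: l => [|[d w] l IH] /=; rewrite ?scaler0 // IH scalerDr scalerA.
Qed.

Lemma nc_sum_mul1 vs c v l :
  nc_sum vs (nc_mul1 c v l) = (c *: nc_word vs v) * nc_sum vs l.
Proof.
elim: l => [|[d w] l IH] /=; rewrite ?mulr0 // IH nc_word_app mulrDr.
by rewrite -scalerAr -!scalerAl scalerA mulrC.
Qed.

Lemma nc_sum_mul vs l m : nc_sum vs (nc_mul l m) = nc_sum vs l * nc_sum vs m.
Proof.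
elim: l => [|[c v] l IH] /=; rewrite ?mul0r //.
by rewrite nc_sum_cat nc_sum_mul1 IH mulrDl.
Qed.

Lemma nc_normP vs e : nc_sum vs (nc_norm e) = nc_eval vs e.
Proof.
elim: e => [n|||a IHa b IHb|a IHa|a IHa b IHb|c a IHa] //=.
- by rewrite scale1r mulr1 addr0.
- by rewrite scale1r addr0.
- by rewrite nc_sum_cat IHa IHb.
- by rewrite nc_sum_scale IHa scaleN1r.
- by rewrite nc_sum_mul IHa IHb.
- by rewrite nc_sum_scale IHa.
Qed.

Lemma nc_eqnP m n : nc_eqn m n -> m = n.
Proof. by elim: m n => [|m IH] [|n] //= /IH ->. Qed.

Lemma nc_eqwP s t : nc_eqw s t -> s = t.
Proof.
elim: s t => [|x s IH] [|y t] //=.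
by case: (nc_eqn x y) (@nc_eqnP x y) => // /(_ isT) -> /IH ->.
Qed.

Lemma nc_coefP vs c w l : c *: nc_word vs w + nc_sum vs l
  = nc_coef c w l *: nc_word vs w + nc_sum vs (nc_del w l).
Proof.
elim: l c => [|[d v] l IH] c //=.
case: (nc_eqw w v) (@nc_eqwP w v) => [/(_ isT) <-|_] /=.
  by rewrite addrA -scalerDl IH.
by rewrite addrCA IH addrCA.
Qed.

Lemma nc_nullP vs n l : nc_null n l -> nc_sum vs l = 0.
Proof.
elim: n l => [|n IH] [|[c w] l] //= [cw0 /IH l0].
by rewrite nc_coefP cw0 l0 scale0r addr0.
Qed.

Lemma nc_zero vs e : nc_null (nc_len (nc_norm e)) (nc_norm e) ->
  nc_eval vs e = 0.
Proof. by rewrite -nc_normP => /nc_nullP. Qed.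

(** A zero element that remembers the equation it comes from; it marks the place of a hypothesis
    inside a linear combination. *)
Definition eqd (x y : A) (_ : x = y) : A := x - y.

Lemma eqd0 x y (H : x = y) : eqd H = 0.
Proof. by rewrite /eqd H subrr. Qed.

Lemma nc_combine (x y e : A) : e = 0 -> x - y - e = 0 -> x = y.
Proof. by move=> ->; rewrite subr0 => /eqP; rewrite subr_eq0 => /eqP. Qed.

End NCReflection.

Ltac nc_mem x vs :=
  lazymatch vs with
  | nil => constr:(false)
  | cons x _ => constr:(true)
  | cons _ ?vs' => nc_mem x vs'
  end.

Ltac nc_vars vs t :=
  lazymatch t with
  | @GRing.add _ ?a ?b => let vs := nc_vars vs a in nc_vars vs b
  | @GRing.opp _ ?a => nc_vars vs a
  | @GRing.mul _ ?a ?b => let vs := nc_vars vs a in nc_vars vs b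
  | @GRing.scale _ _ _ ?a => nc_vars vs a
  | @GRing.zero _ => vs
  | @GRing.one _ => vs
  | _ => let b := nc_mem t vs in
         lazymatch b with true => vs | false => constr:(cons t vs) end
  end.

Ltac nc_index x vs :=
  lazymatch vs with
  | cons x _ => constr:(O)
  | cons _ ?vs' => let n := nc_index x vs' in constr:(S n)
  end.

Ltac nc_reify K vs t :=
  lazymatch t with
  | @GRing.add _ ?a ?b =>
    let a := nc_reify K vs a in let b := nc_reify K vs b in
    constr:(NCadd a b)
  | @GRing.opp _ ?a => let a := nc_reify K vs a in constr:(NCopp a)
  | @GRing.mul _ ?a ?b =>
    let a := nc_reify K vs a in let b := nc_reify K vs b in
    constr:(NCmul a b)
  | @GRing.scale _ _ ?c ?a => let a := nc_reify K vs a in constr:(@NCscale K c a)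
  | @GRing.zero _ => constr:(@NCzero K)
  | @GRing.one _ => constr:(@NCone K)
  | _ => let n := nc_index t vs in constr:(@NCvar K n)
  end.

(* Reduces an equation z = 0 in a K-algebra A to equations in K. *)
Ltac nc_reduce K A :=
  lazymatch goal with
  | |- ?z = _ =>
    let vs := nc_vars (@nil A) z in
    let e := nc_reify K vs z in
    change (nc_eval vs e = 0);
    apply: nc_zero;
    lazy [nc_norm nc_cat nc_scale nc_mul nc_mul1 nc_app nc_len nc_null
          nc_coef nc_del nc_eqw nc_eqn];
    repeat split
  end.

Ltac nc_field K A :=
  nc_reduce K A; rewrite ?invrK; try (by ring);
  try (by field; do ?[apply/andP; split]).

(* Proves x = y in A from x - y = e, where e is a linear combination of terms *)
(* u * eqd H * v for hypotheses H.                                            *)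
Ltac nc_lin K A e :=
  apply: (@nc_combine K A _ _ e);
    [ by rewrite ?(eqd0, mulr0, mul0r, scaler0, oppr0, addr0)
    | rewrite /eqd; nc_field K A ].

(** * Root vectors *)

Section RootVectors.
Variables (K : fieldType) (A : algType K) (r s : K).

(** Only r + s and r s occur, so the relations are symmetric in r and s ([serre_sym]). *)
Record serre (x : nat -> A) : Prop := Serre {
  serre_far i j : (i.+1 < j)%N -> x i * x j = x j * x i;
  serre_lo i : x i * x i * x i.+1 + (r * s) *: (x i.+1 * x i * x i)
    = (r + s) *: (x i * x i.+1 * x i);
  serre_hi i : x i * x i.+1 * x i.+1 + (r * s) *: (x i.+1 * x i.+1 * x i)
    = (r + s) *: (x i.+1 * x i * x i.+1)
}.

Section Def.
Variable x : nat -> A.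

(* The root vector of e_i - e_(i + m + 1). *)
Fixpoint rootvec_rec (i m : nat) : A :=
  if m is m'.+1
  then r *: (x (i + m'.+1) * rootvec_rec i m') - rootvec_rec i m' * x (i + m'.+1)
  else x i.

Definition rootvec (i j : nat) : A := rootvec_rec i (j - i).-1.

Lemma rootvec1 i : rootvec i i.+1 = x i.
Proof. by rewrite /rootvec subSnn. Qed.

Lemma rootvecS i j : (i < j)%N ->
  rootvec i j.+1 = r *: (x j * rootvec i j) - rootvec i j * x j.
Proof.
move=> ij; rewrite /rootvec subSn 1?ltnW //=.
have : (0 < j - i)%N by rewrite subn_gt0.
case E : (j - i)%N => [//|m] _ /=.
by have -> : (i + m.+1)%N = j by lia.
Qed.

(** Scaling factors multiply along the recursion, so it is enough to know how z moves past the
    simple root vectors. *)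
Lemma rootvec_scale (z : A) (c : nat -> nat -> K) :
  (forall i j, (i < j)%N -> c i j.+1 = c i j * c j j.+1) ->
  (forall j, z * x j = c j j.+1 *: (x j * z)) ->
  forall i j, (i < j)%N -> z * rootvec i j = c i j *: (rootvec i j * z).
Proof.
move=> cS zx i; elim=> // j IH; rewrite ltnS leq_eqVlt => /orP[/eqP <-|ij].
  by rewrite rootvec1.
have e := zx j; have f := IH ij.
rewrite rootvecS // (cS _ _ ij).
nc_lin K A (r *: (eqd e * rootvec i j) + (r * c j j.+1) *: (x j * eqd f)
     - eqd f * x j - c i j *: (rootvec i j * eqd e)).
Qed.

End Def.

Variable x : nat -> A.
Hypothesis S : serre x.
Local Notation E := (rootvec x).
Local Ltac lin e := nc_lin K A e.

Lemma rootvec_comm_gen (z : A) (i j : nat) :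
  (forall k, (i <= k < j)%N -> x k * z = z * x k) -> (i < j)%N ->
  E i j * z = z * E i j.
Proof.
move=> + ij; elim: j ij => // j IH; rewrite ltnS leq_eqVlt => /orP[/eqP <-|ij] xz.
  by rewrite rootvec1; apply: xz; lia.
have xj : x j * z = z * x j by apply: xz; lia.
have Ez : E i j * z = z * E i j by apply: IH => // k kj; apply: xz; lia.
rewrite rootvecS //.
lin (r *: (eqd xj * E i j + x j * eqd Ez)
     - (E i j * eqd xj + eqd Ez * x j)).
Qed.

Lemma rootvec_sep i j k l : (i < j)%N -> (j < k)%N -> (k < l)%N ->
  E i j * E k l = E k l * E i j.
Proof.
move=> ij jk kl; apply: rootvec_comm_gen => // m mj.
apply/esym/rootvec_comm_gen => // p pk; symmetry; apply: (serre_far S); lia.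
Qed.

(** The recursion splits off the last simple root. Since E i j commutes with every later x k, the
    interval may be cut at any interior point. *)
Lemma rootvec_adj i j k : (i < j)%N -> (j < k)%N ->
  E i k = r *: (E j k * E i j) - E i j * E j k.
Proof.
move=> ij; elim: k => // k IH; rewrite ltnS leq_eqVlt => /orP[/eqP <-|jk].
  by rewrite rootvecS // rootvec1.
have xk : E i j * x k = x k * E i j.
  apply: rootvec_comm_gen => // m mj; apply: (serre_far S); lia.
rewrite !rootvecS ?IH //; last lia.
lin (r *: (eqd xk * E j k) - r *: (E j k * eqd xk)).
Qed.

(** For a root of length two this is [serre_hi]. A longer interval is cut two steps before its end,
    and its lower part commutes with the last generator. *)
Lemma rootvec_end1 i j : (i < j)%N -> E i j.+1 * x j = s *: (x j * E i j.+1).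
Proof.
case: j => // j.
have e1 : E j j.+2 * x j.+1 = s *: (x j.+1 * E j j.+2).
  rewrite rootvecS // rootvec1.
  lin (- eqd (serre_hi S j)).
rewrite ltnS leq_eqVlt => /orP[/eqP -> //|ij].
have c1 : E i j * x j.+1 = x j.+1 * E i j.
  apply: rootvec_comm_gen => // k kj; apply: (serre_far S); lia.
rewrite (@rootvec_adj i j) //.
lin (r *: (E j j.+2 * eqd c1) + r *: (eqd e1 * E i j)
     - E i j * eqd e1 - s *: (eqd c1 * E j j.+2)).
Qed.

Lemma rootvec_start1 i k : (i.+1 < k)%N -> x i * E i k = s *: (E i k * x i).
Proof.
have e1 : x i * E i i.+2 = s *: (E i i.+2 * x i).
  rewrite rootvecS // rootvec1.
  lin (- eqd (serre_lo S i)).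
rewrite leq_eqVlt => /orP[/eqP <- //|ik].
have c1 : x i * E i.+2 k = E i.+2 k * x i.
  apply/esym/rootvec_comm_gen => // m mj; symmetry; apply: (serre_far S); lia.
rewrite (@rootvec_adj i i.+2) //.
lin (r *: (eqd c1 * E i i.+2) + r *: (E i.+2 k * eqd e1)
     - eqd e1 * E i.+2 k - s *: (E i i.+2 * eqd c1)).
Qed.

Hypothesis rs0 : r + s != 0.

(* Both relations come from expanding E i k * E j l in two ways. *)
Lemma rootvec_cross_of_ends i j k l : (i < j)%N -> (j < k)%N -> (k < l)%N ->
  E i k * E j k = s *: (E j k * E i k) ->
  E j k * E j l = s *: (E j l * E j k) ->
  E j k * E i l = E i l * E j k /\
  (r * s) *: (E j l * E i k) - E i k * E j l = (r - s) *: (E i l * E j k).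
Proof.
move=> ij jk kl He Hs.
have Hik := rootvec_adj ij jk; have Hjl := rootvec_adj jk kl.
have H1 := @rootvec_adj i k l (ltn_trans ij jk) kl.
have H2 := @rootvec_adj i j l ij (ltn_trans jk kl).
have HI : E i k * E j l = (r * s) *: (E j l * E i k) - r *: (E i l * E j k)
    + s *: (E j k * E i l).
  lin (E i k * eqd Hjl - (r * s) *: (eqd Hjl * E i k) + r *: (eqd H1 * E j k)
    - s *: (E j k * eqd H1) - eqd He * E k l + (r * r) *: (E k l * eqd He)).
have HII : E i k * E j l = (r * s) *: (E j l * E i k) - r *: (E j k * E i l)
    + s *: (E i l * E j k).
  lin (eqd Hik * E j l - (r * s) *: (E j l * eqd Hik) + r *: (E j k * eqd H2)
    - s *: (eqd H2 * E j k) - E i j * eqd Hs + (r * r) *: (eqd Hs * E i j)).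
(* Subtracting the two expansions leaves (r + s) times the commutator. *)
have C : E j k * E i l = E i l * E j k.
  lin ((r + s)^-1 *: (eqd HII - eqd HI)).
split=> //.
lin (- eqd HI - s *: eqd C).
Qed.

(** Induction on the length of the interval from j to k. Both relations for an interval shorter by
    one give, through [rootvec_cross_of_ends], a commutation of nested root vectors; together with
    [rootvec_end1] or [rootvec_start1] for the removed simple root it gives the relation for the
    longer interval. *)
Lemma rootvec_ends m j k : (j < k)%N -> (k <= j + m)%N ->
  (forall i, (i < j)%N -> E i k * E j k = s *: (E j k * E i k)) /\
  (forall l, (k < l)%N -> E j k * E j l = s *: (E j l * E j k)).
Proof.
elim: m j k => [|m IH] j k jk kjm; first by lia.
case: (eqVneq k j.+1) => [->|ne].
  by rewrite rootvec1; split=> *; [exact: rootvec_end1 | exact: rootvec_start1].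
split=> [i ij|l kl].
- have k1 : k.-1.+1 = k by lia.
  have jk1 : (j < k.-1)%N by lia.
  have kk1 : (k.-1 < k)%N by lia.
  have [e1 e2] := IH j k.-1 jk1 ltac:(lia).
  have [c _] := rootvec_cross_of_ends ij jk1 kk1 (e1 i ij) (e2 k kk1).
  have e3 : E i k * x k.-1 = s *: (x k.-1 * E i k).
    by have := @rootvec_end1 i k.-1; rewrite k1; apply; lia.
  have Ek := rootvecS x jk1; rewrite k1 in Ek; rewrite Ek.
  lin (r *: (eqd e3 * E j k.-1) - (r * s) *: (x k.-1 * eqd c)
       + eqd c * x k.-1 - E j k.-1 * eqd e3).
- have jk1 : (j.+1 < k)%N by lia.
  have km : (k <= j.+1 + m)%N by lia.
  have [e1 e2] := IH j.+1 k jk1 km.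
  have [c _] := rootvec_cross_of_ends (ltnSn j) jk1 kl (e1 j (ltnSn j)) (e2 l kl).
  have e3 : x j * E j l = s *: (E j l * x j) by apply: rootvec_start1; lia.
  rewrite (rootvec_adj (ltnSn j) jk1) rootvec1.
  lin (r *: (E j.+1 k * eqd e3) + (r * s) *: (eqd c * x j)
       - eqd e3 * E j.+1 k - x j * eqd c).
Qed.

Lemma rootvec_end i j k : (i < j)%N -> (j < k)%N ->
  E i k * E j k = s *: (E j k * E i k).
Proof. by move=> ij jk; have [+ _] := rootvec_ends jk (leq_addl j k); apply. Qed.

Lemma rootvec_start j k l : (j < k)%N -> (k < l)%N ->
  E j k * E j l = s *: (E j l * E j k).
Proof. by move=> jk kl; have [_] := rootvec_ends jk (leq_addl j k); apply. Qed.

Lemma rootvec_nested i j k l : (i < j)%N -> (j < k)%N -> (k < l)%N ->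
  E j k * E i l = E i l * E j k.
Proof.
move=> ij jk kl.
by have [] := rootvec_cross_of_ends ij jk kl (rootvec_end ij jk) (rootvec_start jk kl).
Qed.

Lemma rootvec_crossing i j k l : (i < j)%N -> (j < k)%N -> (k < l)%N ->
  (r * s) *: (E j l * E i k) - E i k * E j l = (r - s) *: (E i l * E j k).
Proof.
move=> ij jk kl.
by have [] := rootvec_cross_of_ends ij jk kl (rootvec_end ij jk) (rootvec_start jk kl).
Qed.

End RootVectors.

(** * Triangular solutions of the RLL relations *)

Section QuantumMatrices.
Variables (K : fieldType) (A : algType K).
Local Ltac lin e := nc_lin K A e.

(** The relations of two-parameter quantum matrices: the content of R L1 L2 = L2 L1 R after
    separating cases by the order of the indices ([qmat_rll], [rll_qmat]). *)
Record qmat (r s : K) (L : nat -> nat -> A) : Prop := QMat {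
  qmat_row i k l : (k < l)%N -> L i l * L i k = r *: (L i k * L i l);
  qmat_col i j k : (j < i)%N -> L j k * L i k = s *: (L i k * L j k);
  qmat_anti i j k l : (j < i)%N -> (l < k)%N ->
    L j k * L i l = (r * s) *: (L i l * L j k);
  qmat_main i j k l : (j < i)%N -> (l < k)%N ->
    L i k * L j l - L j l * L i k = (r - s) *: (L i l * L j k)
}.

(** [rdiag] and [roff] are the entries of R at ((i,j),(i,j)) and, for distinct i and j, at
    ((i,j),(j,i)); see [Rmx_entry]. *)
Definition rdiag (r s : K) (i j : nat) : K :=
  if i == j then 1 else if (j < i)%N then r else s^-1.

Definition roff (r s : K) (i j : nat) : K := if (j < i)%N then 1 - r * s^-1 else 0.

Lemma rdiagii r s i : rdiag r s i i = 1.
Proof. by rewrite /rdiag eqxx. Qed.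

Lemma rdiag_gt r s i j : (j < i)%N -> rdiag r s i j = r.
Proof. by move=> ji; rewrite /rdiag gtn_eqF ?ji. Qed.

Lemma rdiag_lt r s i j : (i < j)%N -> rdiag r s i j = s^-1.
Proof. by move=> ij; rewrite /rdiag ltn_eqF // ltnNge ltnW. Qed.

Lemma roff_gt r s i j : (j < i)%N -> roff r s i j = 1 - r * s^-1.
Proof. by rewrite /roff => ->. Qed.

Lemma roff_le r s i j : (i <= j)%N -> roff r s i j = 0.
Proof. by rewrite /roff ltnNge => ->. Qed.

(* The (i, j), (k, l) entry of R L1 M2 = M2 L1 R. *)
Definition rll (r s : K) (L M : nat -> nat -> A) : Prop :=
  forall i j k l,
  rdiag r s i j *: (L i k * M j l) + roff r s i j *: (L j k * M i l)
  = rdiag r s k l *: (M j l * L i k) + roff r s l k *: (M j k * L i l).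

Local Ltac ord :=
  repeat first [ rewrite rdiagii | rewrite rdiag_gt; [|lia] | rewrite rdiag_lt; [|lia]
    | rewrite roff_gt; [|lia] | rewrite roff_le; [|lia] ].

Lemma qmat_rll (r s : K) (L : nat -> nat -> A) : s != 0 ->
  qmat r s L -> rll r s L L.
Proof.
move=> s0 Q i j k l.
case: (ltngtP i j) => [ij|ji|<-]; case: (ltngtP k l) => [kl|lk|<-]; ord.
- lin (- s^-1 *: eqd (qmat_main Q ij kl)).
- lin (s^-1 *: eqd (qmat_anti Q ij lk)).
- lin (s^-1 *: eqd (qmat_col Q k ij)).
- lin (- s^-1 *: eqd (qmat_anti Q ji kl)).
- lin (r *: eqd (qmat_main Q ji lk) + (1 - r * s^-1) *: eqd (qmat_anti Q ji lk)).
- lin (- (r * s^-1) *: eqd (qmat_col Q k ji)).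
- lin (- s^-1 *: eqd (qmat_row Q i kl)).
- lin (eqd (qmat_row Q i lk)).
- by [].
Qed.

Lemma rll_qmat (r s : K) (L : nat -> nat -> A) : r != 0 -> s != 0 ->
  rll r s L L -> qmat r s L.
Proof.
move=> r0 s0 H; have anti i j k l : (j < i)%N -> (l < k)%N ->
    L j k * L i l = (r * s) *: (L i l * L j k).
  by move=> ji lk; have := H i j l k; ord => e; lin (- s *: eqd e).
split=> // [i k l kl|i j k ji|i j k l ji lk].
- by have := H i i k l; ord => e; lin (- s *: eqd e).
- by have := H i j k k; ord => e; lin (- (s / r) *: eqd e).
- have := H i j k l; ord => e.
  by lin (r^-1 *: (eqd e - (1 - r * s^-1) *: eqd (anti i j k l ji lk))).
Qed.

End QuantumMatrices.

(** * The triangular matrix of root vectors *)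

Section BorelMatrix.
Variables (K : fieldType) (A : algType K) (r s : K).
Local Ltac lin e := nc_lin K A e.

(* Conjugation by the i-th diagonal generator scales a root vector of weight *)
(* e_j - e_k by [twt i j k]. *)
Definition twt (i j k : nat) : K :=
  (if (j <= i < k)%N then s else 1) * (if (j < i <= k)%N then r else 1).

(** One half of the relations of U_{r,s}(gl_{n+1}): x plays the role of the e_i and t that of the
    a_i^-1, the future diagonal of ell^+. *)
Record borel (x t : nat -> A) : Prop := Borel {
  borel_serre : serre r s x;
  borel_tt i j : t i * t j = t j * t i;
  borel_tx i j : t i * x j = twt i j j.+1 *: (x j * t i)
}.

Variables (x t : nat -> A).
Hypothesis B : borel x t.
Local Notation E := (rootvec r x).

Lemma borel_tE m i j : (i < j)%N -> t m * E i j = twt m i j *: (E i j * t m).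
Proof.
apply: (@rootvec_scale _ _ _ _ (t m) (twt m)); last exact: borel_tx.
by move=> {}i {}j ij; rewrite /twt; do !case: ifP => ?; try lia; ring.
Qed.

(** The candidate for ell^+. The formula for theta(e_i) prescribes the diagonal and the first
    subdiagonal, and the RLL relations force root vectors below ([matE_rec]). *)
Definition borelL (j i : nat) : A :=
  if i == j then t i else if (i < j)%N then (r - s) *: (E i j * t i) else 0.

Lemma borelL_diag i : borelL i i = t i.
Proof. by rewrite /borelL eqxx. Qed.

Lemma borelL_lt j i : (i < j)%N -> borelL j i = (r - s) *: (E i j * t i).
Proof. by move=> ij; rewrite /borelL ltn_eqF ?ij. Qed.

Lemma borelL_gt j i : (j < i)%N -> borelL j i = 0.
Proof. by move=> ji; rewrite /borelL gtn_eqF // ltnNge ltnW. Qed.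

Local Notation D := (r - s).
Local Notation L := borelL.

Local Ltac Lsimp :=
  repeat first [ rewrite borelL_diag | rewrite borelL_lt; [|lia]
    | rewrite borelL_gt; [|lia] ].
Local Ltac tE H m i j v :=
  have H : t m * E i j = v *: (E i j * t m)
    by (rewrite borel_tE; [|lia]; congr (_ *: _); rewrite /twt;
        do !case: ifP => ?; try lia; ring).

Hypothesis rs0 : r + s != 0.

(** Once all diagonal elements are moved to the right, at the cost of the factors [twt], each
    quadratic relation becomes one relation between two root vectors, selected by the relative
    position of their intervals. *)
Lemma borelL_qmat : qmat r s L.
Proof.
have S := borel_serre B; have T := borel_tt B.
split=> [i k l kl|i j k ji|i j k l ji lk|i j k l ji lk].
- case: (ltngtP l i) => [li|il|lE].
  + Lsimp; tE e1 l k i (r * s); tE e2 k l i (1 : K).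
    have e := rootvec_end S rs0 kl li.
    lin (D * D *: (E l i * eqd e1 * t k + (r * s) *: (E l i * E k i * eqd (T l k))
      - r *: (E k i * eqd e2 * t l) - r *: (eqd e * t k * t l))).
  + Lsimp; lin (0 : A).
  + rewrite lE in kl *; Lsimp; tE e1 i k i r.
    lin (D *: (eqd e1 * t k + r *: (E k i * eqd (T i k)))).
- case: (ltngtP k j) => [kj|jk|kE].
  + Lsimp; tE e1 k k i s; tE e2 k k j s.
    have e := rootvec_start S rs0 kj ji.
    lin (D * D *: (E k j * eqd e1 * t k - s *: (E k i * eqd e2 * t k)
      + s *: (eqd e * t k * t k))).
  + Lsimp; lin (0 : A).
  + rewrite kE; Lsimp; tE e1 j j i s.
    lin (D *: (eqd e1 * t j)).
- case: (ltngtP k j) => [kj|jk|kE].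
  + Lsimp; tE e1 k l i (r * s); tE e2 l k j (1 : K).
    have e := rootvec_nested S rs0 lk kj ji.
    lin (D * D *: (E k j * eqd e1 * t l - (r * s) *: (E l i * eqd e2 * t k)
      + (r * s) *: (eqd e * t k * t l) + (r * s) *: (E l i * E k j * eqd (T k l)))).
  + Lsimp; lin (0 : A).
  + rewrite kE in lk *; Lsimp; tE e1 j l i (r * s).
    lin (D *: (eqd e1 * t l + (r * s) *: (E l i * eqd (T j l)))).
- case: (ltngtP k i) => [ki|ik|kE]; case: (ltngtP l j) => [lj|jl|lE].
  + Lsimp.
    (* The intervals from l to j and from k to i cross, are disjoint or abut according to the order
       of k and j. Only in the last two cases does an entry on the right lie on or above the
       diagonal. *)
    case: (ltngtP k j) => [kj|jk|kE].
    * Lsimp; tE e1 k l j (r * s); tE e2 l k i (1 : K); tE e3 l k j (1 : K).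
      have e := rootvec_crossing S rs0 lk kj ji.
      lin (D * D *: (E k i * eqd e1 * t l - E l j * eqd e2 * t k
        + (r * s) *: (E k i * E l j * eqd (T k l)) + eqd e * t l * t k
        - D *: (E l i * eqd e3 * t k))).
    * Lsimp; tE e1 k l j (1 : K); tE e2 l k i (1 : K).
      have e := rootvec_sep S lj jk ki.
      lin (D * D *: (E k i * eqd e1 * t l - E l j * eqd e2 * t k
        - eqd e * t k * t l - E l j * E k i * eqd (T l k))).
    * rewrite kE in lk ki *; Lsimp; tE e1 j l j r; tE e2 l j i (1 : K).
      have e := rootvec_adj S lk ki.
      lin (D * D *: (E j i * eqd e1 * t l - E l j * eqd e2 * t j
        + r *: (E j i * E l j * eqd (T j l)) - eqd e * t l * t j)).
  + Lsimp; lin (0 : A).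
  + rewrite lE in lk *; Lsimp; tE e1 j k i (1 : K).
    lin (D *: (E k i * eqd (T k j) - eqd e1 * t k)).
  + Lsimp; lin (0 : A).
  + rewrite (@borelL_gt j k) ?(@borelL_gt j l) //; last lia.
    lin (0 : A).
  + rewrite lE in lk *; Lsimp; lin (0 : A).
  + rewrite kE in lk *; Lsimp; tE e1 i l j (1 : K).
    lin (D *: (eqd e1 * t l + E l j * eqd (T i l))).
  + rewrite kE in lk *; Lsimp; lin (0 : A).
  + rewrite kE lE; Lsimp; lin (eqd (T i j)).
Qed.

End BorelMatrix.

(** * The mixed relation between the two triangular matrices *)

Section Cross.
Variables (K : fieldType) (A : algType K) (r s : K) (n : nat).
Variables (x y t tV u uV : nat -> A) (M : nat -> nat -> A).
Hypotheses (r0 : r != 0) (s0 : s != 0) (rs0 : r - s != 0).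
Hypothesis B : borel r s x t.
Hypothesis ux : forall i j, u i * x j = twt s r i j j.+1 *: (x j * u i).
Hypothesis ty : forall i j, t i * y j = (twt r s i j j.+1)^-1 *: (y j * t i).
Hypothesis tu : forall i j, t i * u j = u j * t i.
Hypothesis tV_t : forall i, (i <= n)%N -> tV i * t i = 1.
Hypothesis t_tV : forall i, (i <= n)%N -> t i * tV i = 1.
Hypothesis uV_u : forall i, (i <= n)%N -> uV i * u i = 1.
Hypothesis u_uV : forall i, (i <= n)%N -> u i * uV i = 1.
Hypothesis xy : forall i j, (i < n)%N -> (j < n)%N -> x i * y j - y j * x i
  = (i == j)%:R *: ((r - s)^-1 *: (tV i * t i.+1 - uV i * u i.+1)).
Hypothesis x_out : forall i, (n <= i)%N -> x i = 0.
Hypothesis Mq : qmat r s M.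
Hypothesis M_diag : forall i, M i i = u i.
Hypothesis M_next : forall i, M i i.+1 = (s - r) *: (u i * y i).
Hypothesis M_gt : forall i j, (j < i)%N -> M i j = 0.

Local Ltac lin e := nc_lin K A e.
Local Notation E := (rootvec r x).
Local Notation P := (borelL r s x t).

Lemma xy_neq i j : (j < n)%N -> i != j -> x i * y j = y j * x i.
Proof.
move=> jn ij; case: (ltnP i n) => [i_n|ni]; last first.
  by rewrite x_out // mul0r mulr0.
have e := xy i_n jn; rewrite (negbTE ij) scale0r in e.
lin (eqd e).
Qed.

Lemma uE m i j : (i < j)%N -> u m * E i j = twt s r m i j *: (E i j * u m).
Proof.
apply: (@rootvec_scale _ _ _ _ (u m) (twt s r m)); last exact: ux.
by move=> {}i {}j ij; rewrite /twt; do !case: ifP => ?; try lia; ring.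
Qed.

Local Ltac tE H m i j v :=
  have H : t m * E i j = v *: (E i j * t m)
    by (rewrite (borel_tE B); [|lia]; congr (_ *: _); rewrite /twt;
        do !case: ifP => ?; try lia; ring).
Local Ltac tuE H m i j v :=
  have H : u m * E i j = v *: (E i j * u m)
    by (rewrite uE; [|lia]; congr (_ *: _); rewrite /twt;
        do !case: ifP => ?; try lia; ring).
Local Ltac tyE H m j v :=
  have H : t m * y j = v *: (y j * t m)
    by (rewrite ty; congr (_ *: _); rewrite /twt;
        do !case: ifP => ?; try lia; rewrite ?mul1r ?mulr1 ?invr1).

Lemma rootvec_y_out k i j : (k < i)%N -> (j < n)%N -> (j < k)%N || (i <= j)%N ->
  E k i * y j = y j * E k i.
Proof.
move=> ki jn jout; apply: rootvec_comm_gen => // m mj.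
by apply: xy_neq => //; apply/eqP; lia.
Qed.

(** The commutator with y j only sees the last factor x j. The two t-terms of [x j, y j] cancel
    since t j scales E k j by r, and the u-terms survive. The factor u j clears the inverse uV j. *)
Lemma rootvec_y_last k j : (k < j)%N -> (j < n)%N ->
  u j * E k j.+1 * y j - u j * y j * E k j.+1 = - (u j.+1 * E k j).
Proof.
move=> kj jn.
have e := xy jn jn; rewrite eqxx scale1r in e.
have c : E k j * y j = y j * E k j by apply: rootvec_y_out; lia.
tE e1 j k j r; tE e2 j.+1 k j (1 : K); tuE e3 j k j s; tuE e4 j.+1 k j (1 : K).
have f1 : tV j * E k j = r^-1 *: (E k j * tV j).
  have i1 := tV_t (ltnW jn); have i2 := t_tV (ltnW jn).
  lin (- r^-1 *: (tV j * eqd e1 * tV j) + r^-1 *: (eqd i1 * E k j * tV j)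
    - tV j * E k j * eqd i2).
have f2 : uV j * E k j = s^-1 *: (E k j * uV j).
  have i1 := uV_u (ltnW jn); have i2 := u_uV (ltnW jn).
  lin (- s^-1 *: (uV j * eqd e3 * uV j) + s^-1 *: (eqd i1 * E k j * uV j)
    - uV j * E k j * eqd i2).
rewrite rootvecS //.
have i3 := u_uV (ltnW jn).
lin (r *: (u j * x j * eqd c) - u j * eqd c * x j + r *: (u j * eqd e * E k j)
  - u j * E k j * eqd e
  + (r - s)^-1 *: (r *: (u j * tV j * eqd e2) + r *: (u j * eqd f1 * t j.+1)
    - r *: (eqd i3 * u j.+1 * E k j) + eqd e3 * uV j * u j.+1
    + s *: (E k j * eqd i3 * u j.+1) - s *: eqd e4)).
Qed.

(** Here the first factor x k is hit. Since u k.+1 scales E k.+1 i by r, it is the u-terms that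
    cancel, and multiplication by t k clears tV k. *)
Lemma rootvec_y_first k i : (k.+1 < i)%N -> (k < n)%N ->
  E k i * y k * t k - y k * E k i * t k = E k.+1 i * t k.+1.
Proof.
move=> ki kn.
have e := xy kn kn; rewrite eqxx scale1r in e.
have c : E k.+1 i * y k = y k * E k.+1 i by apply: rootvec_y_out; lia.
have i1 := tV_t (ltnW kn); have T := borel_tt B k.+1 k.
tE e1 k k.+1 i (1 : K); tE f k.+1 k.+1 i s; tuE e3 k k.+1 i (1 : K).
tuE h k.+1 k.+1 i r.
have g1 : tV k * E k.+1 i = E k.+1 i * tV k.
  have i2 := t_tV (ltnW kn).
  lin (- (tV k * eqd e1 * tV k) + eqd i1 * E k.+1 i * tV k
    - tV k * E k.+1 i * eqd i2).
have g2 : uV k * E k.+1 i = E k.+1 i * uV k.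
  have i3 := uV_u (ltnW kn); have i2 := u_uV (ltnW kn).
  lin (- (uV k * eqd e3 * uV k) + eqd i3 * E k.+1 i * uV k
    - uV k * E k.+1 i * eqd i2).
rewrite (rootvec_adj (borel_serre B) (ltnSn k) ki) rootvec1.
lin (r *: (eqd c * x k * t k) - x k * eqd c * t k
  + r *: (E k.+1 i * eqd e * t k) - eqd e * E k.+1 i * t k
  + (r - s)^-1 *: ((r - s) *: (E k.+1 i * tV k * eqd T)
    + (r - s) *: (E k.+1 i * eqd i1 * t k.+1)
    - tV k * eqd f * t k - s *: (eqd g1 * t k.+1 * t k)
    + uV k * eqd h * t k + r *: (eqd g2 * u k.+1 * t k))).
Qed.

(** Cut the interval at j.+1. The commutator of the lower part with y j is given by
    [rootvec_y_last]; its two contributions cancel because u j.+1 scales E j.+1 i by r and E k j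
    commutes with E j.+1 i. *)
Lemma rootvec_y_mid k j i : (k < j)%N -> (j.+1 < i)%N -> (j < n)%N ->
  E k i * y j = y j * E k i.
Proof.
move=> kj ji jn.
have a := rootvec_y_last kj jn.
have c : E j.+1 i * y j = y j * E j.+1 i by apply: rootvec_y_out; lia.
have sp := rootvec_sep (borel_serre B) kj (ltnSn j) ji.
tuE g j j.+1 i (1 : K); tuE h j.+1 j.+1 i r.
have e : u j * (E k i * y j) = u j * (y j * E k i).
  rewrite (rootvec_adj (borel_serre B) (ltnW kj : k < j.+1)%N ji).
  lin (r *: (eqd g * E k j.+1 * y j) - u j * E k j.+1 * eqd c
    + r *: (u j * eqd c * E k j.+1) - r *: (eqd g * y j * E k j.+1)
    + r *: (E j.+1 i * eqd a) - eqd a * E j.+1 i + eqd h * E k j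
    + u j.+1 * eqd sp).
have i1 := uV_u (ltnW jn).
lin (uV j * eqd e - eqd i1 * (E k i * y j - y j * E k i)).
Qed.

(* R(r^-1, s^-1) is the inverse of R(r, s), so these are the entries of       *)
(* R^-1 M2 P1 = P1 M2 R^-1.                                                   *)
Definition rllV (i j k l : nat) : Prop :=
  rdiag r^-1 s^-1 i j *: (M j l * P i k) + roff r^-1 s^-1 i j *: (M i l * P j k)
  = rdiag r^-1 s^-1 k l *: (P i k * M j l) + roff r^-1 s^-1 l k *: (P i l * M j k).

Local Ltac ord :=
  rewrite ?rdiagii ?borelL_diag ?M_diag ?M_next;
  repeat match goal with
  | |- context [rdiag ?a ?b ?i ?j] =>
    first [rewrite (@rdiag_gt K a b i j); [|lia] | rewrite (@rdiag_lt K a b i j); [|lia]]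
  | |- context [roff ?a ?b ?i ?j] =>
    first [rewrite (@roff_gt K a b i j); [|lia] | rewrite (@roff_le K a b i j); [|lia]]
  | |- context [borelL r s x t ?i ?j] =>
    first [rewrite (@borelL_lt K A r s x t i j); [|lia]
      | rewrite (@borelL_gt K A r s x t i j); [|lia]]
  | |- context [M ?i ?j] => rewrite (@M_gt i j); [|lia]
  end.

(** Wherever R^-1 has an off-diagonal coefficient, the entry of M next to it vanishes by
    triangularity. What remains is the scaling of root vectors by u j. *)
Lemma rllV_diag i j k : rllV i j k j.
Proof.
have z1 : roff r^-1 s^-1 i j *: (M i j * P j k) = 0.
  by case: (leqP i j) => ij; [rewrite roff_le ?scale0r | rewrite M_gt ?mul0r ?scaler0].
have z2 : roff r^-1 s^-1 j k *: (P i j * M j k) = 0.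
  by case: (leqP j k) => jk; [rewrite roff_le ?scale0r | rewrite M_gt ?mulr0 ?scaler0].
rewrite /rllV z1 z2 !addr0 M_diag; case: (ltngtP i k) => [ik|ki|<-].
- ord; lin (0 : A).
- have -> : rdiag r^-1 s^-1 k j = rdiag r^-1 s^-1 i j * twt s r j k i.
    by rewrite /rdiag /twt; do !case: ifP => ?; try lia; rewrite ?invrK; field; rewrite ?r0 ?s0.
  have e := uE j ki; ord.
  lin (rdiag r^-1 s^-1 i j *: ((r - s) *: (eqd e * t k
    - twt s r j k i *: (E k i * eqd (tu k j))))).
- ord; lin (- rdiag r^-1 s^-1 i j *: eqd (tu i j)).
Qed.

(** M j j.+1 is a multiple of u j y j, so the entry reduces to moving y j past E k i. The place of j
    relative to the interval from k to i decides which commutator enters; if the interval is exactly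
    from j to j.+1 it is the relation [xy] itself. *)
Lemma rllV_next i j k : (j < n)%N -> rllV i j k j.+1.
Proof.
move=> jn; rewrite /rllV; case: (ltngtP i k) => [ik|ki|<-].
- by case: (leqP i j) => ij; case: (leqP j.+1 k) => jk; try lia; ord; lin (0 : A).
- case: (ltngtP i j) => [ij|ji|iE].
  + ord; tyE e1 k j (1 : K); tuE e2 j k i (1 : K).
    have c : E k i * y j = y j * E k i by apply: rootvec_y_out; lia.
    lin ((s - r) * (r - s) * s *: (- (u j * eqd c * t k)
      - E k i * eqd (tu k j) * y j + eqd e2 * y j * t k - E k i * u j * eqd e1)).
  + case: (ltngtP i j.+1) => [ij'|ji'|iE]; first lia.
    * case: (ltngtP k j) => [kj|jk|kE].
      -- ord; tyE e1 k j (1 : K); tuE e2 j k i (r * s).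
         have c : E k i * y j = y j * E k i by apply: rootvec_y_mid.
         lin (- ((r - s) * (r - s)) *: (- r^-1 *: (u j * eqd c * t k)
           - s *: (E k i * eqd (tu k j) * y j) + r^-1 *: (eqd e2 * y j * t k)
           - s *: (E k i * u j * eqd e1))).
      -- have c : E k i * y j = y j * E k i by apply: rootvec_y_out; lia.
         tuE e2 j k i (1 : K).
         case: (ltngtP k j.+1) => [kj|jk'|kE]; first lia.
         ++ ord; tyE e1 k j (1 : K).
            lin (- ((r - s) * (r - s)) * r^-1 *: (- (u j * eqd c * t k)
              - E k i * eqd (tu k j) * y j + eqd e2 * y j * t k
              - E k i * u j * eqd e1)).
         ++ rewrite kE in e2 c ki *; ord; tyE e1 j.+1 j (r^-1).
            lin (- ((r - s) * (r - s)) *: (- r^-1 *: (u j * eqd c * t j.+1)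
              - E j.+1 i * eqd (tu j.+1 j) * y j + r^-1 *: (eqd e2 * y j * t j.+1)
              - E j.+1 i * u j * eqd e1)).
      -- rewrite kE in ki *; ord; tyE e1 j j (s^-1); tuE e2 j j i r.
         tuE e5 j j.+1 i (1 : K).
         have b := rootvec_y_first ji' jn.
         lin ((r - s) * (r - s) *: (r^-1 *: (u j * eqd b)
           - r^-1 *: (eqd e2 * y j * t j) + s *: (E j i * u j * eqd e1)
           + s *: (E j i * eqd (tu j j) * y j) + r^-1 *: (eqd e5 * t j.+1)
           - r^-1 *: (E j.+1 i * eqd (tu j.+1 j)))).
    * rewrite iE in ki *; case: (ltngtP k j) => [kj|jk|kE]; first 2 last.
      -- rewrite kE; ord; rewrite rootvec1.
         have e := xy jn jn; rewrite eqxx scale1r in e.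
         have T := borel_tt B j.+1 j; tyE e1 j j (s^-1).
         have e2 : u j * x j = r *: (x j * u j).
           by rewrite ux /twt; congr (_ *: _); do !case: ifP => ?; try lia; ring.
         have i1 := tV_t (ltnW jn); have i3 := u_uV (ltnW jn).
         lin ((s * (r - s) * (r - s)) *: (x j * eqd (tu j j) * y j
             + x j * u j * eqd e1)
           + ((r - s) * (r - s) / r) *: (u j * eqd e * t j - eqd e2 * y j * t j)
           + ((r - s) / r) *: (u j * tV j * eqd T + u j * eqd i1 * t j.+1
             - eqd (tu j.+1 j) - eqd i3 * u j.+1 * t j)).
      -- ord; tyE e1 k j (1 : K); tuE e2 j k j.+1 (r * s).
         have a := rootvec_y_last kj jn.
         lin ((r - s) * (r - s) *: (r^-1 *: (eqd a * t k)
           - r^-1 *: (eqd e2 * y j * t k) + s *: (E k j.+1 * u j * eqd e1)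
           + s *: (E k j.+1 * eqd (tu k j) * y j))).
      -- lia.
  + rewrite iE in ki *; ord; tyE e1 k j (1 : K); tuE e2 j k j s.
    have c : E k j * y j = y j * E k j by apply: rootvec_y_out; lia.
    lin ((s - r) * (r - s) *: (- (u j * eqd c * t k)
      - s *: (E k j * eqd (tu k j) * y j) + eqd e2 * y j * t k
      - s *: (E k j * u j * eqd e1))).
- case: (ltngtP i j) => [ij|ji|<-].
  + ord; tyE e1 i j (1 : K).
    lin ((s - r) * s *: (- (eqd (tu i j) * y j) - u j * eqd e1)).
  + case: (ltngtP i j.+1) => [ij|ji'|->]; first lia.
    * ord; tyE e1 i j (1 : K).
      lin ((s - r) * r^-1 *: (- (eqd (tu i j) * y j) - u j * eqd e1)).
    * ord; tyE e1 j.+1 j (r^-1).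
      lin ((s - r) *: (- (eqd (tu j.+1 j) * y j) - u j * eqd e1)).
  + ord; tyE e1 i i (s^-1).
    lin (s * (s - r) *: (- (eqd (tu i i) * y i) - u i * eqd e1)).
Qed.
Local Notation d' := (rdiag r^-1 s^-1).
Local Notation q' := (roff r^-1 s^-1).

(* The left and right actions of the entries of R^-1 M2 and M2 R^-1, which P *)
(* intertwines. *)
Definition actl (j l : nat) (v : nat -> A) (i : nat) : A :=
  d' i j *: (M j l * v i) + q' i j *: (M i l * v j).
Definition actr (j l : nat) (w : nat -> A) (k : nat) : A :=
  d' k l *: (w k * M j l) + q' l k *: (w l * M j k).

Lemma eq_actl j l v v' i : (forall i, v i = v' i) -> actl j l v i = actl j l v' i.
Proof. by move=> vv; rewrite /actl !vv. Qed.

Lemma eq_actr j l w w' k : (forall k, w k = w' k) -> actr j l w k = actr j l w' k.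
Proof. by move=> ww; rewrite /actr !ww. Qed.

Lemma actlr j l j' l' (Q : nat -> nat -> A) i k :
  actl j l (fun i => actr j' l' (Q i) k) i
  = actr j' l' (fun k => actl j l (fun i => Q i k) i) k.
Proof. by rewrite /actl /actr; lin (0 : A). Qed.

(** R^-1 M2 satisfies the same relation as M, here [qmat_main] for the indices j < m < l.
    [actr_main] is the right-hand version, where composition is reversed. *)
Lemma actl_main j m l v i : (j < m)%N -> (m < l)%N ->
  actl m l (actl j m v) i - actl j m (actl m l v) i
  = (r - s) *: actl m m (actl j l v) i.
Proof.
move=> jm ml; rewrite /actl; have e := qmat_main Mq jm ml.
case: (leqP i j) => [ij|ji].
  have im : (i < m)%N by lia.
  rewrite (roff_le _ _ ij) (roff_le _ _ (ltnW im)) (rdiag_lt _ _ im).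
  lin ((s^-1^-1 * d' i j) *: (eqd e * v i)).
case: (ltngtP i m) => [im|mi|->]; ord.
- have f := qmat_main Mq im ml; rewrite M_diag in e f.
  lin ((r^-1 * s^-1^-1) *: (eqd e * v i)
    + (s^-1^-1 * (1 - r^-1 / s^-1)) *: (eqd f * v j)).
- have f := qmat_main Mq ji ml; have g := qmat_main Mq mi ml.
  rewrite (@M_gt i m) // mul0r scaler0 in f g; rewrite M_diag in e g.
  lin ((r^-1 * r^-1) *: (eqd e * v i) + (r^-1 * (1 - r^-1 / s^-1)) *: (eqd f * v m)
    + ((1 - r^-1 / s^-1) * (1 - r^-1 / s^-1)) *: (eqd g * v j)).
- have f := qmat_row Mq m ml.
  rewrite M_diag in e f.
  lin (r^-1 *: (eqd e * v m) + (1 - r^-1 / s^-1) *: (eqd f * v j)).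
Qed.

Lemma actr_main j m l w k : (j < m)%N -> (m < l)%N ->
  actr j m (actr m l w) k - actr m l (actr j m w) k
  = (r - s) *: actr j l (actr m m w) k.
Proof.
move=> jm ml; rewrite /actr; have e := qmat_main Mq jm ml.
case: (leqP l k) => [lk|kl].
  have mk : (m < k)%N by lia.
  rewrite (roff_le _ _ lk) (roff_le _ _ (ltnW mk)) (rdiag_gt _ _ mk).
  lin ((r^-1 * d' k l) *: (w k * eqd e)).
case: (ltngtP k m) => [km|mk|->]; ord.
- have f := qmat_main Mq jm kl.
  rewrite (@M_gt m k) // mul0r scaler0 in f.
  rewrite M_diag in e.
  lin ((s^-1^-1 * s^-1^-1) *: (w k * eqd e)
    + (s^-1^-1 * (1 - r^-1 / s^-1)) *: (w m * eqd f)).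
- have f := qmat_main Mq jm mk.
  rewrite M_diag in e f.
  lin ((r^-1 * s^-1^-1) *: (w k * eqd e)
    + (r^-1 * (1 - r^-1 / s^-1)) *: (w l * eqd f)).
- have f := qmat_col Mq m jm.
  rewrite M_diag in e f.
  lin (s^-1^-1 *: (w m * eqd e) - (r^-1 * (1 - r^-1 / s^-1)) *: (w l * eqd f)).
Qed.

(** Induction on the distance from the diagonal. If P intertwines the actions of M j l and of M l
    l.+1, it intertwines their commutator, which is (r - s) times the action of M l l followed or
    preceded by that of M j l.+1; M l l acts invertibly and can be removed. *)
Lemma rllV_all i j k l : (l <= n)%N -> rllV i j k l.
Proof.
have act_rllV j' l' : (forall i k, rllV i j' k l') -> forall i k,
    actl j' l' (fun i => P i k) i = actr j' l' (P i) k.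
  by move=> H i' k'; apply: H.
case: (ltnP l j) => [lj _|].
  have z1 : q' i j *: (M i l * P j k) = 0.
    case: (leqP i j) => ij; first by rewrite roff_le ?scale0r.
    by rewrite M_gt ?mul0r ?scaler0 // (ltn_trans lj).
  have z2 : q' l k *: (P i l * M j k) = 0.
    case: (leqP l k) => lk; first by rewrite roff_le ?scale0r.
    by rewrite M_gt ?mulr0 ?scaler0 // (ltn_trans lk).
  by rewrite /rllV z1 z2 M_gt // mul0r mulr0 !scaler0.
elim: l i k => [|l IH] i k; first by case: j => // _ _; apply: rllV_diag.
rewrite leq_eqVlt => /orP[/eqP <- _|jl ln]; first exact: rllV_diag.
move: jl; rewrite ltnS leq_eqVlt => /orP[/eqP ->|jl]; first exact: rllV_next.
have a1 := act_rllV j l (fun i k => IH i k (ltnW jl) (ltnW ln)).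
have a2 := act_rllV l l.+1 (fun i k => rllV_next i k ln).
have a3 := act_rllV l l (fun i k => rllV_diag i l k).
(* Left and right actions commute ([actlr]), so each factor on the left of P can be turned into one
   on its right, one after the other. *)
have e : actl l l (actl j l.+1 (fun i => P i k)) i
    = actl l l (fun i => actr j l.+1 (P i) k) i.
  have -> : actl l l (fun i => actr j l.+1 (P i) k) i
      = actr j l.+1 (actr l l (P i)) k.
    by rewrite actlr; apply: eq_actr => k'.
  have := actl_main (fun i => P i k) i jl (ltnSn l).
  have -> : actl l l.+1 (actl j l (fun i => P i k)) i
      = actr j l (actr l l.+1 (P i)) k.
    rewrite (@eq_actl _ _ _ (fun i => actr j l (P i) k)) //.
    by rewrite actlr; apply: eq_actr => k'.
  have -> : actl j l (actl l l.+1 (fun i => P i k)) i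
      = actr l l.+1 (actr j l (P i)) k.
    rewrite (@eq_actl _ _ _ (fun i => actr l l.+1 (P i) k)) //.
    by rewrite actlr; apply: eq_actr => k'.
  by rewrite actr_main // => /(scalerI rs0).
(* [actl l l] is a nonzero scalar times left multiplication by u l, hence injective. *)
have z v : actl l l v i = d' i l *: (u l * v i).
  rewrite /actl M_diag; case: (leqP i l) => il.
    by rewrite roff_le // scale0r addr0.
  by rewrite M_gt // mul0r scaler0 addr0.
have d0 : d' i l != 0.
  by rewrite /rdiag; do !case: ifP => _; rewrite ?oner_eq0 ?invr_eq0.
move: e; rewrite !z => /(scalerI d0) e.
have i1 := uV_u (ltnW ln).
change (actl j l.+1 (fun i => P i k) i = actr j l.+1 (P i) k).
lin (uV l * eqd e - eqd i1 * (actl j l.+1 (fun i => P i k) i - actr j l.+1 (P i) k)).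
Qed.

(** Multiply the relation with R^-1 by R on both sides. On the left this mixes (i,j) with (j,i), on
    the right (k,l) with (l,k), which accounts for the four instances. *)
Lemma borel_cross_rll i j k l : (k <= n)%N -> (l <= n)%N ->
  rdiag r s i j *: (P i k * M j l) + roff r s i j *: (P j k * M i l)
  = rdiag r s k l *: (M j l * P i k) + roff r s l k *: (M j k * P i l).
Proof.
move=> kn ln.
have := rllV_all i j k ln; have := rllV_all j i k ln.
have := rllV_all i j l kn; have := rllV_all j i l kn; rewrite /rllV.
case: (ltngtP i j) => ij; case: (ltngtP k l) => kl; rewrite ?ij ?kl ?rdiagii;
(repeat match goal with
  | |- context [rdiag ?a ?b ?i ?j] =>
    first [rewrite (@rdiag_gt K a b i j); [|lia] | rewrite (@rdiag_lt K a b i j); [|lia]]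
  | |- context [roff ?a ?b ?i ?j] =>
    first [rewrite (@roff_gt K a b i j); [|lia] | rewrite (@roff_le K a b i j); [|lia]]
  end); move=> e4 e3 e2 e1.
- lin (- (s^-1 * s^-1) *: eqd e1 - (s^-1 * (1 - r / s)) *: eqd e3).
- lin (- (s^-1 * r) *: eqd e1).
- lin (- s^-1 *: eqd e1).
- lin (- (r * s^-1) *: eqd e1 - ((1 - r / s) * s^-1) *: eqd e2
    - (r * (1 - r / s)) *: eqd e3 - ((1 - r / s) * (1 - r / s)) *: eqd e4).
- lin (- (r * r) *: eqd e1 - ((1 - r / s) * r) *: eqd e2).
- lin (- r *: eqd e1 - (1 - r / s) *: eqd e2).
- lin (- s^-1 *: eqd e1 - (1 - r / s) *: eqd e3).
- lin (- r *: eqd e1).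
- lin (- eqd e1).
Qed.

End Cross.

(* The f_i satisfy the relations of the e_i in the opposite algebra with r and *)
(* s exchanged, so every statement on the e_i and ell^+ applies to the f_i and *)
(* ell^-.                                                                     *)
Section OppositeAlgebra.
Variables (K : fieldType) (A : algType K).

Definition opalg : Type := A^c.
HB.instance Definition _ := GRing.NzRing.on opalg.
HB.instance Definition _ := GRing.Lmodule.copy opalg A.

Fact opalg_scaleAl (c : K) (x y : opalg) : c *: (x * y) = (c *: x : opalg) * y.
Proof. exact: (@scalerAr K A c y x). Qed.
HB.instance Definition _ := GRing.Lmodule_isLalgebra.Build K opalg opalg_scaleAl.

Fact opalg_scaleAr (c : K) (x y : opalg) : c *: (x * y) = x * (c *: y : opalg).
Proof. exact: (@scalerAl K A c y x). Qed.
HB.instance Definition _ := GRing.Lalgebra_isAlgebra.Build K opalg opalg_scaleAr.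

Lemma opalg_mulE (x y : opalg) : x * y = (y : A) * (x : A).
Proof. by []. Qed.

(** Reversing products and transposing exchanges rows with columns, and with them r and s. *)
Lemma qmat_op r s (L : nat -> nat -> A) :
  qmat (A := opalg) s r (fun i j => L j i) <-> qmat r s L.
Proof.
split=> Q; split=> [i k l kl|i j k ji|i j k l ji lk|i j k l ji lk].
- exact: (qmat_col Q i kl).
- exact: (qmat_row Q k ji).
- by rewrite [r * s]mulrC; apply: (qmat_anti Q lk ji).
- have e := qmat_main Q lk ji; rewrite !opalg_mulE in e.
  nc_lin K A (- eqd e).
- exact: (qmat_col Q i kl).
- exact: (qmat_row Q k ji).
- by rewrite [s * r]mulrC; apply: (qmat_anti Q lk ji).
- have e := qmat_main Q lk ji; rewrite !opalg_mulE.
  nc_lin K A (- eqd e).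
Qed.

End OppositeAlgebra.

(** * From a triangular solution back to the Borel relations *)

Section BorelOfMatrix.
Variables (K : fieldType) (A : algType K) (r s : K) (n : nat).
Variables (P : nat -> nat -> A) (tV : nat -> A).
Hypotheses (r0 : r != 0) (s0 : s != 0) (rs0 : r - s != 0).
Hypothesis Q : qmat r s P.
Hypothesis P_lt : forall i j, (i < j)%N -> P i j = 0.
Hypothesis P_out : forall i j, (n < i)%N -> P i j = 0.
Hypothesis tV_P : forall i, (i <= n)%N -> tV i * P i i = 1.
Hypothesis P_tV : forall i, (i <= n)%N -> P i i * tV i = 1.

Local Ltac lin e := nc_lin K A e.

Definition matE (i j : nat) : A := (r - s)^-1 *: (P j i * tV i).
Local Notation x := (fun i => matE i i.+1).

Lemma mat_tt i j : P i i * P j j = P j j * P i i.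
Proof.
wlog ij : i j / (i < j)%N => [W|].
  by case: (ltngtP i j) => [/W //|/W //|->].
have e := qmat_main Q ij ij; rewrite (P_lt ij) mulr0 scaler0 in e.
lin (- eqd e).
Qed.

(** Each position of m relative to i and j selects one of the four quantum matrix relations; its
    correction term, if any, contains an entry above the diagonal. *)
Lemma mat_tP m i j : (i < j)%N -> P m m * P j i = twt r s m i j *: (P j i * P m m).
Proof.
move=> ij; rewrite /twt; case: (ltngtP m i) => [mi|im|->].
- have mj : (m < j)%N by lia.
  have e := qmat_main Q mj mi; rewrite (P_lt mi) mulr0 scaler0 in e.
  by rewrite /=; lin (- eqd e).
- case: (ltngtP m j) => [mj|jm|->].
  + have e := qmat_anti Q mj im.
    by rewrite /=; lin (eqd e).
  + have e := qmat_main Q jm im; rewrite (P_lt jm) mulr0 scaler0 in e.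
    by rewrite /=; lin (eqd e).
  + have e := qmat_row Q j ij.
    by rewrite /=; lin (eqd e).
- have e := qmat_col Q i ij.
  rewrite ?ij /=; lin (eqd e).
Qed.

Lemma twt_neq0 m i j : twt r s m i j != 0.
Proof. by rewrite /twt; do !case: ifP => _; rewrite mulf_neq0 ?oner_eq0. Qed.

Lemma mat_ttV i j : (j <= n)%N -> P i i * tV j = tV j * P i i.
Proof.
move=> jn; have e := mat_tt i j; have e1 := tV_P jn; have e2 := P_tV jn.
lin (- (eqd e1 * (P i i * tV j)) + tV j * eqd e * tV j * (-1)
  + tV j * P i i * eqd e2).
Qed.

Lemma mat_tVtV i j : (i <= n)%N -> (j <= n)%N -> tV i * tV j = tV j * tV i.
Proof.
move=> i_n jn; have e := mat_ttV i jn; have e1 := tV_P i_n; have e2 := P_tV i_n.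
lin (- tV i * eqd e * tV i + eqd e1 * (tV j * tV i) - tV i * tV j * eqd e2).
Qed.

Lemma mat_tVP m i j : (m <= n)%N -> (i < j)%N ->
  tV m * P j i = (twt r s m i j)^-1 *: (P j i * tV m).
Proof.
move=> mn ij; have e := mat_tP m ij; have e1 := tV_P mn; have e2 := P_tV mn.
have w0 := twt_neq0 m i j.
lin (- (twt r s m i j)^-1 *: (tV m * eqd e * tV m)
  + (twt r s m i j)^-1 *: (eqd e1 * P j i * tV m) - tV m * P j i * eqd e2).
Qed.

Lemma mat_tE m i j : (i <= n)%N -> (i < j)%N ->
  P m m * matE i j = twt r s m i j *: (matE i j * P m m).
Proof.
move=> i_n ij; rewrite /matE; have e := mat_tP m ij; have f := mat_ttV m i_n.
lin ((r - s)^-1 *: (eqd e * tV i + twt r s m i j *: (P j i * eqd f))).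
Qed.

Lemma matE_out i j : (n < j)%N -> matE i j = 0.
Proof. by move=> nj; rewrite /matE P_out // mul0r scaler0. Qed.

Local Ltac tVP H m i j v :=
  have H : tV m * P j i = v *: (P j i * tV m)
    by (rewrite mat_tVP; [|lia|lia]; congr (_ *: _); rewrite /twt;
        do !case: ifP => ?; try lia; rewrite ?mul1r ?mulr1 ?invr1).

(** This is [qmat_main] for the entries (j+1, j) and (j, i), whose right-hand side is (r - s) times
    P j.+1 i P j j. *)
Lemma matE_rec i j : (i < j)%N -> (j <= n)%N ->
  matE i j.+1 = r *: (matE j j.+1 * matE i j) - matE i j * matE j j.+1.
Proof.
move=> ij jn; rewrite /matE.
have e := qmat_main Q (ltnSn j) ij.
tVP f1 j i j (r^-1); tVP f2 i j j.+1 (1 : K).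
have f3 := mat_tVtV (leq_trans (ltnW ij) jn) jn; have e1 := P_tV jn.
have d0 := rs0.
lin ((r - s)^-1 * (r - s)^-1 *: (- eqd e * tV j * tV i
  - r *: (P j.+1 j * eqd f1 * tV i) + P j i * eqd f2 * tV j
  + P j i * P j.+1 j * eqd f3
  - (r - s) *: (P j.+1 i * eqd e1 * tV i))).
Qed.

Lemma matE_start i j k : (i < j)%N -> (j < k)%N -> (k <= n)%N ->
  matE i j * matE i k = s *: (matE i k * matE i j).
Proof.
move=> ij jk kn; rewrite /matE; have e := qmat_col Q i jk.
tVP f1 i i j (s^-1); tVP f2 i i k (s^-1).
lin ((r - s)^-1 * (r - s)^-1 *: (P j i * eqd f2 * tV i
  - s *: (P k i * eqd f1 * tV i) + s^-1 *: (eqd e * tV i * tV i))).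
Qed.

Lemma matE_end i j k : (i < j)%N -> (j < k)%N -> (k <= n)%N ->
  matE i k * matE j k = s *: (matE j k * matE i k).
Proof.
move=> ij jk kn; rewrite /matE; have e := qmat_row Q k ij.
tVP f1 i j k (1 : K); tVP f2 j i k ((s * r)^-1).
have f3 := mat_tVtV (leq_trans (ltnW (ltn_trans ij jk)) kn) (leq_trans (ltnW jk) kn).
lin ((r - s)^-1 * (r - s)^-1 *: (P k i * eqd f1 * tV j
  - s *: (P k j * eqd f2 * tV i) - r^-1 *: (eqd e * tV j * tV i)
  + P k i * P k j * eqd f3)).
Qed.

(** The cubic Serre relations arise by inserting [matE_rec] into [matE_start] and [matE_end];
    distant generators commute since the right-hand side of [qmat_main] contains an entry above the
    diagonal. Beyond n both sides are zero. *)
Lemma mat_borel : borel r s x (fun i => P i i).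
Proof.
split.
- split=> [i j ij|i|i].
  + case: (leqP j.+1 n) => jn; last first.
      by rewrite (matE_out _ jn) mulr0 mul0r.
    have ij' : (i.+1 < j.+1)%N by lia.
    have e := qmat_main Q ij' (ltnW ij).
    rewrite (@P_lt i.+1 j) // mulr0 scaler0 in e.
    tVP f1 i j j.+1 (1 : K); tVP f2 j i i.+1 (1 : K).
    have f3 := @mat_tVtV i j ltac:(lia) ltac:(lia).
    rewrite /matE; lin ((r - s)^-1 * (r - s)^-1 *: (P i.+1 i * eqd f1 * tV j
      - P j.+1 j * eqd f2 * tV i - eqd e * tV j * tV i
      + P i.+1 i * P j.+1 j * eqd f3)).
  + case: (leqP i.+2 n) => i_n; last first.
      by rewrite (@matE_out i.+1 i.+2) // !(mulr0, mul0r, scaler0, addr0).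
    have e := matE_start (ltnSn i) (ltnSn i.+1) i_n.
    have f := matE_rec (ltnSn i) (ltnW i_n); rewrite f in e.
    lin (- eqd e).
  + case: (leqP i.+2 n) => i_n; last first.
      by rewrite (@matE_out i.+1 i.+2) // !(mulr0, mul0r, scaler0, addr0).
    have e := matE_end (ltnSn i) (ltnSn i.+1) i_n.
    have f := matE_rec (ltnSn i) (ltnW i_n); rewrite f in e.
    lin (- eqd e).
- exact: mat_tt.
- move=> i j; case: (leqP j.+1 n) => jn; first by apply: mat_tE => //; lia.
  by rewrite (matE_out _ jn) mulr0 mul0r scaler0.
Qed.

(** Consequently P is determined by its diagonal and its first subdiagonal. *)
Lemma matE_rootvec i j : (i < j)%N -> (j <= n)%N -> matE i j = rootvec r x i j.
Proof.
elim: j => // j IH; rewrite ltnS leq_eqVlt => /orP[/eqP -> _|ij jn].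
  by rewrite rootvec1.
by rewrite rootvecS // (matE_rec ij (ltnW jn)) IH // ltnW.
Qed.

End BorelOfMatrix.

Lemma inv_scale (K : fieldType) (A : algType K) (c : K) (z zV v : A) :
  c != 0 -> zV * z = 1 -> z * zV = 1 -> z * v = c *: (v * z) ->
  zV * v = c^-1 *: (v * zV).
Proof.
move=> c0 e1 e2 e.
nc_lin K A (- c^-1 *: (zV * eqd e * zV) + c^-1 *: (eqd e1 * v * zV) - zV * v * eqd e2).
Qed.

(** * From the mixed relation back to the commutators *)

Section CrossOfMatrix.
Variables (K : fieldType) (A : algType K) (r s : K) (n : nat).
Variables (P M : nat -> nat -> A) (tV uV : nat -> A).
Hypotheses (r0 : r != 0) (s0 : s != 0) (rs0 : r - s != 0).
Hypothesis P_lt : forall i j, (i < j)%N -> P i j = 0.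
Hypothesis M_gt : forall i j, (j < i)%N -> M i j = 0.
Hypothesis tV_P : forall i, (i <= n)%N -> tV i * P i i = 1.
Hypothesis P_tV : forall i, (i <= n)%N -> P i i * tV i = 1.
Hypothesis uV_M : forall i, (i <= n)%N -> uV i * M i i = 1.
Hypothesis M_uV : forall i, (i <= n)%N -> M i i * uV i = 1.
Hypothesis QP : qmat r s P.
Hypothesis Q : rll r s P M.

Local Ltac lin e := nc_lin K A e.
Local Notation x i := (matE r s P tV i i.+1).
Local Notation y i := ((s - r)^-1 *: (uV i * M i i.+1)).
Local Notation d := (rdiag r s).

(** As in the next two lemmas, the entry of R P1 M2 = M2 P1 R is chosen so that each off-diagonal
    coefficient of R meets a vanishing triangular entry, leaving a plain commutation up to
    scalar. *)
Lemma cross_tu i j : P i i * M j j = M j j * P i i.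
Proof.
have e := Q i j i j; have d0 : d i j != 0.
  by rewrite /rdiag; do !case: ifP => _; rewrite ?oner_eq0 ?invr_eq0.
have z1 : roff r s i j *: (P j i * M i j) = 0.
  by case: (leqP i j) => ij; [rewrite roff_le ?scale0r | rewrite P_lt ?mul0r ?scaler0].
have z2 : roff r s j i *: (M j i * P i j) = 0.
  by case: (leqP j i) => ij; [rewrite roff_le ?scale0r | rewrite P_lt ?mulr0 ?scaler0].
rewrite z1 z2 !addr0 in e; exact: scalerI d0 _ _ e.
Qed.

Lemma cross_tM m j : P m m * M j j.+1 = (twt r s m j j.+1)^-1 *: (M j j.+1 * P m m).
Proof.
have e := Q m j m j.+1.
have z1 : roff r s m j *: (P j m * M m j.+1) = 0.
  by case: (leqP m j) => ij; [rewrite roff_le ?scale0r | rewrite P_lt ?mul0r ?scaler0].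
have z2 : roff r s j.+1 m *: (M j m * P m j.+1) = 0.
  by case: (leqP j.+1 m) => ij; [rewrite roff_le ?scale0r | rewrite P_lt ?mulr0 ?scaler0].
rewrite z1 z2 !addr0 in e.
have -> : (twt r s m j j.+1)^-1 = (d m j)^-1 * d m j.+1.
  by rewrite /rdiag /twt; do !case: ifP => ?; try lia;
    rewrite ?(mul1r, mulr1, invrK, invr1, mulVf, divff, invr_eq0).
have d0 : d m j != 0.
  by rewrite /rdiag; do !case: ifP => _; rewrite ?oner_eq0 ?invr_eq0.
by lin ((d m j)^-1 *: eqd e).
Qed.

Lemma cross_uP m j : M m m * P j.+1 j = twt s r m j j.+1 *: (P j.+1 j * M m m).
Proof.
have e := Q j.+1 m j m.
have z1 : roff r s j.+1 m *: (P m j * M j.+1 m) = 0.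
  by case: (leqP j.+1 m) => ij; [rewrite roff_le ?scale0r | rewrite M_gt ?mulr0 ?scaler0].
have z2 : roff r s m j *: (M m j * P j.+1 m) = 0.
  by case: (leqP m j) => ij; [rewrite roff_le ?scale0r | rewrite M_gt ?mul0r ?scaler0].
rewrite z1 z2 !addr0 in e.
have -> : twt s r m j j.+1 = (d j m)^-1 * d j.+1 m.
  by rewrite /rdiag /twt; do !case: ifP => ?; try lia;
    rewrite ?(mul1r, mulr1, invrK, invr1, mulVf, divff, invr_eq0).
have d0 : d j m != 0.
  by rewrite /rdiag; do !case: ifP => _; rewrite ?oner_eq0 ?invr_eq0.
by lin (- (d j m)^-1 *: eqd e).
Qed.

Lemma cross_tVu i j : (i <= n)%N -> tV i * M j j = M j j * tV i.
Proof.
move=> i_n; rewrite -[RHS]scale1r -invr1; apply: inv_scale (tV_P i_n) (P_tV i_n) _.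
  exact: oner_neq0.
by rewrite scale1r cross_tu.
Qed.

Lemma cross_tVuV i j : (i <= n)%N -> (j <= n)%N -> tV i * uV j = uV j * tV i.
Proof.
move=> i_n jn; apply/esym; rewrite -[RHS]scale1r -invr1.
apply: inv_scale (uV_M jn) (M_uV jn) _; first exact: oner_neq0.
by rewrite scale1r cross_tVu.
Qed.

Lemma cross_tVy i j : (i <= n)%N -> (j <= n)%N ->
  tV i * y j = twt r s i j j.+1 *: (y j * tV i).
Proof.
move=> i_n jn.
have w0 : (twt r s i j j.+1)^-1 != 0 by rewrite invr_eq0 twt_neq0.
have e := inv_scale w0 (tV_P i_n) (P_tV i_n) (cross_tM i j).
rewrite invrK in e; have f := cross_tVuV i_n jn.
lin ((s - r)^-1 *: (eqd f * M j j.+1 + uV j * eqd e)).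
Qed.

Lemma cross_uVx i j : (i <= n)%N -> (j <= n)%N ->
  uV i * x j = (twt s r i j j.+1)^-1 *: (x j * uV i).
Proof.
move=> i_n jn; have w0 := twt_neq0 s0 r0 i j j.+1.
have e := inv_scale w0 (uV_M i_n) (M_uV i_n) (cross_uP i j).
have f := cross_tVuV jn i_n; rewrite /matE.
lin ((r - s)^-1 *: (eqd e * tV j - (twt s r i j j.+1)^-1 *: (P j.+1 j * eqd f))).
Qed.

(** The entry ((i+1, j), (i, j+1)) compares P i.+1 i M j j.+1 with the opposite product. The
    off-diagonal terms of R contribute only for i = j, where they consist of diagonal entries. *)
Lemma cross_xy i j : (i < n)%N -> (j < n)%N ->
  x i * y j - y j * x i
  = (i == j)%:R *: ((r - s)^-1 *: (tV i * P i.+1 i.+1 - uV i * M i.+1 i.+1)).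
Proof.
move=> i_n jn; rewrite /matE.
have e := Q i.+1 j i j.+1.
have a1 := inv_scale (twt_neq0 s0 r0 j i i.+1) (uV_M (ltnW jn)) (M_uV (ltnW jn)) (cross_uP j i).
have w0 : (twt r s i j j.+1)^-1 != 0 by rewrite invr_eq0 twt_neq0.
have a2 := inv_scale w0 (tV_P (ltnW i_n)) (P_tV (ltnW i_n)) (cross_tM i j).
rewrite invrK in a2; have f := cross_tVuV (ltnW i_n) (ltnW jn).
have w1 := twt_neq0 s0 r0 j i i.+1.
(* x i * y j, with both inverses moved outwards *)
have xy : P i.+1 i * tV i * (uV j * M j j.+1)
    = (twt s r j i i.+1 * twt r s i j j.+1) *: (uV j * P i.+1 i * M j j.+1 * tV i).
  lin (P i.+1 i * eqd f * M j j.+1 + P i.+1 i * uV j * eqd a2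
    - (twt s r j i i.+1 * twt r s i j j.+1) *: (eqd a1 * M j j.+1 * tV i)).
have d0 : d i j.+1 != 0.
  by rewrite /rdiag; do !case: ifP => _; rewrite ?oner_eq0 ?invr_eq0.
(* Moving the two inverses outwards costs exactly the ratio of the diagonal coefficients of R on the
   two sides of [e], so that [xy] and [e] combine to a commutator. *)
have step : twt s r j i i.+1 * twt r s i j j.+1 = d i.+1 j / d i j.+1.
{ apply: (mulIf d0); rewrite divfK //.
  have tw (p q : K) (a b m : nat) (v : K) : (if (a <= m < b)%N then q else 1)
      * (if (a < m <= b)%N then p else 1) = v -> twt p q m a b = v by [].
  case: (ltngtP i j) => [ij|ji|->].
  - rewrite (rdiag_lt _ _ (ltnW ij : i < j.+1)%N) (tw r s j j.+1 i 1); last first.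
      by do !case: ifP => ?; try lia; rewrite mulr1.
    case: (ltngtP i.+1 j) => [ij1|ji1|<-]; [|lia|].
    + rewrite rdiag_lt // (tw s r i i.+1 j 1) ?mul1r //.
      by do !case: ifP => ?; try lia; rewrite mulr1.
    + rewrite rdiagii (tw s r i i.+1 i.+1 s) ?mulr1 ?mulfV //.
      by do !case: ifP => ?; try lia; rewrite mul1r.
  - rewrite (rdiag_gt _ _ (ltnW ji : j < i.+1)%N) (tw s r i i.+1 j 1); last first.
      by do !case: ifP => ?; try lia; rewrite mulr1.
    case: (ltngtP i j.+1) => [ij1|ji1|->]; first lia.
    + rewrite rdiag_gt // (tw r s j j.+1 i 1) ?mul1r //.
      by do !case: ifP => ?; try lia; rewrite mulr1.
    + rewrite rdiagii (tw r s j j.+1 j.+1 r) ?mulr1 ?mul1r //.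
      by do !case: ifP => ?; try lia; rewrite mul1r.
  - rewrite rdiag_lt // rdiag_gt // (tw s r j j.+1 j r) ?(tw r s j j.+1 j s) ?mulfK //.
      by do !case: ifP => ?; try lia; rewrite mulr1.
    by do !case: ifP => ?; try lia; rewrite mulr1. }
rewrite {}step in xy.
have sr0 : s - r != 0 by rewrite -opprB oppr_eq0.
have [ijE|ne] := eqVneq i j; last first.
  have z1 : roff r s i.+1 j *: (P j i * M i.+1 j.+1) = 0.
    case: (leqP i.+1 j) => ij; first by rewrite roff_le ?scale0r.
    by rewrite P_lt ?mul0r ?scaler0 //; lia.
  have z2 : roff r s j.+1 i *: (M j i * P i.+1 j.+1) = 0.
    case: (leqP j.+1 i) => ij; first by rewrite roff_le ?scale0r.
    by rewrite M_gt ?mul0r ?scaler0 //; lia.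
  rewrite z1 z2 !addr0 in e; rewrite /= scale0r.
  by lin ((r - s)^-1 * (s - r)^-1 *: (eqd xy + (d i j.+1)^-1 *: (uV j * eqd e * tV i))).
(* For i = j the surviving products M j j P j.+1 j.+1 and P j j M j.+1 j.+1 become the two Cartan
   terms, and 1 - r/s supplies the factor s - r. *)
rewrite {}ijE in i_n e xy a1 a2 f d0 w0 w1 *; rewrite /= scale1r.
rewrite (rdiag_lt _ _ (ltnSn j)) (rdiag_gt _ _ (ltnSn j)) roff_gt // in e xy.
have g1 := uV_M (ltnW jn); have g2 := P_tV (ltnW jn).
have g3 := mat_ttV QP P_lt tV_P P_tV j.+1 (ltnW jn).
have g4 := cross_tVu j.+1 (ltnW jn).
lin ((r - s)^-1 * (s - r)^-1 *: (eqd xy + s *: (uV j * eqd e * tV j)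
  + (s - r) *: (eqd g1 * P j.+1 j.+1 * tV j + eqd g3
     + uV j * P j j * eqd g4 - uV j * eqd g2 * M j.+1 j.+1))).
Qed.

End CrossOfMatrix.

(** * Entries of the matrix equation R L1 M2 = M2 L1 R *)

Section Kron.
Variables (T : pzRingType) (N : nat).

Lemma kron_l1r (L M : 'M[T]_N) : kron L 1%:M *m kron 1%:M M = kron L M.
Proof.
apply/matrixP => p q; rewrite mxE [RHS]mxE.
rewrite (bigD1 (enum_rank ((enum_val q).1, (enum_val p).2))) //=.
rewrite !mxE enum_rankK /= !eqxx mulr1 mul1r big1 ?addr0 // => x ne.
rewrite !mxE; case: eqP => [e1|_]; last by rewrite mulr0 mul0r.
case: eqP => [e2|_]; last by rewrite mul0r mulr0.
by case/eqP: ne; apply: enum_val_inj; rewrite enum_rankK e1 -e2; case: (enum_val x).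
Qed.

Lemma kron_1rl (L M : 'M[T]_N) p q : (kron 1%:M M *m kron L 1%:M) p q
  = M (enum_val p).2 (enum_val q).2 * L (enum_val p).1 (enum_val q).1.
Proof.
rewrite mxE (bigD1 (enum_rank ((enum_val p).1, (enum_val q).2))) //=.
rewrite !mxE enum_rankK /= !eqxx mulr1 mul1r big1 ?addr0 // => x ne.
rewrite !mxE; case: eqP => [e1|_]; last by rewrite !mul0r.
case: eqP => [e2|_]; last by rewrite !mulr0.
by case/eqP: ne; apply: enum_val_inj; rewrite enum_rankK e1 -e2; case: (enum_val x).
Qed.

End Kron.

Section RmxEntries.
Variables (K : fieldType) (N : nat) (r s : K).
Implicit Types p q : 'I_#|{: 'I_N * 'I_N}|.

Lemma sum_pick (V : pzRingType) (a b : 'I_N) (F : 'I_N -> 'I_N -> V) :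
  (forall i j, (i, j) != (a, b) -> F i j = 0) ->
  \sum_(i < N) \sum_(j < N | (i < j)%N) F i j = (a < b)%N%:R * F a b.
Proof.
move=> F0; rewrite (bigD1 a) //= [X in _ + X]big1 ?addr0; last first.
  move=> i ia; rewrite big1 // => j _; apply: F0.
  by rewrite xpair_eqE (negbTE ia).
case ab : (a < b)%N.
  rewrite (bigD1 b) //= big1 ?addr0 ?mul1r // => j /andP[_ jb]; apply: F0.
  by rewrite xpair_eqE (negbTE jb) andbF.
rewrite mul0r big1 // => j aj; apply: F0.
by apply/eqP => -[jb]; rewrite -jb aj in ab.
Qed.

(** Multiplication by the flip picks the column (l,k) of Rhat, and each of its four sums has at most
    one nonzero term there. *)
Lemma Rmx_entry p q :
  let: (i, j) := enum_val p in let: (k, l) := enum_val q in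
  Rmx N r s p q = ((i == k) && (j == l))%:R * rdiag r s i j
    + ((i == l) && (j == k))%:R * roff r s i j.
Proof.
case Ep : (enum_val p) => [i j]; case Eq : (enum_val q) => [k l].
have flipE x : flip K N x q = (x == enum_rank (l, k))%:R.
  rewrite /flip summxE.
  have -> : (x == enum_rank (l, k)) = (enum_val x == (l, k)).
    by rewrite -(inj_eq enum_val_inj) enum_rankK.
  case Ex : (enum_val x) => [a b].
  rewrite (bigD1 a) //= [X in _ + X]big1 ?addr0; last first.
    move=> i' ne; rewrite summxE big1 // => j' _.
    by rewrite !mxE Ex Eq /= [a == i']eq_sym (negbTE ne) mul0r.
  rewrite summxE (bigD1 b) //= big1 ?addr0; last first.
    by move=> j' ne; rewrite !mxE Ex Eq /= [b == j']eq_sym (negbTE ne) mulr0.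
  rewrite !mxE Ex Eq /= !eqxx xpair_eqE /= -natrM mulnb andbC.
  by rewrite [l == a]eq_sym [k == b]eq_sym.
rewrite /Rmx mxE (bigD1 (enum_rank (l, k))) //= flipE eqxx mulr1.
rewrite big1 ?addr0 => [|x ne]; last by rewrite flipE (negbTE ne) mulr0.
have S0 : (\sum_(i < N) kron (delta_mx i i) (delta_mx i i)) p (enum_rank (l, k))
    = ((i == l) && (j == k) && (i == j))%:R :> K.
  rewrite summxE (bigD1 i) //= big1 ?addr0 => [|i' ne].
    rewrite !mxE enum_rankK Ep /= !eqxx /= -natrM mulnb.
    by congr (_%:R); case: (eqVneq j i) => [->|_]; rewrite ?eqxx ?andbT ?andbF //=;
       rewrite [l == i]eq_sym [k == i]eq_sym.
  by rewrite !mxE enum_rankK Ep /= [i == i']eq_sym (negbTE ne) mul0r.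
have S1 : (\sum_(i < N) \sum_(j < N | (i < j)%N)
      kron (delta_mx j i) (delta_mx i j)) p (enum_rank (l, k))
    = (j < i)%N%:R * ((i == k) && (j == l))%:R :> K.
  rewrite summxE (eq_bigr (fun i' : 'I_N => \sum_(j' < N | (i' < j')%N)
    ((i == j') && (l == i'))%:R * ((j == i') && (k == j'))%:R)); last first.
    move=> i' _; rewrite summxE; apply: eq_bigr => j' _.
    by rewrite !mxE enum_rankK Ep.
  rewrite (@sum_pick _ j i).
    rewrite !eqxx /= -natrM mulnb [l == j]eq_sym [k == i]eq_sym.
    by rewrite [(j == l) && _]andbC.
  move=> i' j'; rewrite xpair_eqE [i == j']eq_sym [j == i']eq_sym.
  by case: (i' == j); case: (j' == i); rewrite //= ?mul0r ?mulr0.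
have S2 : (\sum_(i < N) \sum_(j < N | (i < j)%N)
      kron (delta_mx i j) (delta_mx j i)) p (enum_rank (l, k))
    = (i < j)%N%:R * ((i == k) && (j == l))%:R :> K.
  rewrite summxE (eq_bigr (fun i' : 'I_N => \sum_(j' < N | (i' < j')%N)
    ((i == i') && (l == j'))%:R * ((j == j') && (k == i'))%:R)); last first.
    move=> i' _; rewrite summxE; apply: eq_bigr => j' _.
    by rewrite !mxE enum_rankK Ep.
  rewrite (@sum_pick _ i j).
    rewrite !eqxx /= -natrM mulnb [l == j]eq_sym [k == i]eq_sym.
    by rewrite [(j == l) && _]andbC.
  move=> i' j'; rewrite xpair_eqE [j == j']eq_sym [i == i']eq_sym.
  by case: (i' == i); case: (j' == j); rewrite //= ?mul0r ?mulr0.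
have S3 : (\sum_(i < N) \sum_(j < N | (i < j)%N)
      kron (delta_mx j j) (delta_mx i i)) p (enum_rank (l, k))
    = (j < i)%N%:R * ((i == l) && (j == k))%:R :> K.
  rewrite summxE (eq_bigr (fun i' : 'I_N => \sum_(j' < N | (i' < j')%N)
    ((i == j') && (l == j'))%:R * ((j == i') && (k == i'))%:R)); last first.
    move=> i' _; rewrite summxE; apply: eq_bigr => j' _.
    by rewrite !mxE enum_rankK Ep.
  rewrite (@sum_pick _ j i).
    by rewrite !eqxx /= -natrM mulnb [l == i]eq_sym [k == j]eq_sym.
  move=> i' j'; rewrite xpair_eqE [i == j']eq_sym [j == i']eq_sym.
  by case: (i' == j); case: (j' == i); rewrite //= ?mul0r ?mulr0.
have -> : Rhat N r s p (enum_rank (l, k)) =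
    ((i == l) && (j == k) && (i == j))%:R
    + r * ((j < i)%N%:R * ((i == k) && (j == l))%:R)
    + s^-1 * ((i < j)%N%:R * ((i == k) && (j == l))%:R)
    + (1 - r / s) * ((j < i)%N%:R * ((i == l) && (j == k))%:R).
  by rewrite -S0 -S1 -S2 -S3 /Rhat !mxE.
rewrite /rdiag /roff -(inj_eq val_inj i j) /=.
case: ltngtP => [ij|ji|/val_inj ->]; rewrite ?andbF ?andbT /= ?(mulr0n, mulr1n).
- by rewrite !(mul0r, mul1r, mulr0, add0r, addr0) mulrC [X in _ + X]mulrC.
- by rewrite !(mul0r, mul1r, mulr0, add0r, addr0) mulrC.
- by rewrite !(mul0r, mul1r, mulr0, mulr1, add0r, addr0) andbC.
Qed.

Section RLLEntries.
Variable A : algType K.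
Implicit Types L M : 'M[A]_N.

Definition rll_mxl L M : 'M[A]_#|{: 'I_N * 'I_N}| :=
  map_mx (in_alg A) (Rmx N r s) *m kron L 1%:M *m kron 1%:M M.
Definition rll_mxr L M : 'M[A]_#|{: 'I_N * 'I_N}| :=
  kron 1%:M M *m kron L 1%:M *m map_mx (in_alg A) (Rmx N r s).

Lemma rll_mxl_sum L M p q : rll_mxl L M p q
  = \sum_(x : 'I_#|{: 'I_N * 'I_N}|) Rmx N r s p x
      *: (L (enum_val x).1 (enum_val q).1 * M (enum_val x).2 (enum_val q).2).
Proof.
rewrite /rll_mxl -mulmxA kron_l1r mxE; apply: eq_bigr => x _.
by rewrite !mxE mulr_algl.
Qed.

Lemma rll_mxr_sum L M p q : rll_mxr L M p q
  = \sum_(x : 'I_#|{: 'I_N * 'I_N}|) Rmx N r s x q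
      *: (M (enum_val p).2 (enum_val x).2 * L (enum_val p).1 (enum_val x).1).
Proof.
rewrite /rll_mxr mxE; apply: eq_bigr => x _.
by rewrite kron_1rl mxE mulr_algr.
Qed.

Lemma rll_mxlE L M p q :
  let: (i, j) := enum_val p in let: (k, l) := enum_val q in
  rll_mxl L M p q
  = rdiag r s i j *: (L i k * M j l) + roff r s i j *: (L j k * M i l).
Proof.
have := Rmx_entry p; case Ep : (enum_val p) => [i j] RE.
case Eq : (enum_val q) => [k l].
rewrite rll_mxl_sum Eq /=.
pose c (x : 'I_#|{: 'I_N * 'I_N}|) : A := L (enum_val x).1 k * M (enum_val x).2 l.
have sumd (i' j' : 'I_N) (d : K) :
    \sum_(x : 'I_#|{: 'I_N * 'I_N}|) (((i' == (enum_val x).1) && (j' == (enum_val x).2))%:R * d) *: c x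
    = d *: (L i' k * M j' l).
  rewrite (bigD1 (enum_rank (i', j'))) //= big1 ?addr0 => [|x ne].
    by rewrite /c enum_rankK !eqxx mul1r.
  rewrite (_ : _ && _ = false) ?mul0r ?scale0r //; apply: contraNF ne.
  move=> /andP[/eqP -> /eqP ->]; apply/eqP/enum_val_inj.
  by rewrite enum_rankK; case: (enum_val x).
rewrite -!sumd -big_split /=; apply: eq_bigr => x _.
have := RE x; rewrite -/(c x); case Ex : (enum_val x) => [a b] -> /=.
by rewrite scalerDl [(i == b) && _]andbC.
Qed.

Lemma rll_mxrE L M p q :
  let: (i, j) := enum_val p in let: (k, l) := enum_val q in
  rll_mxr L M p q
  = rdiag r s k l *: (M j l * L i k) + roff r s l k *: (M j k * L i l).
Proof.
have := (fun x : 'I_#|{: 'I_N * 'I_N}| => Rmx_entry x q); case Eq : (enum_val q) => [k l] RE.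
case Ep : (enum_val p) => [i j].
rewrite rll_mxr_sum Ep /=.
pose c (x : 'I_#|{: 'I_N * 'I_N}|) : A := M j (enum_val x).2 * L i (enum_val x).1.
have sumd (i' j' : 'I_N) (d : K) :
    \sum_(x : 'I_#|{: 'I_N * 'I_N}|) (((i' == (enum_val x).1) && (j' == (enum_val x).2))%:R * d) *: c x
    = d *: (M j j' * L i i').
  rewrite (bigD1 (enum_rank (i', j'))) //= big1 ?addr0 => [|x ne].
    by rewrite /c enum_rankK !eqxx mul1r.
  rewrite (_ : _ && _ = false) ?mul0r ?scale0r //; apply: contraNF ne.
  move=> /andP[/eqP -> /eqP ->]; apply/eqP/enum_val_inj.
  by rewrite enum_rankK; case: (enum_val x).
rewrite -!sumd -big_split /=; apply: eq_bigr => x _.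
have := RE x; rewrite -/(c x); case Ex : (enum_val x) => [a b] -> /=.
rewrite scalerDl [k == a]eq_sym [l == b]eq_sym [l == a]eq_sym [k == b]eq_sym.
congr (_ *: _ + _ *: _).
  by case: (eqVneq a k) => [->|_]; case: (eqVneq b l) => [->|_]; rewrite ?mul0r.
by case: (eqVneq a l) => [->|_]; case: (eqVneq b k) => [->|_]; rewrite ?mul0r.
Qed.

End RLLEntries.
End RmxEntries.

(* Families and matrices indexed by ordinals are extended by 0 to nat, where   *)
(* index arithmetic needs no bounds.                                          *)
Section NatIndexed.
Variables (K : fieldType) (A : algType K) (n : nat).

Definition natfun (m : nat) (f : 'I_m -> A) (i : nat) : A :=
  if insub i is Some o then f o else 0.

Lemma natfunE m (f : 'I_m -> A) (i : 'I_m) : natfun f i = f i.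
Proof. by rewrite /natfun valK. Qed.

Lemma natfun_out m (f : 'I_m -> A) i : (m <= i)%N -> natfun f i = 0.
Proof. by move=> mi; rewrite /natfun insubN // -leqNgt. Qed.

Definition natmx (X : 'M[A]_n.+1) (i j : nat) : A :=
  natfun (fun i' => natfun (X i') j) i.

Lemma natmxE X (i j : 'I_n.+1) : natmx X i j = X i j.
Proof. by rewrite /natmx natfunE natfunE. Qed.

Lemma natmx_outl X i j : (n < i)%N -> natmx X i j = 0.
Proof. by move=> ni; rewrite /natmx natfun_out. Qed.

Lemma natmx_outr X i j : (n < j)%N -> natmx X i j = 0.
Proof.
move=> nj; rewrite /natmx /natfun; case: insub => // o.
by rewrite insubN // -leqNgt.
Qed.

Lemma ord_dec (m i : nat) : (exists o : 'I_m, i = o) \/ (m <= i)%N.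
Proof. by case: (ltnP i m) => im; [left; exists (Ordinal im) | right]. Qed.

Lemma rll_natmx r s (L M : 'M[A]_n.+1) :
  (forall p q, rll_mxl r s L M p q = rll_mxr r s L M p q) <->
  rll r s (natmx L) (natmx M).
Proof.
split=> [H i j k l|H p q]; last first.
  have := rll_mxlE r s L M p q; have := rll_mxrE r s L M p q.
  case: (enum_val p) (enum_val q) => [i j] [k l] -> ->.
  by have := H i j k l; rewrite !natmxE.
case: (ord_dec n.+1 i) => [[i' ->]|ni]; last first.
  by rewrite !(@natmx_outl _ i) // !(mul0r, mulr0, scaler0, addr0).
case: (ord_dec n.+1 j) => [[j' ->]|nj]; last first.
  by rewrite !(@natmx_outl _ j) // !(mul0r, mulr0, scaler0, addr0).
case: (ord_dec n.+1 k) => [[k' ->]|nk]; last first.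
  by rewrite !(@natmx_outr _ _ k) // !(mul0r, mulr0, scaler0, addr0).
case: (ord_dec n.+1 l) => [[l' ->]|nl]; last first.
  by rewrite !(@natmx_outr _ _ l) // !(mul0r, mulr0, scaler0, addr0).
have := H (enum_rank (i', j')) (enum_rank (k', l')).
have := rll_mxlE r s L M (enum_rank (i', j')) (enum_rank (k', l')).
have := rll_mxrE r s L M (enum_rank (i', j')) (enum_rank (k', l')).
by rewrite !enum_rankK => -> ->; rewrite !natmxE.
Qed.

End NatIndexed.

Lemma rll_mx_hom (K : fieldType) (N : nat) (r s : K) (A B : algType K)
    (phi : {lrmorphism A -> B}) (L M : 'M[A]_N) p q :
  phi (rll_mxl r s L M p q) = rll_mxl r s (map_mx phi L) (map_mx phi M) p q /\
  phi (rll_mxr r s L M p q) = rll_mxr r s (map_mx phi L) (map_mx phi M) p q.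
Proof.
have := rll_mxlE r s L M p q; have := rll_mxrE r s L M p q.
have := rll_mxlE r s (map_mx phi L) (map_mx phi M) p q.
have := rll_mxrE r s (map_mx phi L) (map_mx phi M) p q.
case: (enum_val p) (enum_val q) => [i j] [k l] -> -> -> ->.
by rewrite !mxE !linearD !linearZ !rmorphM.
Qed.

(** * Explicit Serre sums *)

Section SerreSums.
Variables (K : fieldType) (n : nat) (r s : K).
Hypothesis rs0 : r - s != 0.

Lemma rs_fact0 : rs_fact r s 0 = 1.
Proof. by rewrite /rs_fact big_geq. Qed.

Lemma rs_fact1 : rs_fact r s 1 = 1.
Proof. by rewrite /rs_fact big_nat1 /rs_int !expr1 divff. Qed.

Lemma rs_fact2 : rs_fact r s 2 = r + s.
Proof.
rewrite /rs_fact big_nat_recr //= big_nat1 /rs_int !expr1 divff // mul1r.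
by rewrite subr_sqr mulrAC divff // mul1r.
Qed.

Lemma serre_deg_far (i j : 'I_n) : (i.+1 < j)%N || (j.+1 < i)%N ->
  serre_deg i j = 1%N.
Proof.
move=> ij; rewrite /serre_deg /cartanA.
by do !case: ifP => //; rewrite -?val_eqE /=; lia.
Qed.

Lemma serre_deg_next (i j : 'I_n) : (i.+1 == j) || (j.+1 == i) ->
  serre_deg i j = 2%N.
Proof.
move=> ij; rewrite /serre_deg /cartanA.
by do !case: ifP => //; rewrite -?val_eqE /=; lia.
Qed.

Lemma serre_sum_far (B : algType K) (T : nat -> nat -> B) (i j : 'I_n) :
  (i.+1 < j)%N || (j.+1 < i)%N ->
  \sum_(k < (serre_deg i j).+1) serre_coef r s i j k *: T (serre_deg i j - k)%N k
  = T 1%N 0%N - T 0%N 1%N.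
Proof.
move=> ij; have e0 : eulerA j i = 0.
  by rewrite /eulerA /cartanA; do !case: ifP => //; rewrite -?val_eqE /=; lia.
rewrite /serre_coef e0 serre_deg_far // !big_ord_recl big_ord0 /=.
rewrite /bump /= /rs_bin subn0 subnn rs_fact0 rs_fact1 !mulr0 !addr0 expr0z.
by rewrite expr0 expr1 !mulr1 invr1 !mulr1 scale1r scaleN1r.
Qed.

Hypothesis rs1 : r + s != 0.

(** c is r s to the power of the Euler form of (alpha_j, alpha_i), which is 0 for i < j and -1 for j
    < i. T p q stands for the word x_i^p x_j x_i^q, in whichever order products are read. *)
Lemma serre_sum_next (B : algType K) (T : nat -> nat -> B) (i j : 'I_n) (c : K) :
  r * s != 0 -> (i.+1 == j) || (j.+1 == i) ->
  c = (if (i < j)%N then 1 else (r * s)^-1) ->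
  \sum_(k < (serre_deg i j).+1) serre_coef r s i j k *: T (serre_deg i j - k)%N k
  = T 2%N 0%N - ((r + s) * c) *: T 1%N 1%N + (r * s * c * c) *: T 0%N 2%N.
Proof.
move=> rsn0 ij cE.
have ce : (r * s) ^ (eulerA j i) = c.
  rewrite cE /eulerA /cartanA; case: ifP => [ji|nji].
    have -> : (i < j)%N = false by rewrite ltnNge ltnW.
    have -> : (j == i) = false by rewrite -val_eqE /=; lia.
    by rewrite orbC ij.
  case: ifP => [/eqP e|ne]; first by exfalso; move: ij; rewrite e; lia.
  case: ifP => // nij; exfalso; move: ne; rewrite -val_eqE /=; lia.
rewrite serre_deg_next // !big_ord_recl big_ord0 /serre_coef serre_deg_next //=.
rewrite /rs_bin /= !subn0 subnn /bump /= !addn0 !rs_fact0 !rs_fact1 rs_fact2.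
have -> : 0%:Z + 0%:Z * eulerA j i = 0 by rewrite mul0r.
have -> : 0%:Z + 1%:Z * eulerA j i = eulerA j i by rewrite mul1r add0r.
have -> : 1%:Z + (1 + 1)%N%:Z * eulerA j i = 1 + eulerA j i + eulerA j i.
  by rewrite PoszD mulrDl mul1r addrA.
rewrite !expfzDr // ce expr1z expr0z expr0 sqrrN expr1n !mul1r !mulr1 !divff //.
rewrite !mul1r scale1r addr0 divr1 expr1 mulN1r mulNr scaleNr addrA.
by [].
Qed.

End SerreSums.

(** * Presented algebras *)

Section PresentedLift.
Variables (K : fieldType) (X : choiceType).
Variable E : freealg K X -> freealg K X -> Prop.

Lemma freealg_ind (P : freealg K X -> Prop) :
  P 1 -> (forall x, P (fvar K x)) ->
  (forall u v, P u -> P v -> P (u + v)) ->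
  (forall u v, P u -> P v -> P (u * v)) ->
  (forall c u, P u -> P (c *: u)) ->
  forall z, P z.
Proof.
move=> P1 PX PD PM PZ z.
have P0 : P 0 by rewrite -(scale0r (1 : freealg K X)); apply: PZ.
rewrite (monalgE z); apply: (big_ind P) => // m _; rewrite malgU_scale; apply: PZ.
case: m => m; elim: m => [|x m IH].
  by rewrite -fmoneE; exact: P1.
have -> : FMonom (x :: m) = fmmul (fmu x) (FMonom m).
  by rewrite fmmulE fmuE.
have := PM _ _ (PX x) IH; rewrite fvar.unlock freealg_mulE malgM_def fgmulUU.
by rewrite mul1r.
Qed.

Lemma presalg_ind (P : presalg E -> Prop) :
  P 1 -> (forall x, P (pgen E x)) ->
  (forall u v, P u -> P v -> P (u + v)) ->
  (forall u v, P u -> P v -> P (u * v)) ->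
  (forall c u, P u -> P (c *: u)) ->
  forall z, P z.
Proof.
move=> P1 PX PD PM PZ z; have [g ->] := qapi_surj z.
elim/freealg_ind: g => [|x|u v Pu Pv|u v Pu Pv|c u Pu].
- by rewrite rmorph1.
- by have := PX x; rewrite pgen.unlock.
- by rewrite raddfD; apply: PD.
- by rewrite rmorphM; apply: PM.
- by rewrite linearZ; apply: PZ.
Qed.

Lemma presalg_rel u v : E u v -> qapi (relators E) u = qapi (relators E) v.
Proof.
move=> Euv; apply/eqP; rewrite -subr_eq0 -raddfB; apply/eqP/qmpi_gen0.
by exists 1, (u - v), 1; split; [exists u, v | rewrite mul1r mulr1].
Qed.

Variables (B : algType K) (f : X -> B).
Hypothesis fE : forall u v, E u v -> freealg_eval f u = freealg_eval f v.

Definition presalg_lift : presalg E -> B :=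
  quotmod_lift (freealg_eval f).

Lemma presalg_liftE z : presalg_lift (qapi (relators E) z) = freealg_eval f z.
Proof.
apply: (@quotmod_liftE _ _ _ B (freealg_eval f)) => _ [a [_ [b [[u [v [Euv ->]]] ->]]]].
by rewrite !rmorphM /= rmorphB /= (fE Euv) subrr mulr0 mul0r.
Qed.

Lemma presalg_lift_gen x : presalg_lift (pgen E x) = f x.
Proof. by rewrite pgen.unlock presalg_liftE freealg_evalX. Qed.

Lemma presalg_lift_linear : linear presalg_lift.
Proof.
move=> c x y; have [u ->] := qapi_surj x; have [v ->] := qapi_surj y.
by rewrite -linearP !presalg_liftE linearP.
Qed.

Lemma presalg_lift_monoid_morphism : monoid_morphism presalg_lift.
Proof.
split=> [|x y]; first by rewrite -[1]/(qapi (relators E) 1) presalg_liftE rmorph1.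
have [u ->] := qapi_surj x; have [v ->] := qapi_surj y.
by rewrite -rmorphM !presalg_liftE rmorphM.
Qed.

End PresentedLift.

Section ProjUR.
Variables (K : fieldType) (N : nat) (R : 'M[K]_#|{: 'I_N * 'I_N}|).
Local Notation F := (freealg K (frt_gen N)).

Definition frt_pi : F -> UR R := qapi (relators (frt_eq R)).

Fact frt_pi_linear : linear frt_pi.
Proof. by move=> c u v; rewrite /frt_pi linearP. Qed.
HB.instance Definition _ := GRing.isLinear.Build K F (UR R) _ frt_pi frt_pi_linear.

Fact frt_pi_monoid_morphism : monoid_morphism frt_pi.
Proof. by split=> [|u v]; rewrite /frt_pi ?rmorph1 // rmorphM. Qed.
HB.instance Definition _ := GRing.isMonoidMorphism.Build F (UR R) frt_pi
  frt_pi_monoid_morphism.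

Lemma frt_pi_rel u v : frt_eq R u v -> frt_pi u = frt_pi v.
Proof. exact: presalg_rel. Qed.

Lemma frt_pi_var x : frt_pi (fvar K x) = pgen (frt_eq R) x.
Proof. by rewrite pgen.unlock. Qed.

Lemma map_upper_mx (A B : pzRingType) (phi : {additive A -> B}) (l : tri N -> A) :
  map_mx phi (upper_mx l) = upper_mx (phi \o l).
Proof.
apply/matrixP => i j; rewrite !mxE; case: insub => [p|] //=.
by rewrite raddf0.
Qed.

Lemma map_free_Lp : map_mx frt_pi (free_Lp K N) = Lp R.
Proof.
rewrite /free_Lp -map_trmx map_upper_mx /Lp; congr (_^T).
by apply/matrixP => i j; rewrite !mxE; case: insub => //= p; rewrite frt_pi_var.
Qed.

Lemma map_free_Lm : map_mx frt_pi (free_Lm K N) = Lm R.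
Proof.
rewrite /free_Lm map_upper_mx /Lm.
by apply/matrixP => i j; rewrite !mxE; case: insub => //= p; rewrite frt_pi_var.
Qed.

Lemma upper_mx_lt (A : pzRingType) (l : tri N -> A) (i j : 'I_N) : (j < i)%N ->
  upper_mx l i j = 0.
Proof. by move=> ji; rewrite mxE insubN //= -ltnNge. Qed.

Lemma Lp_lt (i j : 'I_N) : (i < j)%N -> Lp R i j = 0.
Proof. by move=> ij; rewrite /Lp mxE upper_mx_lt. Qed.

Lemma Lm_gt (i j : 'I_N) : (j < i)%N -> Lm R i j = 0.
Proof. by move=> ij; rewrite /Lm upper_mx_lt. Qed.

Lemma Lp_LpV i : Lp R i i * LpV R i = 1.
Proof.
rewrite -map_free_Lp mxE /LpV -frt_pi_var -rmorphM -(rmorph1 frt_pi).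
exact/frt_pi_rel/frt_pV.
Qed.

Lemma LpV_Lp i : LpV R i * Lp R i i = 1.
Proof.
rewrite -map_free_Lp mxE /LpV -frt_pi_var -rmorphM -(rmorph1 frt_pi).
exact/frt_pi_rel/frt_Vp.
Qed.

Lemma Lm_LmV i : Lm R i i * LmV R i = 1.
Proof.
rewrite -map_free_Lm mxE /LmV -frt_pi_var -rmorphM -(rmorph1 frt_pi).
exact/frt_pi_rel/frt_mV.
Qed.

Lemma LmV_Lm i : LmV R i * Lm R i i = 1.
Proof.
rewrite -map_free_Lm mxE /LmV -frt_pi_var -rmorphM -(rmorph1 frt_pi).
exact/frt_pi_rel/frt_Vm.
Qed.

End ProjUR.

Section RLLinUR.
Variables (K : fieldType) (N : nat) (r s : K).
Local Notation R := (Rmx N r s).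

Lemma RLL_UR (L M : 'M[freealg K (frt_gen N)]_N) p q :
  frt_eq R (RLL_l R L M p q) (RLL_r R L M p q) ->
  rll_mxl r s (map_mx (frt_pi R) L) (map_mx (frt_pi R) M) p q
  = rll_mxr r s (map_mx (frt_pi R) L) (map_mx (frt_pi R) M) p q.
Proof.
move=> /frt_pi_rel e; have [<- <-] := rll_mx_hom r s (frt_pi R) L M p q.
exact: e.
Qed.

Lemma RLL_pp p q : rll_mxl r s (Lp R) (Lp R) p q = rll_mxr r s (Lp R) (Lp R) p q.
Proof. by rewrite -map_free_Lp; apply/RLL_UR/frt_pp. Qed.

Lemma RLL_mm p q : rll_mxl r s (Lm R) (Lm R) p q = rll_mxr r s (Lm R) (Lm R) p q.
Proof. by rewrite -map_free_Lm; apply/RLL_UR/frt_mm. Qed.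

Lemma RLL_pm p q : rll_mxl r s (Lp R) (Lm R) p q = rll_mxr r s (Lp R) (Lm R) p q.
Proof. by rewrite -map_free_Lp -map_free_Lm; apply/RLL_UR/frt_pm. Qed.

End RLLinUR.

Lemma serre_sym (K : fieldType) (A : algType K) (r s : K) (x : nat -> A) :
  serre r s x -> serre s r x.
Proof.
case=> far lo hi; split=> // i.
  by rewrite [s * r]mulrC [s + r]addrC.
by rewrite [s * r]mulrC [s + r]addrC.
Qed.

Section SerreSumOrd.
Variables (K : fieldType) (n : nat) (r s : K).
Hypotheses (r0 : r != 0) (s0 : s != 0) (rs0 : r - s != 0) (rs1 : r + s != 0).
Variables (B : algType K) (x : 'I_n -> B).
Variable T : 'I_n -> 'I_n -> nat -> nat -> B.
Hypothesis T10 : forall i j, T i j 1%N 0%N = x i * x j.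
Hypothesis T01 : forall i j, T i j 0%N 1%N = x j * x i.
Hypothesis T20 : forall i j, T i j 2%N 0%N = x i * x i * x j.
Hypothesis T11 : forall i j, T i j 1%N 1%N = x i * x j * x i.
Hypothesis T02 : forall i j, T i j 0%N 2%N = x j * x i * x i.

Local Notation S i j := (\sum_(k < (serre_deg i j).+1)
  serre_coef r s i j k *: T i j (serre_deg i j - k)%N k).
Local Ltac lin e := nc_lin K B e.

(** T is abstract so that the sums for the e_i and, read in the opposite algebra, those for the f_i
    are both covered. For j.+1 = i the sum is (r s)^-1 times the cubic expression of [serre_hi]. *)
Lemma serre_sum_ordP : serre r s (natfun x) <-> forall i j : 'I_n, i != j -> S i j = 0.
Proof.
have rsn0 : r * s != 0 by rewrite mulf_neq0.
have Sfar (i j : 'I_n) : (i.+1 < j)%N || (j.+1 < i)%N -> S i j = x i * x j - x j * x i.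
  by move=> ij; rewrite (serre_sum_far rs0 (T i j) ij) T10 T01.
have Slo (i j : 'I_n) : i.+1 = j -> S i j = x i * x i * x j
    - (r + s) *: (x i * x j * x i) + (r * s) *: (x j * x i * x i).
  move=> ij; have b : (i.+1 == j) || (j.+1 == i) by rewrite ij eqxx.
  have c : 1 = (if (i < j)%N then 1 else (r * s)^-1) by rewrite -ij ltnSn.
  by rewrite (serre_sum_next rs0 rs1 (T i j) rsn0 b c) T20 T11 T02 !mulr1.
have Shi (i j : 'I_n) : j.+1 = i -> S i j = x i * x i * x j
    - ((r + s) / (r * s)) *: (x i * x j * x i) + (r * s)^-1 *: (x j * x i * x i).
  move=> ij; have b : (i.+1 == j) || (j.+1 == i) by rewrite ij eqxx orbT.
  have c : (r * s)^-1 = (if (i < j)%N then 1 else (r * s)^-1).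
    by rewrite -ij ltnNge leqnSn.
  rewrite (serre_sum_next rs0 rs1 (T i j) rsn0 b c) T20 T11 T02.
  by rewrite (divff rsn0) mul1r.
split=> [[far lo hi] i j ne|H].
- have [ij|ij|ij] := ltngtP i j; last by case/eqP: ne; apply: val_inj.
  + move: ij; rewrite leq_eqVlt => /orP[/eqP ij|ij].
      rewrite Slo //; have := lo i; rewrite ij !natfunE => e.
      lin (eqd e).
    rewrite Sfar ?ij //; have := far i j ij; rewrite !natfunE => e.
    lin (eqd e).
  + move: ij; rewrite leq_eqVlt => /orP[/eqP ij|ij].
      rewrite Shi //; have := hi j; rewrite ij !natfunE => e.
      lin ((r * s)^-1 *: eqd e).
    rewrite Sfar ?ij ?orbT //; have := far j i ij; rewrite !natfunE => e.
    lin (- eqd e).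
- split=> [i j ij|i|i].
  + case: (ord_dec n j) => [[j' jE]|nj]; last by rewrite (natfun_out _ nj) mulr0 mul0r.
    case: (ord_dec n i) => [[i' iE]|ni]; last by rewrite (natfun_out _ ni) mulr0 mul0r.
    have ne : i' != j' by rewrite -val_eqE /=; lia.
    have := H _ _ ne; rewrite Sfar -?iE -?jE ?ij // iE jE !natfunE => e.
    lin (eqd e).
  + case: (ord_dec n i.+1) => [[j' jE]|nj]; last first.
      by rewrite (natfun_out _ nj) !(mulr0, mul0r, scaler0, addr0).
    case: (ord_dec n i) => [[i' iE]|ni]; last first.
      by rewrite (natfun_out _ ni) !(mulr0, mul0r, scaler0, addr0).
    have ne : i' != j' by rewrite -val_eqE /=; lia.
    have := H _ _ ne; rewrite Slo -?iE // jE iE !natfunE => e.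
    lin (eqd e).
  + case: (ord_dec n i.+1) => [[j' jE]|nj]; last first.
      by rewrite (natfun_out _ nj) !(mulr0, mul0r, scaler0, addr0).
    case: (ord_dec n i) => [[i' iE]|ni]; last first.
      by rewrite (natfun_out _ ni) !(mulr0, mul0r, scaler0, addr0).
    have ne : j' != i' by rewrite -val_eqE /=; lia.
    have := H _ _ ne; rewrite Shi -?iE // jE iE !natfunE => e.
    lin ((r * s) *: eqd e).
Qed.

End SerreSumOrd.

(** * The relations of the two algebras *)

Section GlRelations.
Variables (K : fieldType) (n : nat) (r s : K).

(** The far, lower and upper commutation rules are merged into [twt]. The Serre relations of the f_i
    are put in the opposite algebra with r and s exchanged, which is the form in which results on
    the e_i apply to them. *)
Record gl_rels (B : algType K) (e f : 'I_n -> B) (a aV a' a'V : 'I_n.+1 -> B) :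
    Prop := GlRels {
  rel_aaV j : a j * aV j = 1;
  rel_aVa j : aV j * a j = 1;
  rel_a'a'V j : a' j * a'V j = 1;
  rel_a'Va' j : a'V j * a' j = 1;
  rel_aa i j : a i * a j = a j * a i;
  rel_aa' i j : a i * a' j = a' j * a i;
  rel_a'a' i j : a' i * a' j = a' j * a' i;
  rel_ae i j : a i * e j = (twt r s i j j.+1)^-1 *: (e j * a i);
  rel_af i j : a i * f j = twt r s i j j.+1 *: (f j * a i);
  rel_a'e i j : a' i * e j = (twt s r i j j.+1)^-1 *: (e j * a' i);
  rel_a'f i j : a' i * f j = twt s r i j j.+1 *: (f j * a' i);
  rel_ef i j : e i * f j - f j * e i = (i == j)%:R *: ((r - s)^-1 *:
    (a (lo i) * aV (hi i) - a' (lo i) * a'V (hi i)));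
  rel_serre_e : serre r s (natfun e);
  rel_serre_f : serre (A := opalg B) s r (natfun f)
}.

Lemma val_hi (i : 'I_n) : hi i = i.+1 :> nat.
Proof. by []. Qed.

Lemma twt_lo (p q : K) (j : 'I_n) : twt p q (lo j) j j.+1 = q.
Proof. by rewrite /twt /= !leqnn ltnn mulr1. Qed.

Lemma twt_hi (p q : K) (j : 'I_n) : twt p q (hi j) j j.+1 = p.
Proof. by rewrite /twt val_hi ltnn andbF !leqnn mul1r. Qed.

Lemma twt_far (p q : K) (i : 'I_n.+1) (j : 'I_n) : (i < j)%N || (j.+1 < i)%N ->
  twt p q i j j.+1 = 1.
Proof. by move=> ij; rewrite /twt; do !case: ifP => ?; try lia; rewrite mulr1. Qed.

Lemma lo_hi_far (i : 'I_n.+1) (j : 'I_n) :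
  [\/ i = lo j, i = hi j | (i < j)%N || (j.+1 < i)%N].
Proof.
case: (ltngtP i j) => [ij|ji|ij]; first by apply: Or33.
  move: ji; rewrite leq_eqVlt => /orP[/eqP ji|ji]; last by apply: Or33.
  by apply: Or32; apply: val_inj; exact: esym ji.
by apply: Or31; apply: val_inj.
Qed.

Lemma twt_cases (B : algType K) (z : 'I_n.+1 -> B) (y : 'I_n -> B)
    (p q : K) (i : 'I_n.+1) (j : 'I_n) :
  ((i < j)%N || (j.+1 < i)%N -> z i * y j = y j * z i) ->
  z (lo j) * y j = q *: (y j * z (lo j)) ->
  z (hi j) * y j = p *: (y j * z (hi j)) ->
  z i * y j = twt p q i j j.+1 *: (y j * z i).
Proof.
case: (lo_hi_far i j) => [->|->|ij].
- by rewrite twt_lo.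
- by rewrite twt_hi.
- by rewrite twt_far // scale1r => ->.
Qed.

Definition gl_gen_map (B : algType K) (e f : 'I_n -> B)
    (a aV a' a'V : 'I_n.+1 -> B) (x : gl_gen n) : B :=
  match x with
  | Ge i => e i | Gf i => f i | Ga j => a j | GaV j => aV j
  | Ga' j => a' j | Ga'V j => a'V j
  end.

Hypotheses (r0 : r != 0) (s0 : s != 0) (rs0 : r - s != 0) (rs1 : r + s != 0).

Lemma gl_rels_hom (B : algType K) (e f : 'I_n -> B) (a aV a' a'V : 'I_n.+1 -> B) :
  gl_rels e f a aV a' a'V -> forall u v, gl_eq r s u v ->
  freealg_eval (gl_gen_map e f a aV a' a'V) u
  = freealg_eval (gl_gen_map e f a aV a' a'V) v.
Proof.
case=> aaV aVa a'a'V a'Va' aa aa' a'a' ae af a'e a'f ef Se Sf u v E.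
pose g := gl_gen_map e f a aV a' a'V.
pose phi : {lrmorphism freealg K (gl_gen n) -> B} := freealg_eval g.
rewrite -[freealg_eval _]/(phi : _ -> _).
have phiX x : phi (fvar K x) = g x by apply: freealg_evalX.
move: phi phiX => phi phiX.
have phiM x y : phi (x * y) = phi x * phi y by apply: rmorphM.
have phiZ k x : phi (k *: x) = k *: phi x by rewrite linearZ.
have phiB x y : phi (x - y) = phi x - phi y by apply: raddfB.
have phi1 : phi 1 = 1 by apply: rmorph1.
have phiE x k : phi (x ^+ k) = phi x ^+ k by apply: rmorphXn.
have phi0 : phi 0 = 0 by apply: raddf0.
case: E => [j|j|j|j|i j|i j|i j|i j ij|i j ij|i j ij|i j ij|i|i|i|i|i|i|i|i|i j
  |i j ij|i j ij].
- by rewrite phiM !phiX phi1 /= aaV.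
- by rewrite phiM !phiX phi1 /= aVa.
- by rewrite phiM !phiX phi1 /= a'a'V.
- by rewrite phiM !phiX phi1 /= a'Va'.
- by rewrite !phiM !phiX /= aa.
- by rewrite !phiM !phiX /= aa'.
- by rewrite !phiM !phiX /= a'a'.
- by rewrite !phiM !phiX /= ae twt_far // invr1 scale1r.
- by rewrite !phiM !phiX /= af twt_far // scale1r.
- by rewrite !phiM !phiX /= a'e twt_far // invr1 scale1r.
- by rewrite !phiM !phiX /= a'f twt_far // scale1r.
- by rewrite phiZ !phiM !phiX /= ae twt_lo.
- by rewrite phiZ !phiM !phiX /= af twt_lo.
- by rewrite phiZ !phiM !phiX /= a'e twt_lo.
- by rewrite phiZ !phiM !phiX /= a'f twt_lo.
- by rewrite phiZ !phiM !phiX /= ae twt_hi.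
- by rewrite phiZ !phiM !phiX /= af twt_hi.
- by rewrite phiZ !phiM !phiX /= a'e twt_hi.
- by rewrite phiZ !phiM !phiX /= a'f twt_hi.
- by rewrite !phiZ !phiB !phiM !phiX /= ef.
- rewrite phi0 raddf_sum /=.
  pose T i j p q := e i ^+ p * e j * e i ^+ q.
  have [H _] := @serre_sum_ordP K n r s r0 s0 rs0 rs1 B e T
    ltac:(by move=> *; rewrite /T expr1 expr0 mulr1)
    ltac:(by move=> *; rewrite /T expr1 expr0 mul1r)
    ltac:(by move=> *; rewrite /T expr0 expr2 mulr1)
    ltac:(by move=> *; rewrite /T expr1)
    ltac:(by move=> *; rewrite /T expr0 expr2 mul1r mulrA).
  rewrite -[RHS](H Se i j ij); apply: eq_bigr => k _.
  by rewrite phiZ !phiM !phiE !phiX.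
- rewrite phi0 raddf_sum /=.
  (* Read in the opposite algebra this is f_i^p f_j f_i^q, hence the exchanged exponents. *)
  pose T i j p q : opalg B := (f i ^+ q * f j * f i ^+ p : B).
  have [H _] : serre r s (natfun (f : 'I_n -> opalg B)) <->
      (forall i j : 'I_n, i != j -> \sum_(k < (serre_deg i j).+1)
        serre_coef r s i j k *: T i j (serre_deg i j - k)%N k = 0).
    { apply: serre_sum_ordP => // i' j'; rewrite /T ?expr0 ?expr1 ?expr2.
    + by rewrite mul1r.
    + by rewrite mulr1.
    + by rewrite mul1r !opalg_mulE.
    + by rewrite !opalg_mulE mulrA.
    + by rewrite mulr1 !opalg_mulE mulrA. }
  rewrite -[RHS](H (serre_sym Sf) i j ij); apply: eq_bigr => k _.
  by rewrite phiZ !phiM !phiE !phiX.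
Qed.

End GlRelations.

Section ProjUgl.
Variables (K : fieldType) (n : nat) (r s : K).
Local Notation F := (freealg K (gl_gen n)).
Local Notation U := (Ugl n r s).

Definition gl_pi : F -> U := qapi (relators (@gl_eq K n r s)).

Fact gl_pi_linear : linear gl_pi.
Proof. by move=> c u v; rewrite /gl_pi linearP. Qed.
HB.instance Definition _ := GRing.isLinear.Build K F U _ gl_pi gl_pi_linear.

Fact gl_pi_monoid_morphism : monoid_morphism gl_pi.
Proof. by split=> [|u v]; rewrite /gl_pi ?rmorph1 // rmorphM. Qed.
HB.instance Definition _ := GRing.isMonoidMorphism.Build F U gl_pi
  gl_pi_monoid_morphism.

Lemma gl_pi_rel u v : gl_eq r s u v -> gl_pi u = gl_pi v.
Proof. exact: presalg_rel. Qed.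

Lemma gl_pi_var x : gl_pi (fvar K x) = pgen (@gl_eq K n r s) x.
Proof. by rewrite pgen.unlock. Qed.

Hypotheses (r0 : r != 0) (s0 : s != 0) (rs0 : r - s != 0) (rs1 : r + s != 0).

Lemma Ugl_rels : gl_rels r s (gl_e r s) (gl_f r s) (gl_a r s) (gl_aV r s)
  (gl_a' r s) (gl_a'V r s) (B := U).
Proof.
have piM (x y : F) : gl_pi (x * y) = gl_pi x * gl_pi y by apply: rmorphM.
have piZ k (x : F) : gl_pi (k *: x) = k *: gl_pi x by rewrite linearZ.
have pi0 : gl_pi 0 = 0 by apply: raddf0.
have piS m (G : 'I_m -> F) : gl_pi (\sum_k G k) = \sum_k gl_pi (G k).
  by apply: raddf_sum.
have piX (x : F) k : gl_pi (x ^+ k) = gl_pi x ^+ k by apply: rmorphXn.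
have pi1 : gl_pi 1 = 1 by apply: rmorph1.
have R u v (E : gl_eq r s u v) : gl_pi u = gl_pi v by apply: gl_pi_rel.
have piMv x y : gl_pi (fvar K x * fvar K y)
    = (pgen (@gl_eq K n r s) x : U) * pgen (@gl_eq K n r s) y.
  by rewrite piM !gl_pi_var.
have piZv k x y : gl_pi (k *: (fvar K x * fvar K y))
    = k *: ((pgen (@gl_eq K n r s) x : U) * pgen (@gl_eq K n r s) y).
  by rewrite piZ piMv.
have tw (p q : K) (i j : nat) : (twt p q i j j.+1)^-1 = twt p^-1 q^-1 i j j.+1.
  by rewrite /twt; do !case: ifP => _; rewrite ?(mul1r, mulr1, invr1, invfM).
split.
- by move=> j; have := R _ _ (gl_aaV r s j); rewrite piM !gl_pi_var pi1.
- by move=> j; have := R _ _ (gl_aVa r s j); rewrite piM !gl_pi_var pi1.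
- by move=> j; have := R _ _ (gl_a'a'V r s j); rewrite piM !gl_pi_var pi1.
- by move=> j; have := R _ _ (gl_a'Va' r s j); rewrite piM !gl_pi_var pi1.
- by move=> i j; have := R _ _ (gl_aa r s i j); rewrite !piM !gl_pi_var.
- by move=> i j; have := R _ _ (gl_aa' r s i j); rewrite !piM !gl_pi_var.
- by move=> i j; have := R _ _ (gl_a'a' r s i j); rewrite !piM !gl_pi_var.
- move=> i j; rewrite tw; apply: twt_cases => [ij||].
  + by have := R _ _ (gl_ae_far r s ij); rewrite !piMv.
  + by have := R _ _ (gl_ae_lo r s j); rewrite piMv piZv.
  + by have := R _ _ (gl_ae_hi r s j); rewrite piMv piZv.
- move=> i j; apply: twt_cases => [ij||].
  + by have := R _ _ (gl_af_far r s ij); rewrite !piMv.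
  + by have := R _ _ (gl_af_lo r s j); rewrite piMv piZv.
  + by have := R _ _ (gl_af_hi r s j); rewrite piMv piZv.
- move=> i j; rewrite tw; apply: twt_cases => [ij||].
  + by have := R _ _ (gl_a'e_far r s ij); rewrite !piMv.
  + by have := R _ _ (gl_a'e_lo r s j); rewrite piMv piZv.
  + by have := R _ _ (gl_a'e_hi r s j); rewrite piMv piZv.
- move=> i j; apply: twt_cases => [ij||].
  + by have := R _ _ (gl_a'f_far r s ij); rewrite !piMv.
  + by have := R _ _ (gl_a'f_lo r s j); rewrite piMv piZv.
  + by have := R _ _ (gl_a'f_hi r s j); rewrite piMv piZv.
- move=> i j; have := R _ _ (gl_ef r s i j).
  by rewrite !piZ !raddfB /= !piM !gl_pi_var.
- pose T i j p q : U := gl_e r s i ^+ p * gl_e r s j * gl_e r s i ^+ q.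
  have [_ H] : serre r s (natfun (gl_e r s : 'I_n -> U)) <->
      (forall i j : 'I_n, i != j -> \sum_(k < (serre_deg i j).+1)
        serre_coef r s i j k *: T i j (serre_deg i j - k)%N k = 0).
  { apply: serre_sum_ordP => // i j; rewrite /T ?expr0 ?expr1 ?expr2.
  + by rewrite mulr1.
  + by rewrite mul1r.
  + by rewrite mulr1.
  + by rewrite mul1r mulrA. }
  apply: H => i j ij.
  rewrite -[RHS]pi0 -(R _ _ (gl_serre_e r s ij)) piS.
  by apply: eq_bigr => k _; rewrite piZ !piM !piX !gl_pi_var.
- apply: serre_sym.
  pose T i j p q : opalg U := (gl_f r s i ^+ q * gl_f r s j * gl_f r s i ^+ p : U).
  have [_ H] : serre r s (natfun (gl_f r s : 'I_n -> opalg U)) <->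
      (forall i j : 'I_n, i != j -> \sum_(k < (serre_deg i j).+1)
        serre_coef r s i j k *: T i j (serre_deg i j - k)%N k = 0).
  { apply: serre_sum_ordP => // i j; rewrite /T ?expr0 ?expr1 ?expr2.
  + by rewrite mul1r.
  + by rewrite mulr1.
  + by rewrite mul1r !opalg_mulE.
  + by rewrite !opalg_mulE mulrA.
  + by rewrite mulr1 !opalg_mulE mulrA. }
  apply: H => i j ij.
  rewrite -[RHS]pi0 -(R _ _ (gl_serre_f r s ij)) piS.
  by apply: eq_bigr => k _; rewrite piZ !piM !piX !gl_pi_var.
Qed.

End ProjUgl.

Section FrtRelations.
Variables (K : fieldType) (N : nat) (r s : K) (B : algType K).
Local Notation R := (Rmx N r s).

Record frt_rels (LP LM : 'M[B]_N) (LPV LMV : 'I_N -> B) : Prop := FrtRels {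
  frt_rel_lower (i j : 'I_N) : (i < j)%N -> LP i j = 0;
  frt_rel_upper (i j : 'I_N) : (j < i)%N -> LM i j = 0;
  frt_rel_pp p q : rll_mxl r s LP LP p q = rll_mxr r s LP LP p q;
  frt_rel_mm p q : rll_mxl r s LM LM p q = rll_mxr r s LM LM p q;
  frt_rel_pm p q : rll_mxl r s LP LM p q = rll_mxr r s LP LM p q;
  frt_rel_pV i : LP i i * LPV i = 1;
  frt_rel_Vp i : LPV i * LP i i = 1;
  frt_rel_mV i : LM i i * LMV i = 1;
  frt_rel_Vm i : LMV i * LM i i = 1
}.

Definition frt_gen_map (LP LM : 'M[B]_N) (LPV LMV : 'I_N -> B) (x : frt_gen N) : B :=
  match x with
  | Glp p => LP (val p).2 (val p).1
  | Glm p => LM (val p).1 (val p).2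
  | GlpV i => LPV i
  | GlmV i => LMV i
  end.

Lemma frt_rels_hom (LP LM : 'M[B]_N) (LPV LMV : 'I_N -> B) :
  frt_rels LP LM LPV LMV -> forall u v, frt_eq R u v ->
  freealg_eval (frt_gen_map LP LM LPV LMV) u
  = freealg_eval (frt_gen_map LP LM LPV LMV) v.
Proof.
case=> low up pp mm pm pV Vp mV Vm u v E.
pose g := frt_gen_map LP LM LPV LMV.
pose phi : {lrmorphism freealg K (frt_gen N) -> B} := freealg_eval g.
rewrite -[freealg_eval _]/(phi : _ -> _).
have phiX x : phi (fvar K x) = g x by apply: freealg_evalX.
move: phi phiX => phi phiX.
have phiM x y : phi (x * y) = phi x * phi y by apply: rmorphM.
have phi1 : phi 1 = 1 by apply: rmorph1.
have upE (c : tri N -> frt_gen N) (L : 'M[B]_N) :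
    (forall p, g (c p) = L (val p).1 (val p).2) ->
    (forall i j : 'I_N, (j < i)%N -> L i j = 0) ->
    map_mx phi (upper_mx (fun p => fvar K (c p))) = L.
  move=> gc L0; apply/matrixP => i j; rewrite !mxE.
  case: insubP => [p _ pE|/=]; first by rewrite phiX gc pE.
  by rewrite -ltnNge => ji; rewrite L0 // raddf0.
have EP : map_mx phi (free_Lp K N) = LP.
  rewrite -[LP]trmxK -[free_Lp K N]trmxK -map_trmx; congr (_^T).
  rewrite /free_Lp trmxK; apply: (upE (@Glp N)) => [p|i j ji]; first by rewrite mxE.
  by rewrite mxE low.
have EM : map_mx phi (free_Lm K N) = LM by rewrite /free_Lm; apply: (upE (@Glm N)).
have EPi i : phi (free_Lp K N i i) = LP i i by rewrite -EP [RHS]mxE.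
have EMi i : phi (free_Lm K N i i) = LM i i by rewrite -EM [RHS]mxE.
have RLL (L M : 'M[freealg K (frt_gen N)]_N) p q :
    rll_mxl r s (map_mx phi L) (map_mx phi M) p q
      = rll_mxr r s (map_mx phi L) (map_mx phi M) p q ->
    phi (RLL_l R L M p q) = phi (RLL_r R L M p q).
  by move=> e; have [h1 h2] := rll_mx_hom r s phi L M p q; rewrite [LHS]h1 e -h2.
case: E => [p q|p q|p q|i|i|i|i].
- by apply: RLL; rewrite EP.
- by apply: RLL; rewrite EM.
- by apply: RLL; rewrite EP EM.
- by rewrite phiM phiX EPi phi1 /= pV.
- by rewrite phiM phiX EPi phi1 /= Vp.
- by rewrite phiM phiX EMi phi1 /= mV.
- by rewrite phiM phiX EMi phi1 /= Vm.
Qed.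

Lemma frt_gen_map_Lp LP LM LPV LMV (phi : {lrmorphism UR R -> B}) :
  frt_rels LP LM LPV LMV ->
  (forall x, phi (pgen (frt_eq R) x) = frt_gen_map LP LM LPV LMV x) ->
  [/\ map_mx phi (Lp R) = LP, map_mx phi (Lm R) = LM,
      forall i, phi (LpV R i) = LPV i & forall i, phi (LmV R i) = LMV i].
Proof.
move=> [low up _ _ _ _ _ _ _] phiX.
have upE (c : tri N -> frt_gen N) (L : 'M[B]_N) :
    (forall p, phi (pgen (frt_eq R) (c p)) = L (val p).1 (val p).2) ->
    (forall i j : 'I_N, (j < i)%N -> L i j = 0) ->
    map_mx phi (upper_mx (fun p => pgen (frt_eq R) (c p) : UR R)) = L.
  move=> gc L0; apply/matrixP => i j; rewrite !mxE.
  case: insubP => [p _ pE|/=]; first by rewrite gc pE.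
  by rewrite -ltnNge => ji; rewrite L0 // raddf0.
split=> [||i|i]; try exact: phiX.
- rewrite -[LP]trmxK /Lp -map_trmx; congr (_^T); apply: (upE (@Glp N)) => [p|i j ji].
    by rewrite phiX mxE.
  by rewrite mxE low.
- by rewrite /Lm; apply: (upE (@Glm N)) => // p; rewrite phiX.
Qed.

End FrtRelations.

Lemma UR_frt_rels (K : fieldType) (N : nat) (r s : K) :
  frt_rels r s (Lp (Rmx N r s)) (Lm (Rmx N r s)) (LpV (Rmx N r s)) (LmV (Rmx N r s)).
Proof.
split; [exact: Lp_lt | exact: Lm_gt | exact: RLL_pp | exact: RLL_mm | exact: RLL_pm
  | exact: Lp_LpV | exact: LpV_Lp | exact: Lm_LmV | exact: LmV_Lm].
Qed.

(** * Generators of gl type from triangular RLL matrices *)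

Section GlOfFrt.
Variables (K : fieldType) (n : nat) (r s : K) (B : algType K).
Variables (LP LM : 'M[B]_n.+1) (LPV LMV : 'I_n.+1 -> B).
Hypotheses (r0 : r != 0) (s0 : s != 0) (rs0 : r - s != 0).
Hypothesis H : frt_rels r s LP LM LPV LMV.

Definition frt_e (i : 'I_n) : B := (r - s)^-1 *: (LP (hi i) (lo i) * LPV (lo i)).
Definition frt_f (i : 'I_n) : B := (s - r)^-1 *: (LMV (lo i) * LM (lo i) (hi i)).

Local Notation P := (natmx LP).
Local Notation M := (natmx LM).
Local Notation Mop := (fun i j => natmx LM j i).
Local Notation tV := (natfun LPV).
Local Notation uV := (natfun LMV).

Lemma natmx_lower i j : (i < j)%N -> P i j = 0.
Proof.
move=> ij; case: (ord_dec n.+1 j) => [[j' jE]|nj]; last by rewrite natmx_outr.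
case: (ord_dec n.+1 i) => [[i' iE]|ni]; last by rewrite natmx_outl.
by rewrite iE jE natmxE (frt_rel_lower H) // -iE -jE.
Qed.

Lemma natmx_upper i j : (j < i)%N -> M i j = 0.
Proof.
move=> ij; case: (ord_dec n.+1 j) => [[j' jE]|nj]; last by rewrite natmx_outr.
case: (ord_dec n.+1 i) => [[i' iE]|ni]; last by rewrite natmx_outl.
by rewrite iE jE natmxE (frt_rel_upper H) // -iE -jE.
Qed.

Lemma nat_tV_P i : (i <= n)%N -> tV i * P i i = 1.
Proof.
move=> i_n; case: (ord_dec n.+1 i) => [[i' ->]|]; last by rewrite ltnNge i_n.
by rewrite natmxE natfunE (frt_rel_Vp H).
Qed.

Lemma nat_P_tV i : (i <= n)%N -> P i i * tV i = 1.
Proof.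
move=> i_n; case: (ord_dec n.+1 i) => [[i' ->]|]; last by rewrite ltnNge i_n.
by rewrite natmxE natfunE (frt_rel_pV H).
Qed.

Lemma nat_uV_M i : (i <= n)%N -> uV i * M i i = 1.
Proof.
move=> i_n; case: (ord_dec n.+1 i) => [[i' ->]|]; last by rewrite ltnNge i_n.
by rewrite natmxE natfunE (frt_rel_Vm H).
Qed.

Lemma nat_M_uV i : (i <= n)%N -> M i i * uV i = 1.
Proof.
move=> i_n; case: (ord_dec n.+1 i) => [[i' ->]|]; last by rewrite ltnNge i_n.
by rewrite natmxE natfunE (frt_rel_mV H).
Qed.

Lemma nat_qmat_P : qmat r s P.
Proof. by apply: rll_qmat => //; apply/rll_natmx/(frt_rel_pp H). Qed.

Lemma nat_qmat_M : qmat r s M.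
Proof. by apply: rll_qmat => //; apply/rll_natmx/(frt_rel_mm H). Qed.

Lemma nat_rll_pm : rll r s P M.
Proof. by apply/rll_natmx/(frt_rel_pm H). Qed.

Lemma frt_eE (i : 'I_n) : matE r s P tV i i.+1 = frt_e i.
Proof. by rewrite /matE /frt_e -(natmxE LP) -(natfunE LPV). Qed.

Lemma frt_e_nat i : natfun frt_e i = matE r s P tV i i.+1.
Proof.
case: (ord_dec n i) => [[i' ->]|ni]; first by rewrite natfunE frt_eE.
by rewrite natfun_out // /matE natmx_outl // mul0r scaler0.
Qed.

Lemma frt_fE (i : 'I_n) : (s - r)^-1 *: (uV i * M i i.+1) = frt_f i.
Proof. by rewrite /frt_f -(natmxE LM) -(natfunE LMV). Qed.

Lemma frt_f_nat i : natfun frt_f i = matE s r (Mop : nat -> nat -> opalg B) uV i i.+1.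
Proof.
case: (ord_dec n i) => [[i' ->]|ni]; first by rewrite natfunE -frt_fE.
by rewrite natfun_out // /matE natmx_outr // opalg_mulE mulr0 scaler0.
Qed.

Lemma sr0 : s - r != 0. Proof. by rewrite -opprB oppr_eq0. Qed.

Lemma op_borel : borel (A := opalg B) s r (natfun frt_f) (fun i => M i i).
Proof.
have [S T X] := @mat_borel K (opalg B) s r n Mop uV s0 r0 sr0
  (proj2 (qmat_op r s M) nat_qmat_M) (fun i j => @natmx_upper j i)
  (fun i j => @natmx_outr _ _ _ LM j i) nat_M_uV nat_uV_M.
split; last first.
- by move=> i j; rewrite frt_f_nat; apply: X.
- exact: T.
- case: S => far lo hi; split=> [i j|i|i]; rewrite !frt_f_nat; [exact: far|exact: lo|exact: hi].
Qed.

(** [mat_borel] applied to LP, and to the transpose of LM in the opposite algebra, gives the two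
    halves. The remaining relations are entries of the mixed relation, with diagonal elements
    replaced by their inverses. *)
Lemma gl_of_frt : gl_rels r s frt_e frt_f LPV (fun j => LP j j) LMV (fun j => LM j j).
Proof.
have [S T X] := mat_borel r0 s0 rs0 nat_qmat_P natmx_lower
  (@natmx_outl _ _ _ LP) nat_tV_P nat_P_tV.
have [Sf Tf Xf] := op_borel.
have ln (j : 'I_n.+1) : (j <= n)%N by rewrite -ltnS.
have ln' (j : 'I_n) : (j <= n)%N by apply: ltnW.
split.
- exact: frt_rel_Vp H.
- exact: frt_rel_pV H.
- exact: frt_rel_Vm H.
- exact: frt_rel_mV H.
- move=> i j; rewrite -!(natfunE LPV).
  exact: (mat_tVtV nat_qmat_P natmx_lower nat_tV_P nat_P_tV).
- move=> i j; rewrite -(natfunE LPV) -(natfunE LMV).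
  exact: (cross_tVuV r0 s0 natmx_lower nat_tV_P nat_P_tV nat_uV_M nat_M_uV nat_rll_pm).
- move=> i j; rewrite -!(natfunE LMV).
  exact: (@mat_tVtV _ (opalg B) _ _ _ _ _ (proj2 (qmat_op r s M) nat_qmat_M)
    (fun i j => @natmx_upper j i) nat_M_uV nat_uV_M j i (ln j) (ln i)).
- move=> i j; rewrite -frt_eE -(natfunE LPV).
  apply: inv_scale (nat_tV_P (ln i)) (nat_P_tV (ln i)) (X i j).
  exact: twt_neq0.
- move=> i j; rewrite -frt_fE -(natfunE LPV).
  exact: (cross_tVy r0 s0 rs0 natmx_lower nat_tV_P nat_P_tV nat_uV_M nat_M_uV nat_rll_pm).
- move=> i j; rewrite -frt_eE -(natfunE LMV).
  exact: (cross_uVx r0 s0 rs0 natmx_lower natmx_upper nat_tV_P nat_P_tV nat_uV_M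
    nat_M_uV nat_rll_pm).
- move=> i j; have := Xf i j; rewrite -(natfunE LMV) natfunE => e.
  have w0 := twt_neq0 s0 r0 i j j.+1.
  have := @inv_scale K (opalg B) _ _ _ _ w0 (nat_M_uV (ln i)) (nat_uV_M (ln i)) e.
  rewrite !opalg_mulE => f.
  by nc_lin K B (- twt s r i j j.+1 *: eqd f).
- move=> i j; rewrite -frt_eE -frt_fE -(natfunE LPV) -(natfunE LMV) -(natmxE LP) -(natmxE LM).
  exact: (cross_xy r0 s0 rs0 natmx_lower natmx_upper nat_tV_P nat_P_tV nat_uV_M
    nat_M_uV nat_qmat_P nat_rll_pm (ltn_ord i) (ltn_ord j)).
- case: S => far lo hi; split=> [i j|i|i]; rewrite !frt_e_nat; [exact: far|exact: lo|exact: hi].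
- exact: Sf.
Qed.

(** LP can be rebuilt from its diagonal and the elements [frt_e]; this makes theta surjective and
    gives [iso_etK]. *)
Lemma borelL_of_frt_p i j : (i <= n)%N -> borelL r s (natfun frt_e)
  (natfun (fun j => LP j j)) i j = natmx LP i j.
Proof.
move=> i_n; have tE k : (k <= n)%N -> natfun (fun j => LP j j) k = natmx LP k k.
  move=> kn; case: (ord_dec n.+1 k) => [[k' ->]|]; last by rewrite ltnNge kn.
  by rewrite natmxE natfunE.
case: (ltngtP i j) => [ij|ji|<-].
- by rewrite borelL_gt // natmx_lower.
- have jn : (j <= n)%N by rewrite (leq_trans (ltnW ji)).
  have -> : natfun frt_e = (fun i => matE r s P tV i i.+1).
    by apply/boolp.funext => k; rewrite frt_e_nat.
  rewrite borelL_lt // tE // -(matE_rootvec r0 s0 rs0 nat_qmat_P natmx_lower nat_tV_P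
    nat_P_tV ji i_n) /matE.
  have e := nat_tV_P jn.
  by nc_lin K B (natmx LP i j * eqd e).
- by rewrite borelL_diag tE.
Qed.

Lemma borelL_of_frt_m i j : (i <= n)%N -> borelL (A := opalg B) s r (natfun frt_f)
  (natfun (fun j => LM j j)) i j = natmx LM j i.
Proof.
move=> i_n; have tE k : (k <= n)%N -> natfun (fun j => LM j j) k = natmx LM k k.
  move=> kn; case: (ord_dec n.+1 k) => [[k' ->]|]; last by rewrite ltnNge kn.
  by rewrite natmxE natfunE.
case: (ltngtP i j) => [ij|ji|<-].
- by rewrite borelL_gt // natmx_upper.
- have jn : (j <= n)%N by rewrite (leq_trans (ltnW ji)).
  have -> : natfun frt_f = (fun i => matE s r (Mop : nat -> nat -> opalg B) uV i i.+1).
    by apply/boolp.funext => k; rewrite frt_f_nat.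
  rewrite borelL_lt // tE //.
  rewrite -(@matE_rootvec _ (opalg B) _ _ _ _ _ s0 r0 sr0 (proj2 (qmat_op r s M) nat_qmat_M)
    (fun i j => @natmx_upper j i) nat_M_uV nat_uV_M _ _ ji i_n) /matE !opalg_mulE.
  have e := nat_M_uV jn; have d0 := sr0.
  by nc_lin K B (eqd e * natmx LM j i).
- by rewrite borelL_diag tE.
Qed.


End GlOfFrt.

Lemma inv_comm (K : fieldType) (A : algType K) (z zV v : A) :
  zV * z = 1 -> z * zV = 1 -> z * v = v * z -> zV * v = v * zV.
Proof.
move=> e1 e2 e; nc_lin K A (- (zV * eqd e * zV) + eqd e1 * v * zV - zV * v * eqd e2).
Qed.

(** * Triangular RLL matrices from generators of gl type *)

Section FrtOfGl.
Variables (K : fieldType) (n : nat) (r s : K) (B : algType K).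
Variables (e f : 'I_n -> B) (a aV a' a'V : 'I_n.+1 -> B).
Hypotheses (r0 : r != 0) (s0 : s != 0) (rs0 : r - s != 0) (rs1 : r + s != 0).
Hypothesis H : gl_rels r s e f a aV a' a'V.

Local Notation x := (natfun e).
Local Notation y := (natfun f).
Local Notation t := (natfun aV).
Local Notation tV := (natfun a).
Local Notation u := (natfun a'V).
Local Notation uV := (natfun a').
Local Notation P := (borelL r s x t).
Local Notation M := (fun i j => borelL (A := opalg B) s r y u j i).

Definition gl_Lp : 'M[B]_n.+1 := \matrix_(i, j) P i j.
Definition gl_Lm : 'M[B]_n.+1 := \matrix_(i, j) (M i j : B).

Local Ltac inr i o n E :=
  case: (ord_dec n i) => [[o E]|E]; last by
    rewrite (natfun_out _ E) ?(mulr0, mul0r, scaler0).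

Lemma gl_tt i j : t i * t j = t j * t i.
Proof.
inr i i' n.+1 E; inr j j' n.+1 E'; rewrite E E' !natfunE.
apply: inv_comm (rel_aVa H i') (rel_aaV H i') _; apply/esym.
by apply: inv_comm (rel_aVa H j') (rel_aaV H j') _; apply: (rel_aa H).
Qed.

Lemma gl_uu i j : u i * u j = u j * u i.
Proof.
inr i i' n.+1 E; inr j j' n.+1 E'; rewrite E E' !natfunE.
apply: inv_comm (rel_a'Va' H i') (rel_a'a'V H i') _; apply/esym.
by apply: inv_comm (rel_a'Va' H j') (rel_a'a'V H j') _; apply: (rel_a'a' H).
Qed.

Lemma gl_tu i j : t i * u j = u j * t i.
Proof.
inr i i' n.+1 E; inr j j' n.+1 E'; rewrite E E' !natfunE.
apply: inv_comm (rel_aVa H i') (rel_aaV H i') _; apply/esym.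
by apply: inv_comm (rel_a'Va' H j') (rel_a'a'V H j') _; rewrite (rel_aa' H).
Qed.

Lemma gl_tx i j : t i * x j = twt r s i j j.+1 *: (x j * t i).
Proof.
inr i i' n.+1 E; inr j j' n E'; rewrite E E' !natfunE -[twt _ _ _ _ _]invrK.
apply: inv_scale (rel_aVa H i') (rel_aaV H i') (rel_ae H i' j').
by rewrite invr_eq0 twt_neq0.
Qed.

Lemma gl_ux i j : u i * x j = twt s r i j j.+1 *: (x j * u i).
Proof.
inr i i' n.+1 E; inr j j' n E'; rewrite E E' !natfunE -[twt _ _ _ _ _]invrK.
apply: inv_scale (rel_a'Va' H i') (rel_a'a'V H i') (rel_a'e H i' j').
by rewrite invr_eq0 twt_neq0.
Qed.

Lemma gl_ty i j : t i * y j = (twt r s i j j.+1)^-1 *: (y j * t i).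
Proof.
inr i i' n.+1 E; inr j j' n E'; rewrite E E' !natfunE.
apply: inv_scale (rel_aVa H i') (rel_aaV H i') (rel_af H i' j').
exact: twt_neq0.
Qed.

Lemma gl_uy i j : y j * u i = twt s r i j j.+1 *: (u i * y j).
Proof.
inr i i' n.+1 E; inr j j' n E'; rewrite E E' !natfunE.
have w0 := twt_neq0 s0 r0 i' j' j'.+1.
have h := inv_scale w0 (rel_a'Va' H i') (rel_a'a'V H i') (rel_a'f H i' j').
by nc_lin K B (- twt s r i' j' j'.+1 *: eqd h).
Qed.

Lemma gl_borel : borel r s x t.
Proof. by split; [exact: rel_serre_e H | exact: gl_tt | exact: gl_tx]. Qed.

Lemma gl_op_borel : borel (A := opalg B) s r y u.
Proof.
by split=> [|i j|i j]; [exact: rel_serre_f H | exact: gl_uu | exact: gl_uy].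
Qed.

Lemma gl_qmat_P : qmat r s P.
Proof. exact: borelL_qmat gl_borel rs1. Qed.

Lemma gl_qmat_M : qmat r s (M : nat -> nat -> B).
Proof. by apply/qmat_op; apply: borelL_qmat gl_op_borel _; rewrite addrC. Qed.

Lemma gl_rll_pm (i j k l : 'I_n.+1) :
  rdiag r s i j *: (P i k * (M j l : B)) + roff r s i j *: (P j k * (M i l : B))
  = rdiag r s k l *: ((M j l : B) * P i k) + roff r s l k *: ((M j k : B) * P i l).
Proof.
have ordn (g h : 'I_n.+1 -> B) : (forall p, g p * h p = 1) ->
    forall p : nat, (p <= n)%N -> natfun g p * natfun h p = 1.
  move=> gh p pn; case: (ord_dec n.+1 p) => [[p' ->]|]; last by rewrite ltnNge pn.
  by rewrite !natfunE.
apply: (@borel_cross_rll K B r s n x y t tV u uV (M : nat -> nat -> B)) => //.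
- exact: gl_borel.
- exact: gl_ux.
- exact: gl_ty.
- exact: gl_tu.
- exact: ordn (rel_aaV H).
- exact: ordn (rel_aVa H).
- exact: ordn (rel_a'a'V H).
- exact: ordn (rel_a'Va' H).
- move=> p q pn qn; pose p' := Ordinal pn; pose q' := Ordinal qn.
  have := rel_ef H p' q'.
  rewrite -(natfunE e) -(natfunE f) -!(natfunE a) -!(natfunE aV) -!(natfunE a').
  by rewrite -!(natfunE a'V).
- by move=> p; apply: natfun_out.
- exact: gl_qmat_M.
- by move=> p; rewrite borelL_diag.
- by move=> p; rewrite borelL_lt ?rootvec1.
- by move=> p q qp; rewrite borelL_gt.
- by rewrite -ltnS.
- by rewrite -ltnS.
Qed.

(** Each half is [borelL_qmat], for the f_i through [qmat_op]; the mixed relation is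
    [borel_cross_rll]. *)
Lemma frt_of_gl : frt_rels r s gl_Lp gl_Lm a a'.
Proof.
have rllE (L L' : 'M[B]_n.+1) (l l' : nat -> nat -> B) :
    (forall i j, L i j = l i j) -> (forall i j, L' i j = l' i j) ->
    (forall i j k m : 'I_n.+1,
      rdiag r s i j *: (l i k * l' j m) + roff r s i j *: (l j k * l' i m)
      = rdiag r s k m *: (l' j m * l i k) + roff r s m k *: (l' j k * l i m)) ->
    forall p q, rll_mxl r s L L' p q = rll_mxr r s L L' p q.
  move=> El El' h p q; have := rll_mxlE r s L L' p q; have := rll_mxrE r s L L' p q.
  case: (enum_val p) (enum_val q) => [i j] [k m] -> ->.
  by rewrite !El !El'; apply: h.
have Ep (i j : 'I_n.+1) : gl_Lp i j = P i j by rewrite mxE.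
have Em (i j : 'I_n.+1) : gl_Lm i j = M i j by rewrite mxE.
split.
- by move=> i j ij; rewrite Ep borelL_gt.
- by move=> i j ij; rewrite Em borelL_gt.
- by apply: (rllE _ _ P P Ep Ep) => *; apply: qmat_rll => //; apply: gl_qmat_P.
- by apply: (rllE _ _ (M : nat -> nat -> B) (M : nat -> nat -> B) Em Em) => *;
    apply: (qmat_rll s0 gl_qmat_M).
- by apply: (rllE _ _ P (M : nat -> nat -> B) Ep Em) => *; apply: gl_rll_pm.
- by move=> i; rewrite Ep borelL_diag natfunE (rel_aVa H).
- by move=> i; rewrite Ep borelL_diag natfunE (rel_aaV H).
- by move=> i; rewrite Em borelL_diag natfunE (rel_a'Va' H).
- by move=> i; rewrite Em borelL_diag natfunE (rel_a'a'V H).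
Qed.

Lemma frt_e_of_gl i : frt_e r s gl_Lp a i = e i.
Proof.
rewrite /frt_e mxE val_hi borelL_lt //= rootvec1 !natfunE.
have h := rel_aVa H (lo i); rewrite -(natfunE aV) /= in h.
by nc_lin K B (e i * eqd h).
Qed.

Lemma frt_f_of_gl i : frt_f r s gl_Lm a' i = f i.
Proof.
rewrite /frt_f mxE val_hi borelL_lt //= rootvec1 !natfunE opalg_mulE.
have h := rel_a'a'V H (lo i); rewrite -(natfunE a'V) /= in h.
have d0 : s - r != 0 by rewrite -opprB oppr_eq0.
by nc_lin K B (eqd h * f i).
Qed.

Lemma gl_Lp_diag j : gl_Lp j j = aV j.
Proof. by rewrite mxE borelL_diag natfunE. Qed.

Lemma gl_Lm_diag j : gl_Lm j j = a'V j.
Proof. by rewrite mxE borelL_diag natfunE. Qed.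

End FrtOfGl.

Lemma lrmorphism_of (K : fieldType) (A B : algType K) (f : A -> B) :
  linear f -> monoid_morphism f -> exists phi : {lrmorphism A -> B}, phi =1 f.
Proof.
move=> fl fm.
by exists (HB.pack_for {lrmorphism A -> B} f
  (GRing.isLinear.Build K A B _ f fl) (GRing.isMonoidMorphism.Build A B f fm)).
Qed.

Lemma linear_of (K : fieldType) (V W : lmodType K) (f : V -> W) :
  linear f -> exists phi : {linear V -> W}, phi =1 f.
Proof.
by move=> fl; exists (HB.pack_for {linear V -> W} f (GRing.isLinear.Build K V W _ f fl)).
Qed.

(** * Universal properties and induction on generators *)

Section UglUniversal.
Variables (K : fieldType) (n : nat) (r s : K).
Hypotheses (r0 : r != 0) (s0 : s != 0) (rs0 : r - s != 0) (rs1 : r + s != 0).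
Local Notation U := (Ugl n r s).

Lemma Ugl_lift (B : algType K) (e f : 'I_n -> B) (a aV a' a'V : 'I_n.+1 -> B) :
  gl_rels r s e f a aV a' a'V -> exists phi : {lrmorphism U -> B},
  forall x, phi (pgen (@gl_eq K n r s) x) = gl_gen_map e f a aV a' a'V x.
Proof.
move=> H; have E := gl_rels_hom r0 s0 rs0 rs1 H.
have [phi phiE] := @lrmorphism_of K U B
  (presalg_lift (E := @gl_eq K n r s) (gl_gen_map e f a aV a' a'V))
  (presalg_lift_linear E) (presalg_lift_monoid_morphism E).
by exists phi => x; rewrite phiE presalg_lift_gen.
Qed.

Lemma Ugl_ind (P : U -> Prop) :
  P 1 -> (forall x, P (pgen (@gl_eq K n r s) x)) ->
  (forall u v, P u -> P v -> P (u + v)) ->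
  (forall u v, P u -> P v -> P (u * v)) ->
  (forall c u, P u -> P (c *: u)) ->
  forall z, P z.
Proof. exact: presalg_ind. Qed.

End UglUniversal.

Section URUniversal.
Variables (K : fieldType) (N : nat) (r s : K).
Local Notation R := (Rmx N r s).

Lemma UR_lift (B : algType K) (LP LM : 'M[B]_N) (LPV LMV : 'I_N -> B) :
  frt_rels r s LP LM LPV LMV -> exists phi : {lrmorphism UR R -> B},
  [/\ map_mx phi (Lp R) = LP, map_mx phi (Lm R) = LM,
      forall i, phi (LpV R i) = LPV i & forall i, phi (LmV R i) = LMV i].
Proof.
move=> H; have E := frt_rels_hom H.
have [phi phiE] := @lrmorphism_of K (UR R) B
  (presalg_lift (E := frt_eq R) (frt_gen_map LP LM LPV LMV))
  (presalg_lift_linear E) (presalg_lift_monoid_morphism E).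
exists phi; apply: frt_gen_map_Lp => // x.
by rewrite phiE presalg_lift_gen.
Qed.

Lemma UR_ind (P : UR R -> Prop) :
  P 1 -> (forall i j, P (Lp R i j)) -> (forall i j, P (Lm R i j)) ->
  (forall i, P (LpV R i)) -> (forall i, P (LmV R i)) ->
  (forall u v, P u -> P v -> P (u + v)) ->
  (forall u v, P u -> P v -> P (u * v)) ->
  (forall c u, P u -> P (c *: u)) ->
  forall z, P z.
Proof.
move=> P1 PLp PLm PLpV PLmV PD PM PZ; apply: presalg_ind => // -[p|p|i|i] //.
- have := PLp (val p).2 (val p).1; rewrite !mxE -surjective_pairing valK; exact.
- have := PLm (val p).1 (val p).2; rewrite !mxE -surjective_pairing valK; exact.
- exact: PLpV.
- exact: PLmV.
Qed.

End URUniversal.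

(** * Products and inverses of solutions *)

Section KronProduct.
Variables (T : pzRingType) (N : nat).
Implicit Types L M : 'M[T]_N.

Lemma kron11 : kron 1%:M 1%:M = 1%:M :> 'M[T]_#|{: 'I_N * 'I_N}|.
Proof.
apply/matrixP => x y; rewrite !mxE -natrM mulnb -(inj_eq enum_val_inj).
by case: (enum_val x) (enum_val y) => [i j] [k l]; rewrite xpair_eqE.
Qed.

Lemma sum_enum_val (V : nmodType) (F : 'I_N -> 'I_N -> V) :
  \sum_(x : 'I_#|{: 'I_N * 'I_N}|) F (enum_val x).1 (enum_val x).2
  = \sum_i \sum_j F i j.
Proof.
rewrite pair_big /=.
rewrite (reindex (fun x : 'I_#|{: 'I_N * 'I_N}| => enum_val x)) //=.
by exists enum_rank => x _; rewrite ?enum_valK ?enum_rankK.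
Qed.

Lemma kron1M L M : kron (L *m M) 1%:M = kron L 1%:M *m kron M 1%:M.
Proof.
apply/matrixP => p q; rewrite !mxE.
under [RHS]eq_bigr do rewrite !mxE.
pose F (a b : 'I_N) := L (enum_val p).1 a * ((enum_val p).2 == b)%:R
  * (M a (enum_val q).1 * (b == (enum_val q).2)%:R).
rewrite [RHS](sum_enum_val F) mulr_suml; apply: eq_bigr => a _.
rewrite (bigD1 (enum_val p).2) //= big1 ?addr0 => [|b ne].
  by rewrite /F eqxx mulr1 mulrA.
by rewrite /F [_ == b]eq_sym (negbTE ne) mulr0 mul0r.
Qed.

Lemma kron1rM L M : kron 1%:M (L *m M) = kron 1%:M L *m kron 1%:M M.
Proof.
apply/matrixP => p q; rewrite !mxE.
under [RHS]eq_bigr do rewrite !mxE.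
pose F (a b : 'I_N) := ((enum_val p).1 == a)%:R * L (enum_val p).2 b
  * ((a == (enum_val q).1)%:R * M b (enum_val q).2).
rewrite [RHS](sum_enum_val F) exchange_big mulr_sumr; apply: eq_bigr => b _.
rewrite (bigD1 (enum_val p).1) //= big1 ?addr0 => [|a ne].
  rewrite /F eqxx mul1r; case: (_ == _); first by rewrite !mul1r.
  by rewrite !mul0r mulr0.
by rewrite /F [_ == a]eq_sym (negbTE ne) !mul0r.
Qed.

Lemma kron_comm L M : (forall i j k l, L i j * M k l = M k l * L i j) ->
  kron L 1%:M *m kron 1%:M M = kron 1%:M M *m kron L 1%:M.
Proof.
by move=> LM; apply/matrixP => p q; rewrite kron_l1r kron_1rl mxE LM.
Qed.

End KronProduct.

Section RLLProduct.
Variables (K : fieldType) (N : nat) (r s : K) (B : algType K).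
Implicit Types L M : 'M[B]_N.

(** After exchanging LB1 with MA2, R slides past LA1 MA2 and then past LB1 MB2; exchanging LA1 with
    MB2 restores the order. In the tensor square this produces the coproduct. *)
Lemma rll_mx_prod (LA MA LB MB : 'M[B]_N) :
  (forall i j k l, LB i j * MA k l = MA k l * LB i j) ->
  (forall i j k l, LA i j * MB k l = MB k l * LA i j) ->
  (forall p q, rll_mxl r s LA MA p q = rll_mxr r s LA MA p q) ->
  (forall p q, rll_mxl r s LB MB p q = rll_mxr r s LB MB p q) ->
  forall p q, rll_mxl r s (LA *m LB) (MA *m MB) p q
    = rll_mxr r s (LA *m LB) (MA *m MB) p q.
Proof.
move=> C C' HA HB p q.
have EA : rll_mxl r s LA MA = rll_mxr r s LA MA by apply/matrixP.
have EB : rll_mxl r s LB MB = rll_mxr r s LB MB by apply/matrixP.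
have {}C := kron_comm C; have {}C' := kron_comm C'.
move: EA EB C C'; rewrite /rll_mxl /rll_mxr !kron1M !kron1rM.
move: (map_mx _ _) (kron LA _) (kron LB _) (kron _ MA) (kron _ MB).
move=> R la lb ma mb EA EB C C'.
have -> : R *m (la *m lb) *m (ma *m mb) = (R *m la *m ma) *m (lb *m mb).
  by rewrite !mulmxA -(mulmxA (R *m la) lb ma) C !mulmxA.
rewrite EA.
have -> : ma *m la *m R *m (lb *m mb) = ma *m la *m (R *m lb *m mb).
  by rewrite !mulmxA.
by rewrite EB !mulmxA -(mulmxA ma la mb) C' !mulmxA.
Qed.

(** Inverting R L1 M2 = M2 L1 R gives R M2^-1 L1^-1 = L1^-1 M2^-1 R, which is the original equation
    for the inverses with the entries multiplied in opposite order. This produces the antipode as a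
    morphism into the opposite algebra. *)
Lemma rll_mx_op (L M LI MI : 'M[B]_N) :
  L *m LI = 1%:M -> LI *m L = 1%:M -> M *m MI = 1%:M -> MI *m M = 1%:M ->
  (forall p q, rll_mxl r s L M p q = rll_mxr r s L M p q) ->
  forall p q, @rll_mxl K N r s (opalg B) LI MI p q
    = @rll_mxr K N r s (opalg B) LI MI p q.
Proof.
move=> LL' L'L MM' M'M H p q.
have E : rll_mxl r s L M = rll_mxr r s L M by apply/matrixP.
have l1 : kron L 1%:M *m kron LI 1%:M = 1%:M by rewrite -kron1M LL' kron11.
have l2 : kron LI 1%:M *m kron L 1%:M = 1%:M by rewrite -kron1M L'L kron11.
have m1 : kron 1%:M M *m kron 1%:M MI = 1%:M by rewrite -kron1rM MM' kron11.
have m2 : kron 1%:M MI *m kron 1%:M M = 1%:M by rewrite -kron1rM M'M kron11.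
have E' : map_mx (in_alg B) (Rmx N r s) *m (kron 1%:M MI *m kron LI 1%:M)
    = kron LI 1%:M *m kron 1%:M MI *m map_mx (in_alg B) (Rmx N r s).
  move: E; rewrite /rll_mxl /rll_mxr; set R := map_mx _ _.
  move: (kron L _) (kron LI _) (kron _ M) (kron _ MI) l1 l2 m1 m2.
  move=> l li m mi l1 l2 m1 m2 E.
  have a1 : l *m m *m (mi *m li) = 1%:M.
    by rewrite mulmxA -(mulmxA l) m1 mulmx1 l1.
  have a2 : li *m mi *m (m *m l) = 1%:M.
    by rewrite mulmxA -(mulmxA li) m2 mulmx1 l2.
  rewrite -[LHS]mul1mx -a2 -[li *m mi *m R]mulmx1 -a1.
  rewrite -[LHS]mulmxA -[RHS]mulmxA; congr (_ *m _).
  by rewrite mulmxA -E !mulmxA.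
transitivity ((map_mx (in_alg B) (Rmx N r s)
    *m (kron 1%:M MI *m kron LI 1%:M)) p q).
  rewrite rll_mxl_sum mxE; apply: eq_bigr => x _.
  by rewrite kron_1rl [map_mx _ _ _ _]mxE mulr_algl.
rewrite E' kron_l1r rll_mxr_sum mxE; apply: eq_bigr => x _.
by rewrite !mxE mulr_algr.
Qed.

End RLLProduct.

(** * Inverses of triangular matrices over a noncommutative ring *)

Section TriangularInverse.
Variable A : pzRingType.

Lemma lower_inverse n (L : 'M[A]_n) (d : 'I_n -> A) :
  (forall i j : 'I_n, (i < j)%N -> L i j = 0) ->
  (forall i, L i i * d i = 1) -> (forall i, d i * L i i = 1) ->
  exists X : 'M[A]_n, [/\ L *m X = 1%:M, X *m L = 1%:M,
    forall i j : 'I_n, (i < j)%N -> X i j = 0 & forall i, X i i = d i].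
Proof.
elim: n L d => [|n IH] L d L0 Ld dL.
  by exists 0; split; try by [case]; apply/matrixP => -[].
pose L1 : 'M_(1 + n) := L; pose L' := drsubmx L1; pose c := dlsubmx L1.
have L'0 (i j : 'I_n) : (i < j)%N -> L' i j = 0.
  by move=> ij; rewrite /L' !mxE L0 //= ltn_add2l.
have L'd i : L' i i * d (rshift 1 i) = 1 by rewrite /L' !mxE Ld.
have dL' i : d (rshift 1 i) * L' i i = 1 by rewrite /L' !mxE dL.
have [X [LX XL X0 Xd]] := IH L' (fun i => d (rshift 1 i)) L'0 L'd dL'.
have L1E : L1 = block_mx (L ord0 ord0)%:M 0 c L'.
  rewrite -[LHS]submxK; congr block_mx.
    by apply/matrixP => i j; rewrite !mxE !ord1 eqxx; congr (L _ _); apply: val_inj.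
  by apply/matrixP => i j; rewrite !mxE L0 //= ord1.
pose X1 := block_mx (d ord0)%:M 0 (- (X *m c *m (d ord0)%:M)) X : 'M_(1 + n).
have LX1 : L1 *m X1 = 1%:M.
  rewrite L1E mulmx_block !mulmx0 !mul0mx !addr0 -scalar_mxM Ld mulmxN !mulmxA LX.
  by rewrite mul1mx subrr add0r -scalar_mx_block.
have XL1 : X1 *m L1 = 1%:M.
  rewrite L1E mulmx_block !mulmx0 !mul0mx !addr0 add0r -scalar_mxM dL mulNmx.
  by rewrite -(mulmxA _ (d ord0)%:M) -scalar_mxM dL mulmx1 addNr XL -scalar_mx_block.
have X10 (i j : 'I_(1 + n)) : (i < j)%N -> X1 i j = 0.
{ rewrite /X1; case: (split_ordP i) => i' ->; case: (split_ordP j) => j' ->.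
  - by rewrite !ord1.
  - by rewrite block_mxEur mxE.
  - by move=> /= h; exfalso; move: (ltn_ord j') h; lia.
  - by rewrite block_mxEdr /= ltn_add2l; apply: X0. }
have X1d (i : 'I_(1 + n)) : X1 i i = d i.
  rewrite /X1; case: (split_ordP i) => i' ->.
    by rewrite block_mxEul mxE !ord1 eqxx; congr d; apply: val_inj.
  by rewrite block_mxEdr Xd.
by exists X1.
Qed.

End TriangularInverse.

(** The transpose is lower triangular over the converse ring, where transposition reverses matrix
    products. *)
Lemma upper_inverse (A : pzRingType) n (M : 'M[A]_n) (d : 'I_n -> A) :
  (forall i j : 'I_n, (j < i)%N -> M i j = 0) ->
  (forall i, M i i * d i = 1) -> (forall i, d i * M i i = 1) ->
  exists X : 'M[A]_n, [/\ M *m X = 1%:M, X *m M = 1%:M,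
    forall i j : 'I_n, (j < i)%N -> X i j = 0 & forall i, X i i = d i].
Proof.
move=> M0 Md dM.
pose L : 'M[A^c]_n := \matrix_(i, j) M j i.
have L0 (i j : 'I_n) : (i < j)%N -> L i j = 0 by move=> ij; rewrite mxE M0.
have Ld i : L i i * (d i : A^c) = 1 by rewrite mxE; apply: dM.
have dL i : (d i : A^c) * L i i = 1 by rewrite mxE; apply: Md.
have [X [LX XL X0 Xd]] := lower_inverse L0 Ld dL.
exists (\matrix_(i, j) X j i); split=> [||i j ij|i];
  [ | | by rewrite mxE X0 | by rewrite mxE Xd].
- apply/matrixP => i j; have := congr1 (fun Y : 'M_n => Y j i) XL.
  rewrite !mxE eq_sym => <-; apply: eq_bigr => k _; by rewrite !mxE.
- apply/matrixP => i j; have := congr1 (fun Y : 'M_n => Y j i) LX.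
  rewrite !mxE eq_sym => <-; apply: eq_bigr => k _; by rewrite !mxE.
Qed.

(** * Tensor products and Hopf structures *)

Section TensorLemmas.
Variable K : fieldType.
Implicit Types V W X Z : lmodType K.

Lemma linear_fun0 V W (f : V -> W) : linear f -> f 0 = 0.
Proof. by move=> fl; have := fl (-1) 0 0; rewrite scaler0 addr0 scaleN1r addNr. Qed.

Lemma linear_funD V W (f : V -> W) : linear f -> {morph f : x y / x + y}.
Proof. by move=> fl x y; have := fl 1 x y; rewrite !scale1r. Qed.

Lemma linear_funZ V W (f : V -> W) : linear f -> forall k, {morph f : x / k *: x}.
Proof. by move=> fl k x; have := fl k x 0; rewrite (linear_fun0 fl) !addr0. Qed.

Lemma linear_fun_sum V W (f : V -> W) (I : Type) (r : seq I) (F : I -> V) :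
  linear f -> f (\sum_(i <- r) F i) = \sum_(i <- r) f (F i).
Proof. by move=> fl; apply: (big_morph _ (linear_funD fl) (linear_fun0 fl)). Qed.

Lemma bilinear_of V W Z (f : V -> W -> Z) :
  (forall w, linear (f^~ w)) -> (forall v, linear (f v)) ->
  bilinear_for *:%R *:%R f.
Proof. by move=> fl fr; split=> [w k v v'|v k w w'] /=; [apply: fl|apply: fr]. Qed.

Lemma tpure_linl V W (w : W) : linear (fun v : V => tpure v w).
Proof. by move=> k v v'; apply: ((tpure_bilinear V W).1 w k v v'). Qed.

Lemma tpure_linr V W (v : V) : linear (fun w : W => tpure v w).
Proof. by move=> k w w'; apply: ((tpure_bilinear V W).2 v k w w'). Qed.

Lemma tens_linear_eq V W Z (f g : tens V W -> Z) : linear f -> linear g ->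
  (forall v w, f (tpure v w) = g (tpure v w)) -> f =1 g.
Proof.
move=> fl gl fg; elim/tens_ind => [|v w|x y fx fy].
- by rewrite !linear_fun0.
- exact: fg.
- by rewrite !linear_funD // fx fy.
Qed.

Lemma tmap_bil V W V' W' (f : V -> V') (g : W -> W') : linear f -> linear g ->
  bilinear_for *:%R *:%R (fun v w => tpure (f v) (g w)).
Proof.
by move=> fl gl; apply: bilinear_of => [w k v v'|v k w w'];
  rewrite ?fl ?gl ?(tpure_linl (g w)) ?(tpure_linr (f v)).
Qed.

Lemma tmapE V W V' W' (f : V -> V') (g : W -> W') v w : linear f -> linear g ->
  tmap f g (tpure v w) = tpure (f v) (g w).
Proof. by move=> fl gl; rewrite /tmap (tliftE (tmap_bil fl gl)). Qed.

Lemma tmap_lin V W V' W' (f : V -> V') (g : W -> W') : linear f -> linear g ->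
  linear (tmap f g).
Proof. by move=> fl gl; apply: tlift_linear; apply: tmap_bil. Qed.

Lemma tassoc_in_bil V W X (x : X) :
  bilinear_for *:%R *:%R (fun (v : V) (w : W) => tpure v (tpure w x)).
Proof.
apply: bilinear_of => [w|v]; first exact: tpure_linl.
by move=> k w w'; rewrite (tpure_linl x) (tpure_linr v).
Qed.

Lemma tassoc_bil V W X : bilinear_for *:%R *:%R
  (fun (vw : tens V W) (x : X) => tlift (fun v w => tpure v (tpure w x)) vw).
Proof.
apply: bilinear_of => [x k u u'|vw k x x'].
  exact: (tlift_linear (tassoc_in_bil V W x)).
pose F (z : X) := tlift (fun (v : V) (w : W) => tpure v (tpure w z)).
have l z : linear (F z) := tlift_linear (tassoc_in_bil V W z).
have E z v w : F z (tpure v w) = tpure v (tpure w z).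
  exact: tliftE (tassoc_in_bil V W z) v w.
change (F (k *: x + x') vw = k *: F x vw + F x' vw).
move: F l E => F l E; elim/tens_ind: vw => [|v w|u u' h h'].
- by rewrite !(linear_fun0 (l _)) scaler0 addr0.
- by rewrite !E (tpure_linr w) (tpure_linr v).
- by rewrite !(linear_funD (l _)) h h' scalerDr addrACA.
Qed.

Lemma tassocE V W X (v : V) (w : W) (x : X) :
  tassoc (tpure (tpure v w) x) = tpure v (tpure w x).
Proof. by rewrite /tassoc (tliftE (tassoc_bil V W X)) (tliftE (tassoc_in_bil V W x)). Qed.

Lemma tassoc_lin V W X : linear (@tassoc K V W X).
Proof. exact: tlift_linear (tassoc_bil V W X). Qed.

End TensorLemmas.

Section TensorAlgebraLemmas.
Variable K : fieldType.
Implicit Types A B C : algType K.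

Lemma tens_mulpE A B (a c : A) (b d : B) :
  tpure a b * tpure c d = tpure (a * c) (b * d) :> tens A B.
Proof. exact: tens_mulE. Qed.

Lemma tens_scaleAl A B (k : K) (x y : tens A B) : k *: (x * y) = (k *: x) * y.
Proof.
elim/tens_ind: x => [|a b|u u' h h']; first by rewrite scaler0 !mul0r scaler0.
  elim/tens_ind: y => [|c d|v v' h h']; first by rewrite !mulr0 scaler0.
    rewrite tens_mulpE -(linear_funZ (tpure_linl (b * d))) /=.
    by rewrite -(linear_funZ (tpure_linl b)) /= tens_mulpE scalerAl.
  by rewrite !mulrDr scalerDr h h'.
by rewrite scalerDr !mulrDl scalerDr h h'.
Qed.

Lemma tens_scaleAr A B (k : K) (x y : tens A B) : k *: (x * y) = x * (k *: y).
Proof.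
elim/tens_ind: x => [|a b|u u' h h']; first by rewrite !mul0r scaler0.
  elim/tens_ind: y => [|c d|v v' h h']; first by rewrite scaler0 !mulr0 scaler0.
    rewrite tens_mulpE -(linear_funZ (tpure_linl (b * d))) /=.
    by rewrite -(linear_funZ (tpure_linl d)) /= tens_mulpE scalerAr.
  by rewrite scalerDr !mulrDr scalerDr h h'.
by rewrite !mulrDl scalerDr h h'.
Qed.

Lemma tens_multiplicative A B (Z : pzRingType) (f : tens A B -> Z) :
  {morph f : x y / x + y} -> f 0 = 0 ->
  (forall a b c d, f (tpure (a * c) (b * d)) = f (tpure a b) * f (tpure c d)) ->
  {morph f : x y / x * y}.
Proof.
move=> fD f0 fM x y.
elim/tens_ind: x => [|a b|u u' h h']; first by rewrite mul0r f0 mul0r.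
  elim/tens_ind: y => [|c d|v v' h h']; first by rewrite mulr0 f0 mulr0.
    by rewrite tens_mulpE fM.
  by rewrite mulrDr !fD h h' mulrDr.
by rewrite mulrDl !fD h h' mulrDl.
Qed.

Lemma tmap_mul A B (A' B' : algType K) (f : A -> A') (g : B -> B') :
  linear f -> linear g -> {morph f : x y / x * y} -> {morph g : x y / x * y} ->
  {morph tmap f g : x y / x * y}.
Proof.
move=> fl gl fM gM; apply: tens_multiplicative => [||a b c d].
- exact: linear_funD (tmap_lin fl gl).
- exact: linear_fun0 (tmap_lin fl gl).
- by rewrite !tmapE // fM gM tens_mulpE.
Qed.

End TensorAlgebraLemmas.

Lemma scalar_of (K : fieldType) (V : lmodType K) (f : V -> K^o) :
  linear f -> exists phi : {scalar V}, phi =1 f.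
Proof.
by move=> fl; exists (HB.pack_for {scalar V} (f : V -> K)
  (GRing.isLinear.Build K V K *%R (f : V -> K) fl)).
Qed.

Section HopfBilinear.
Variables (K : fieldType) (A : algType K).

Lemma counit_l_bil (c : A -> K^o) : linear c ->
  bilinear_for *:%R *:%R (fun a b : A => c a *: b).
Proof.
move=> cl; apply: bilinear_of => [w k v v'|v k w w'] /=.
  by rewrite cl scalerDl scalerA.
by rewrite scalerDr !scalerA mulrC.
Qed.

Lemma counit_r_bil (c : A -> K^o) : linear c ->
  bilinear_for *:%R *:%R (fun a b : A => c b *: a).
Proof.
move=> cl; apply: bilinear_of => [w k v v'|v k w w'] /=.
  by rewrite scalerDr !scalerA mulrC.
by rewrite cl scalerDl scalerA.
Qed.

Lemma antipode_l_bil (S : A -> A) : linear S ->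
  bilinear_for *:%R *:%R (fun a b : A => S a * b).
Proof.
move=> Sl; apply: bilinear_of => [w k v v'|v k w w'] /=.
  by rewrite Sl mulrDl -scalerAl.
by rewrite mulrDr -scalerAr.
Qed.

Lemma antipode_r_bil (S : A -> A) : linear S ->
  bilinear_for *:%R *:%R (fun a b : A => a * S b).
Proof.
move=> Sl; apply: bilinear_of => [w k v v'|v k w w'] /=.
  by rewrite mulrDl -scalerAl.
by rewrite Sl mulrDr -scalerAr.
Qed.

End HopfBilinear.

(* A (x) A is nonzero because eps (x) eps maps 1 to 1. *)
Section TensorSquare.
Variables (K : fieldType) (A : algType K) (eps : {lrmorphism A -> K^o}).

Definition tens2 (_ : {lrmorphism A -> K^o}) : Type := tens A A.
Local Notation T := (tens2 eps).

HB.instance Definition _ := GRing.PzRing.copy T (tens A A).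
HB.instance Definition _ := GRing.Lmodule.copy T (tens A A).

Lemma eps_bil : bilinear_for *:%R *:%R (fun a b : A => eps a * eps b : K^o).
Proof.
apply: bilinear_of => [b k a a'|a k b b'] /=.
  by rewrite linearP mulrDl scalerAl.
by rewrite linearP mulrDr scalerAr.
Qed.

Fact tens2_neq0 : (1 : T) != 0.
Proof.
apply/eqP => e; have := congr1 (tlift (fun a b : A => eps a * eps b : K^o)) e.
rewrite [RHS](linear_fun0 (tlift_linear eps_bil)) -[1 : T]/(tpure 1 1).
rewrite (tliftE eps_bil) !rmorph1 mulr1 => /eqP.
by rewrite oner_eq0.
Qed.

HB.instance Definition _ := GRing.PzSemiRing_isNonZero.Build T tens2_neq0.

Fact tens2_scaleAl (k : K) (x y : T) : k *: (x * y) = (k *: x) * y.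
Proof. exact: tens_scaleAl. Qed.
HB.instance Definition _ := GRing.Lmodule_isLalgebra.Build K T tens2_scaleAl.

Fact tens2_scaleAr (k : K) (x y : T) : k *: (x * y) = x * (k *: y).
Proof. exact: tens_scaleAr. Qed.
HB.instance Definition _ := GRing.Lalgebra_isAlgebra.Build K T tens2_scaleAr.

Lemma tens2_inl : exists i1 : {lrmorphism A -> T}, forall a, i1 a = tpure a 1.
Proof.
have [|//|i1 i1E] := @lrmorphism_of K A T (fun a => tpure a 1).
- exact: tpure_linl.
- by split=> // a b; rewrite /= -[RHS]/((tpure a 1 : tens A A) * tpure b 1)
    tens_mulpE mulr1.
- by exists i1.
Qed.

Lemma tens2_inr : exists i2 : {lrmorphism A -> T}, forall a, i2 a = tpure 1 a.
Proof.
have [||i2 i2E] := @lrmorphism_of K A T (fun a => tpure 1 a).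
- exact: tpure_linr.
- by split=> // a b; rewrite /= -[RHS]/((tpure 1 a : tens A A) * tpure 1 b)
    tens_mulpE mulr1.
- by exists i2.
Qed.

End TensorSquare.

Lemma scaler_mulM (K : fieldType) (A : algType K) (c d : K) (x y : A) :
  (c * d) *: (x * y) = (c *: x) * (d *: y).
Proof. by rewrite -scalerAl -scalerAr scalerA. Qed.

Section Composition.
Variable K : fieldType.

Lemma comp_lin (V W Z : lmodType K) (f : V -> W) (g : W -> Z) :
  linear f -> linear g -> linear (fun x => g (f x)).
Proof. by move=> fl gl k x y; rewrite fl gl. Qed.

Lemma comp_mul (A B C : pzRingType) (f : A -> B) (g : B -> C) :
  {morph f : x y / x * y} -> {morph g : x y / x * y} ->
  {morph (fun x => g (f x)) : x y / x * y}.
Proof. by move=> fM gM x y; rewrite fM gM. Qed.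

End Composition.

(* S reverses products, so evaluating S (x) id then multiplying absorbs the   *)
(* left factor of a product first, and id (x) S the right one.                *)
Section Convolution.
Variables (K : fieldType) (A : algType K) (S : A -> A).
Hypothesis SM : forall x y, S (x * y) = S y * S x.
Variable m : tens A A -> A.
Hypothesis m_lin : linear m.
Let m0 : m 0 = 0 := linear_fun0 m_lin.
Let mD : {morph m : x y / x + y} := linear_funD m_lin.

Lemma conv_l_mul : (forall a b, m (tpure a b) = S a * b) ->
  forall t u c, m t = c%:A -> m (t * u) = c *: m u.
Proof.
move=> mE t u c tc.
have inner a b : m (t * tpure a b) = S a * m t * b.
{ elim/tens_ind: {tc} t => [|a' b'|v v' h h'].
  - by rewrite mul0r m0 mulr0 mul0r.
  - by rewrite tens_mulpE !mE SM !mulrA.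
  - by rewrite mulrDl !mD h h' mulrDr mulrDl. }
elim/tens_ind: u => [|a b|v v' h h'].
- by rewrite mulr0 m0 scaler0.
- by rewrite inner tc mE -scalerAr mulr1 -scalerAl.
- by rewrite mulrDr !mD h h' scalerDr.
Qed.

Lemma conv_r_mul : (forall a b, m (tpure a b) = a * S b) ->
  forall t u c, m u = c%:A -> m (t * u) = c *: m t.
Proof.
move=> mE t u c uc.
have inner a b : m (tpure a b * u) = a * m u * S b.
{ elim/tens_ind: {uc} u => [|a' b'|v v' h h'].
  - by rewrite mulr0 m0 mulr0 mul0r.
  - by rewrite tens_mulpE !mE SM !mulrA.
  - by rewrite mulrDr !mD h h' mulrDr mulrDl. }
elim/tens_ind: t => [|a b|v v' h h'].
- by rewrite mul0r m0 scaler0.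
- by rewrite inner uc mE -scalerAr mulr1 -scalerAl.
- by rewrite mulrDl !mD h h' scalerDr.
Qed.

End Convolution.

Lemma tassoc_mul (K : fieldType) (A : algType K) (eps : {lrmorphism A -> K^o})
    (al : tens (tens2 eps) A -> tens A (tens2 eps)) :
  linear al -> (forall a b c, al (tpure (tpure a b : tens2 eps) c)
    = tpure a (tpure b c : tens2 eps)) ->
  {morph al : x y / x * y}.
Proof.
move=> al_lin aE.
have aD := linear_funD al_lin; have a0 := linear_fun0 al_lin.
apply: tens_multiplicative => // ab c ab' c'.
pose p (u : tens2 eps) (z : A) : tens (tens2 eps) A := tpure u z.
have pE u z : tpure u z = p u z by [].
have t0 z : p 0 z = 0 by apply: (linear_fun0 (tpure_linl z)).
have tD z u v : p (u + v) z = p u z + p v z.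
  exact: (linear_funD (tpure_linl z) u v).
have {}aE a b z : al (p (tpure a b) z) = tpure a (tpure b z : tens2 eps).
  exact: aE.
have tM a b a' b' : (tpure a b : tens2 eps) * tpure a' b' = tpure (a * a') (b * b').
  exact: tens_mulpE.
rewrite -!/(p _ _); move: p {pE} t0 tD aE => p t0 tD aE.
elim/tens_ind: ab => [|a b|u u' h h'].
- by rewrite mul0r !t0 a0 mul0r.
- elim/tens_ind: ab' => [|a' b'|u u' h h'].
  + by rewrite mulr0 !t0 a0 mulr0.
  + by rewrite tM !aE tens_mulpE tM.
  + by rewrite mulrDr !tD !aD h h' mulrDr.
- by rewrite mulrDl !tD !aD h h' mulrDl.
Qed.

(** * Hopf axioms checked on generators *)

Section HopfOfGenerators.
Variables (K : fieldType) (A : algType K) (eps : {lrmorphism A -> K^o}).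
Variables (D : {lrmorphism A -> tens2 eps}) (S : {lrmorphism A -> opalg A}).
Variable G : A -> Prop.
Hypothesis G_ind : forall P : A -> Prop, P 1 -> (forall x, G x -> P x) ->
  (forall u v, P u -> P v -> P (u + v)) ->
  (forall u v, P u -> P v -> P (u * v)) ->
  (forall c u, P u -> P (c *: u)) -> forall z, P z.

(** The operations of Z are arguments so that iterated tensor products, known only as rings and
    modules, are allowed as targets. *)
Lemma agree_on_generators (Z : Type) (add mul : Z -> Z -> Z) (sc : K -> Z -> Z)
    (f g : A -> Z) :
  (forall u v, f (u + v) = add (f u) (f v)) ->
  (forall u v, g (u + v) = add (g u) (g v)) ->
  (forall u v, f (u * v) = mul (f u) (f v)) ->
  (forall u v, g (u * v) = mul (g u) (g v)) ->
  (forall c u, f (c *: u) = sc c (f u)) ->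
  (forall c u, g (c *: u) = sc c (g u)) ->
  f 1 = g 1 -> (forall x, G x -> f x = g x) -> f =1 g.
Proof.
move=> fD gD fM gM fZ gZ f1 fG; apply: G_ind => // [u v h h'|u v h h'|c u h].
- by rewrite fD gD h h'.
- by rewrite fM gM h h'.
- by rewrite fZ gZ h.
Qed.

Local Notation T := (tens2 eps).
Local Notation d := (D : A -> T).

Let id_lin : linear (id : A -> A). Proof. by []. Qed.
Let d_lin : linear d. Proof. exact: (linearP D). Qed.
Let d_mul : {morph d : x y / x * y}. Proof. exact: (rmorphM D). Qed.
Let d1 : d 1 = tpure 1 1. Proof. exact: (rmorph1 D). Qed.
Let epsM x y : eps (x * y) = eps x * eps y. Proof. exact: rmorphM. Qed.
Let epsZ c x : eps (c *: x) = c * eps x. Proof. exact: linearZ. Qed.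
Let epsD x y : eps (x + y) = eps x + eps y. Proof. exact: raddfD. Qed.
Let SM x y : S (x * y) = (S y : A) * (S x : A). Proof. by rewrite rmorphM. Qed.

Lemma hopf_coassoc :
  (forall x, G x -> tassoc (tmap d id (d x)) = tmap id d (d x)) ->
  forall x, tassoc (tmap d id (d x)) = tmap id d (d x).
Proof.
have al : linear (@tassoc K A A A : tens T A -> tens A T) := @tassoc_lin K A A A.
have aE a b c : (@tassoc K A A A : tens T A -> tens A T)
    (tpure (tpure a b : T) c) = tpure a (tpure b c : T) by apply: tassocE.
have aM := tassoc_mul al aE.
have l1 : linear (tmap d id : T -> tens T A) := tmap_lin d_lin id_lin.
have l2 : linear (tmap id d : T -> tens A T) := tmap_lin id_lin d_lin.
have M1 : {morph (tmap d id : T -> tens T A) : x y / x * y}.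
  by apply: (tmap_mul d_lin id_lin d_mul).
have M2 : {morph (tmap id d : T -> tens A T) : x y / x * y}.
  by apply: (tmap_mul id_lin d_lin _ d_mul).
have E1 : (tmap d id : T -> tens T A) (tpure 1 1) = tpure (tpure 1 1 : T) 1.
  by rewrite (tmapE 1 1 d_lin id_lin) d1.
have E2 : (tmap id d : T -> tens A T) (tpure 1 1) = tpure 1 (tpure 1 1 : T).
  by rewrite (tmapE 1 1 id_lin d_lin) d1.
change (tassoc (V:=A) (W:=A) (X:=A))
  with ((@tassoc K A A A : tens T A -> tens A T)).
move: (@tassoc K A A A : tens T A -> tens A T) al aE aM => ta al aE aM.
move: (tmap d id : T -> tens T A) (tmap id d : T -> tens A T) l1 l2 M1 M2 E1 E2.
move=> m1 m2 l1 l2 M1 M2 E1 E2 fg.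
have fl := comp_lin (comp_lin d_lin l1) al; have gl := comp_lin d_lin l2.
apply: (@agree_on_generators _ _ _ _ (fun x => ta (m1 (d x))) (fun x => m2 (d x))
  (linear_funD fl) (linear_funD gl) _ _ (linear_funZ fl) (linear_funZ gl)) => //.
- by move=> u v; rewrite d_mul M1 aM.
- by move=> u v; rewrite d_mul M2.
- by rewrite d1 E1 aE E2.
Qed.

Lemma hopf_counit_l :
  (forall x, G x -> tlift (fun a b : A => eps a *: b) (d x) = x) ->
  forall x, tlift (fun a b : A => eps a *: b) (d x) = x.
Proof.
have bil := counit_l_bil (linearP eps : linear (eps : A -> K^o)).
have m_lin := tlift_linear bil; have mE := tliftE bil.
move: (tlift _) m_lin mE => m m_lin mE mG.
have mM : {morph m : x y / x * y}.
{ apply: tens_multiplicative => [||a b a' b'].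
  - exact: linear_funD m_lin.
  - exact: linear_fun0 m_lin.
  - by rewrite !mE epsM; exact: scaler_mulM. }
have fl := comp_lin d_lin m_lin.
apply: (@agree_on_generators _ _ _ _ (fun x => m (d x)) id (linear_funD fl)
  _ (comp_mul d_mul mM) _ (linear_funZ fl)) => //.
by rewrite d1 mE rmorph1 scale1r.
Qed.

Lemma hopf_counit_r :
  (forall x, G x -> tlift (fun a b : A => eps b *: a) (d x) = x) ->
  forall x, tlift (fun a b : A => eps b *: a) (d x) = x.
Proof.
have bil := counit_r_bil (linearP eps : linear (eps : A -> K^o)).
have m_lin := tlift_linear bil; have mE := tliftE bil.
move: (tlift _) m_lin mE => m m_lin mE mG.
have mM : {morph m : x y / x * y}.
{ apply: tens_multiplicative => [||a b a' b'].
  - exact: linear_funD m_lin.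
  - exact: linear_fun0 m_lin.
  - by rewrite !mE epsM; exact: scaler_mulM. }
have fl := comp_lin d_lin m_lin.
apply: (@agree_on_generators _ _ _ _ (fun x => m (d x)) id (linear_funD fl)
  _ (comp_mul d_mul mM) _ (linear_funZ fl)) => //.
by rewrite d1 mE rmorph1 scale1r.
Qed.

(** The convolution of S with the identity is not visibly multiplicative, but [conv_l_mul] shows
    that the elements satisfying the axiom are closed under products. *)
Lemma hopf_antipode_l :
  (forall x, G x -> tlift (fun a b : A => (S a : A) * b) (d x) = (eps x)%:A) ->
  forall x, tlift (fun a b : A => (S a : A) * b) (d x) = (eps x)%:A.
Proof.
have bil := antipode_l_bil (linearP S : linear (S : A -> A)).
have m_lin := tlift_linear bil; have mE := tliftE bil.
move: (tlift _) m_lin mE => m m_lin mE mG.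
have mM := conv_l_mul SM m_lin mE.
have fl := comp_lin d_lin m_lin.
apply: G_ind => // [|u v hu hv|u v hu hv|c u hu].
- by rewrite d1 mE !rmorph1 mulr1 scale1r.
- by rewrite (linear_funD fl) hu hv epsD scalerDl.
- by rewrite d_mul (mM _ _ _ hu) hv epsM scalerA.
- by rewrite (linear_funZ fl) hu epsZ scalerA.
Qed.

Lemma hopf_antipode_r :
  (forall x, G x -> tlift (fun a b : A => a * (S b : A)) (d x) = (eps x)%:A) ->
  forall x, tlift (fun a b : A => a * (S b : A)) (d x) = (eps x)%:A.
Proof.
have bil := antipode_r_bil (linearP S : linear (S : A -> A)).
have m_lin := tlift_linear bil; have mE := tliftE bil.
move: (tlift _) m_lin mE => m m_lin mE mG.
have mM := conv_r_mul SM m_lin mE.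
have fl := comp_lin d_lin m_lin.
apply: G_ind => // [|u v hu hv|u v hu hv|c u hu].
- by rewrite d1 mE !rmorph1 mulr1 scale1r.
- by rewrite (linear_funD fl) hu hv epsD scalerDl.
- by rewrite d_mul (mM _ _ _ hv) hu epsM scalerA mulrC.
- by rewrite (linear_funZ fl) hu epsZ scalerA.
Qed.

Lemma hopf_of_generators :
  (forall x, G x -> tassoc (tmap d id (d x)) = tmap id d (d x)) ->
  (forall x, G x -> tlift (fun a b : A => eps a *: b) (d x) = x) ->
  (forall x, G x -> tlift (fun a b : A => eps b *: a) (d x) = x) ->
  (forall x, G x -> tlift (fun a b : A => (S a : A) * b) (d x) = (eps x)%:A) ->
  (forall x, G x -> tlift (fun a b : A => a * (S b : A)) (d x) = (eps x)%:A) ->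
  exists H : hopf A, [/\ comul H =1 d, counit H =1 eps & antipode H =1 S].
Proof.
move=> /hopf_coassoc A3 /hopf_counit_l A4 /hopf_counit_r A5.
move=> /hopf_antipode_l A6 /hopf_antipode_r A7.
have [D' D'E] := linear_of d_lin.
have eps_lin : linear (eps : A -> K^o) := linearP eps.
have [e' e'E] := scalar_of eps_lin.
have S_lin : linear (S : A -> A) := linearP S.
have [S' S'E] := linear_of S_lin.
have H1 : monoid_morphism D'.
  by split=> [|x y]; rewrite !D'E; [exact: d1 | exact: d_mul].
have H2 : monoid_morphism e'.
  by split=> [|x y]; rewrite !e'E; [exact: rmorph1 | exact: epsM].
have ED : (D' : A -> T) = d by apply/funext.
have Ee : (e' : A -> K) = eps by apply/funext.
have ES : (S' : A -> A) = S by apply/funext.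
have H3 x : tassoc (tmap D' id (D' x)) = tmap id D' (D' x).
  by rewrite ED; apply: A3.
have H4 x : tlift (fun a b => e' a *: b) (D' x) = x.
  by rewrite ED Ee; apply: A4.
have H5 x : tlift (fun a b => e' b *: a) (D' x) = x.
  by rewrite ED Ee; apply: A5.
have H6 x : tlift (fun a b => S' a * b) (D' x) = (e' x)%:A.
  by rewrite ED Ee ES; apply: A6.
have H7 x : tlift (fun a b => a * S' b) (D' x) = (e' x)%:A.
  by rewrite ED Ee ES; apply: A7.
by exists (Hopf H1 H2 H3 H4 H5 H6 H7).
Qed.

End HopfOfGenerators.

Section TriangularProduct.
Variables (A : pzRingType) (n : nat) (X Y : 'M[A]_n).

Lemma lower_mul :
  (forall i j : 'I_n, (i < j)%N -> X i j = 0) ->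
  (forall i j : 'I_n, (i < j)%N -> Y i j = 0) ->
  (forall i j : 'I_n, (i < j)%N -> (X *m Y) i j = 0)
  /\ (forall i, (X *m Y) i i = X i i * Y i i).
Proof.
move=> X0 Y0; split=> [i j ij|i]; rewrite mxE.
  rewrite big1 // => k _; case: (ltnP i k) => [ik|ki]; first by rewrite X0 ?mul0r.
  by rewrite Y0 ?mulr0 //; apply: leq_ltn_trans ij.
rewrite (bigD1 i) //= big1 ?addr0 // => k ki.
case: (ltngtP i k) => [ik|{}ki|ik]; first by rewrite X0 ?mul0r.
  by rewrite Y0 ?mulr0.
by case/eqP: ki; apply/val_inj.
Qed.

Lemma upper_mul :
  (forall i j : 'I_n, (j < i)%N -> X i j = 0) ->
  (forall i j : 'I_n, (j < i)%N -> Y i j = 0) ->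
  (forall i j : 'I_n, (j < i)%N -> (X *m Y) i j = 0)
  /\ (forall i, (X *m Y) i i = X i i * Y i i).
Proof.
move=> X0 Y0; split=> [i j ij|i]; rewrite mxE.
  rewrite big1 // => k _; case: (ltnP k i) => [ik|ki]; first by rewrite X0 ?mul0r.
  by rewrite Y0 ?mulr0 //; apply: leq_trans ij ki.
rewrite (bigD1 i) //= big1 ?addr0 // => k ki.
case: (ltngtP i k) => [ik|{}ki|ik]; first by rewrite Y0 ?mulr0.
  by rewrite X0 ?mul0r.
by case/eqP: ki; apply/val_inj.
Qed.

End TriangularProduct.

Section FrtConstructions.
Variables (K : fieldType) (N : nat) (r s : K).

Lemma frt_rels_one (B : algType K) :
  frt_rels r s (1%:M : 'M[B]_N) 1%:M (fun=> 1) (fun=> 1).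
Proof.
have E p q : rll_mxl r s (1%:M : 'M[B]_N) 1%:M p q = rll_mxr r s 1%:M 1%:M p q.
  by rewrite /rll_mxl /rll_mxr !kron11 !mulmx1 !mul1mx.
split=> // [i j|i j|i|i|i|i]; rewrite !mxE ?eqxx ?mulr1 //.
  by rewrite -val_eqE /=; case: ltngtP.
by rewrite -val_eqE /=; case: ltngtP.
Qed.

Lemma frt_rels_mul (A B : algType K) (i1 i2 : {lrmorphism A -> B})
    (LP LM : 'M[A]_N) LPV LMV :
  (forall a b, i1 a * i2 b = i2 b * i1 a) ->
  frt_rels r s LP LM LPV LMV ->
  frt_rels r s (map_mx i1 LP *m map_mx i2 LP) (map_mx i1 LM *m map_mx i2 LM)
    (fun i => i1 (LPV i) * i2 (LPV i)) (fun i => i1 (LMV i) * i2 (LMV i)).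
Proof.
move=> C [lP uM pp mm pm pV Vp mV Vm].
have rllM (L M : 'M[A]_N) :
    (forall p q, rll_mxl r s L M p q = rll_mxr r s L M p q) ->
    forall p q, rll_mxl r s (map_mx i1 L *m map_mx i2 L)
        (map_mx i1 M *m map_mx i2 M) p q
      = rll_mxr r s (map_mx i1 L *m map_mx i2 L) (map_mx i1 M *m map_mx i2 M) p q.
{ move=> H; apply: rll_mx_prod => [i j k l|i j k l|p q|p q].
  - by rewrite !mxE C.
  - by rewrite !mxE C.
  - by have [<- <-] := rll_mx_hom r s i1 L M p q; rewrite H.
  - by have [<- <-] := rll_mx_hom r s i2 L M p q; rewrite H. }
have mapl (phi : {lrmorphism A -> B}) (i j : 'I_N) :
    (i < j)%N -> map_mx phi LP i j = 0 by move=> ij; rewrite mxE lP ?raddf0.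
have mapu (phi : {lrmorphism A -> B}) (i j : 'I_N) :
    (j < i)%N -> map_mx phi LM i j = 0 by move=> ij; rewrite mxE uM ?raddf0.
have [lo0 lod] := lower_mul (mapl i1) (mapl i2).
have [up0 upd] := upper_mul (mapu i1) (mapu i2).
have inv2 a b a' b' : a * a' = 1 -> b * b' = 1 ->
    i1 a * i2 b * (i1 a' * i2 b') = 1.
  move=> ea eb; rewrite mulrA -(mulrA (i1 a)) -C mulrA -mulrA -!rmorphM ea eb.
  by rewrite !rmorph1 mulr1.
split; [exact: lo0|exact: up0|exact: rllM|exact: rllM|exact: rllM|..] => i;
  by rewrite ?lod ?upd !mxE inv2.
Qed.

Lemma frt_rels_inv (B : algType K) (LP LM : 'M[B]_N) LPV LMV :
  frt_rels r s LP LM LPV LMV -> exists LI MI : 'M[B]_N,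
  [/\ LP *m LI = 1%:M, LI *m LP = 1%:M, LM *m MI = 1%:M, MI *m LM = 1%:M
    & frt_rels r s (B := opalg B) LI MI (fun i => LP i i) (fun i => LM i i)].
Proof.
move=> [lP uM pp mm pm pV Vp mV Vm].
have [LI [a1 a2 a3 a4]] := lower_inverse lP pV Vp.
have [MI [b1 b2 b3 b4]] := upper_inverse uM mV Vm.
exists LI, MI; split=> //; split.
- exact: a3.
- exact: b3.
- exact: (rll_mx_op a1 a2 a1 a2 pp).
- exact: (rll_mx_op b1 b2 b1 b2 mm).
- exact: (rll_mx_op a1 a2 b1 b2 pm).
- by move=> i; rewrite opalg_mulE a4; apply: pV.
- by move=> i; rewrite opalg_mulE a4; apply: Vp.
- by move=> i; rewrite opalg_mulE b4; apply: mV.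
- by move=> i; rewrite opalg_mulE b4; apply: Vm.
Qed.

End FrtConstructions.

(* Stated over abstract modules: unification among concrete tensor products   *)
(* unfolds the quotients behind them and is prohibitively slow.               *)
Lemma coassoc_sum (A : Type) (T TA AT : zmodType) m (X : 'M[A]_m) (d : A -> T)
    (t2 : A -> A -> T) (p : T -> A -> TA) (q : A -> T -> AT) (m1 : T -> TA)
    (m2 : T -> AT) (al : TA -> AT) :
  (forall i j, d (X i j) = \sum_k t2 (X i k) (X k j)) ->
  {morph al : x y / x + y} -> al 0 = 0 ->
  {morph m1 : x y / x + y} -> m1 0 = 0 -> {morph m2 : x y / x + y} -> m2 0 = 0 ->
  (forall a b c, al (p (t2 a b) c) = q a (t2 b c)) ->
  (forall a b, m1 (t2 a b) = p (d a) b) -> (forall a b, m2 (t2 a b) = q a (d b)) ->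
  (forall c, {morph p^~ c : u v / u + v}) -> (forall c, p 0 c = 0) ->
  (forall a, {morph q a : u v / u + v}) -> (forall a, q a 0 = 0) ->
  forall i j, al (m1 (d (X i j))) = m2 (d (X i j)).
Proof.
move=> dE alD al0 m1D m10 m2D m20 alE m1E m2E pD p0 qD q0 i j.
rewrite dE (big_morph _ m1D m10) (big_morph _ alD al0) (big_morph _ m2D m20).
transitivity (\sum_k \sum_l q (X i l) (t2 (X l k) (X k j))).
  apply: eq_bigr => k _; rewrite m1E dE (big_morph (p^~ (X k j)) (pD _) (p0 _)).
  by rewrite (big_morph _ alD al0); apply: eq_bigr => l _; rewrite alE.
rewrite exchange_big; apply: eq_bigr => l _.
by rewrite m2E dE (big_morph (q (X i l)) (qD _) (q0 _)).
Qed.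

(** * Coefficients of comultiplicative matrices *)

Section Comatrix.
Variables (K : fieldType) (A : algType K) (eps : {lrmorphism A -> K^o}).
Variables (D : {lrmorphism A -> tens2 eps}) (S : {lrmorphism A -> opalg A}).
Local Notation T := (tens2 eps).
Local Notation d := (D : A -> T).

Record comatrix m (X : 'M[A]_m) : Prop := Comatrix {
  comatrix_comul i j : d (X i j) = \sum_k (tpure (X i k) (X k j) : T);
  comatrix_counit i j : eps (X i j) = (i == j)%:R;
  comatrix_Sl : map_mx (S : A -> A) X *m X = 1%:M;
  comatrix_Sr : X *m map_mx (S : A -> A) X = 1%:M
}.

Let d_lin : linear d. Proof. exact: (linearP D). Qed.
Let id_lin : linear (id : A -> A). Proof. by []. Qed.

Section Entries.
Variables (m : nat) (X : 'M[A]_m) (CX : comatrix X).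

Lemma comatrix_coassoc i j :
  tassoc (tmap d id (d (X i j))) = tmap id d (d (X i j)).
Proof.
have al : linear (@tassoc K A A A : tens T A -> tens A T) := @tassoc_lin K A A A.
have l1 : linear (tmap d id : T -> tens T A) := tmap_lin d_lin id_lin.
have l2 : linear (tmap id d : T -> tens A T) := tmap_lin id_lin d_lin.
exact: (@coassoc_sum A T (tens T A) (tens A T) m X d (fun a b => tpure a b : T)
  (fun u c => tpure u c) (fun a u => tpure a u) (tmap d id) (tmap id d)
  (@tassoc K A A A : tens T A -> tens A T) (comatrix_comul CX)
  (linear_funD al) (linear_fun0 al) (linear_funD l1) (linear_fun0 l1)
  (linear_funD l2) (linear_fun0 l2) (@tassocE K A A A)
  (fun a b => tmapE a b d_lin id_lin) (fun a b => tmapE a b id_lin d_lin)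
  (fun c => linear_funD (tpure_linl c)) (fun c => linear_fun0 (tpure_linl c))
  (fun a => linear_funD (tpure_linr a)) (fun a => linear_fun0 (tpure_linr a))).
Qed.

Lemma comatrix_tlift (Z : lmodType K) (f : A -> A -> Z) i j :
  bilinear_for *:%R *:%R f ->
  tlift f (d (X i j)) = \sum_k f (X i k) (X k j).
Proof.
move=> fb; rewrite (comatrix_comul CX).
have := tlift_linear fb; have := tliftE fb; move: (tlift f) => g gE gl.
by rewrite (linear_fun_sum _ _ gl); apply: eq_bigr => k _; rewrite gE.
Qed.

Lemma comatrix_counit_l i j :
  tlift (fun a b : A => eps a *: b) (d (X i j)) = X i j.
Proof.
rewrite (comatrix_tlift _ _ (counit_l_bil (linearP eps : linear (eps : A -> K^o)))).
rewrite (bigD1 i) //= (comatrix_counit CX) eqxx scale1r big1 ?addr0 // => k ki.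
by rewrite (comatrix_counit CX) eq_sym (negbTE ki) scale0r.
Qed.

Lemma comatrix_counit_r i j :
  tlift (fun a b : A => eps b *: a) (d (X i j)) = X i j.
Proof.
rewrite (comatrix_tlift _ _ (counit_r_bil (linearP eps : linear (eps : A -> K^o)))).
rewrite (bigD1 j) //= (comatrix_counit CX) eqxx scale1r big1 ?addr0 // => k ki.
by rewrite (comatrix_counit CX) (negbTE ki) scale0r.
Qed.

Lemma comatrix_antipode_l i j :
  tlift (fun a b : A => (S a : A) * b) (d (X i j)) = (eps (X i j))%:A.
Proof.
rewrite (comatrix_tlift _ _ (antipode_l_bil (linearP S : linear (S : A -> A)))).
have := congr1 (fun Y : 'M[A]_m => Y i j) (comatrix_Sl CX).
rewrite !mxE (comatrix_counit CX) scaler_nat => <-.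
by apply: eq_bigr => k _; rewrite mxE.
Qed.

Lemma comatrix_antipode_r i j :
  tlift (fun a b : A => a * (S b : A)) (d (X i j)) = (eps (X i j))%:A.
Proof.
rewrite (comatrix_tlift _ _ (antipode_r_bil (linearP S : linear (S : A -> A)))).
have := congr1 (fun Y : 'M[A]_m => Y i j) (comatrix_Sr CX).
rewrite !mxE (comatrix_counit CX) scaler_nat => <-.
by apply: eq_bigr => k _; rewrite mxE.
Qed.

End Entries.

Definition coefficient (x : A) : Prop :=
  exists m (X : 'M[A]_m) i j, x = X i j /\ comatrix X.

(** A grouplike element is a comultiplicative matrix of size one, so the inverses of the ell_ii need
    no separate treatment. *)
Lemma grouplike_coefficient x xV : d x = tpure x x -> eps x = 1 ->
  (S x : A) = xV -> x * xV = 1 -> xV * x = 1 -> coefficient x.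
Proof.
move=> dx ex Sx xxV xVx; exists 1%N, (const_mx x), ord0, ord0; split.
  by rewrite mxE.
split=> [i j|i j||].
- rewrite big_ord1 !mxE; exact: dx.
- by rewrite mxE ex !ord1.
- by apply/matrixP => i j; rewrite !ord1 !mxE big_ord1 !mxE Sx.
- by apply/matrixP => i j; rewrite !ord1 !mxE big_ord1 !mxE Sx.
Qed.

Lemma hopf_of_coefficients :
  (forall P : A -> Prop, P 1 -> (forall x, coefficient x -> P x) ->
    (forall u v, P u -> P v -> P (u + v)) ->
    (forall u v, P u -> P v -> P (u * v)) ->
    (forall c u, P u -> P (c *: u)) -> forall z, P z) ->
  exists H : hopf A, [/\ comul H =1 d, counit H =1 eps & antipode H =1 S].
Proof.
move=> ind; apply: (hopf_of_generators ind) => _ [m [X [i [j [-> CX]]]]].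
- exact: comatrix_coassoc.
- exact: comatrix_counit_l.
- exact: comatrix_counit_r.
- exact: comatrix_antipode_l.
- exact: comatrix_antipode_r.
Qed.

End Comatrix.

(** * The Hopf structure of U(R) *)

Section FrtHopf.
Variables (K : fieldType) (N : nat) (r s : K) (A : algType K).
Variables (L M : 'M[A]_N) (LV MV : 'I_N -> A).
Hypothesis rels : frt_rels r s L M LV MV.
Hypothesis lift : forall (B : algType K) (LP LM : 'M[B]_N) (LPV LMV : 'I_N -> B),
  frt_rels r s LP LM LPV LMV -> exists phi : {lrmorphism A -> B},
  [/\ map_mx phi L = LP, map_mx phi M = LM,
      forall i, phi (LV i) = LPV i & forall i, phi (MV i) = LMV i].
Hypothesis ind : forall P : A -> Prop,
  P 1 -> (forall i j, P (L i j)) -> (forall i j, P (M i j)) ->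
  (forall i, P (LV i)) -> (forall i, P (MV i)) ->
  (forall u v, P u -> P v -> P (u + v)) ->
  (forall u v, P u -> P v -> P (u * v)) ->
  (forall c u, P u -> P (c *: u)) ->
  forall z, P z.

(** The copies a (x) 1 and 1 (x) a commute, so the product of the two images of L solves the
    relations again, and its entries are the required sums. *)
Lemma frt_comul (eps : {lrmorphism A -> K^o}) :
  exists D : {lrmorphism A -> tens2 eps},
  [/\ forall i j, D (L i j) = \sum_k (tpure (L i k) (L k j) : tens2 eps),
      forall i j, D (M i j) = \sum_k (tpure (M i k) (M k j) : tens2 eps),
      forall i, D (LV i) = tpure (LV i) (LV i)
    & forall i, D (MV i) = tpure (MV i) (MV i)].
Proof.
have [i1 i1E] := tens2_inl eps; have [i2 i2E] := tens2_inr eps.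
pose t a b : tens2 eps := tpure a b.
have i12 a b : i1 a * i2 b = t a b.
  rewrite i1E i2E; apply: etrans (tens_mulpE _ _ _ _) _.
  by rewrite mulr1 mul1r.
have i21 a b : i2 b * i1 a = t a b.
  rewrite i1E i2E; apply: etrans (tens_mulpE _ _ _ _) _.
  by rewrite mulr1 mul1r.
change (exists D : {lrmorphism A -> tens2 eps},
  [/\ forall i j, D (L i j) = \sum_k t (L i k) (L k j),
      forall i j, D (M i j) = \sum_k t (M i k) (M k j),
      forall i, D (LV i) = t (LV i) (LV i)
    & forall i, D (MV i) = t (MV i) (MV i)]).
move: t i1 i2 {i1E i2E} i12 i21 => t i1 i2 i12 i21.
have C a b : i1 a * i2 b = i2 b * i1 a by rewrite i12 i21.
have [D [DL DM DLV DMV]] := lift (frt_rels_mul C rels).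
exists D; split=> [i j|i j|i|i].
- have := congr1 (fun X : 'M_N => X i j) DL; rewrite [LHS]mxE => ->.
  by rewrite mxE; apply: eq_bigr => k _; rewrite !mxE i12.
- have := congr1 (fun X : 'M_N => X i j) DM; rewrite [LHS]mxE => ->.
  by rewrite mxE; apply: eq_bigr => k _; rewrite !mxE i12.
- by rewrite DLV i12.
- by rewrite DMV i12.
Qed.

(** The universal property is applied three times: to identity matrices for the counit, to the
    tensor square for the coproduct, and to the inverse matrices in the opposite algebra for the
    antipode. *)
Lemma frt_hopf : exists H : hopf A,
  [/\ forall i j, comul H (L i j) = \sum_k tpure (L i k) (L k j)
        /\ comul H (M i j) = \sum_k tpure (M i k) (M k j),
      forall i j, counit H (L i j) = (i == j)%:R /\ counit H (M i j) = (i == j)%:R,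
      L *m map_mx (antipode H) L = 1%:M /\ map_mx (antipode H) L *m L = 1%:M
    & M *m map_mx (antipode H) M = 1%:M /\ map_mx (antipode H) M *m M = 1%:M].
Proof.
have [eps [eL eM eLV eMV]] := lift (frt_rels_one N r s K^o).
have [D [DL DM DLV DMV]] := frt_comul eps.
have [LI [MI [LL' L'L MM' M'M rI]]] := frt_rels_inv rels.
have [S [SL SM SLV SMV]] := lift rI.
have epsL i j : eps (L i j) = (i == j)%:R.
  by have := congr1 (fun X : 'M_N => X i j) eL; rewrite !mxE.
have epsM i j : eps (M i j) = (i == j)%:R.
  by have := congr1 (fun X : 'M_N => X i j) eM; rewrite !mxE.
have SLE : map_mx (S : A -> A) L = LI by exact: SL.
have SME : map_mx (S : A -> A) M = MI by exact: SM.
have CL : comatrix D S L by split; rewrite ?SLE.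
have CM : comatrix D S M by split; rewrite ?SME.
have [_ _ _ _ _ pV Vp mV Vm] := rels.
have [|H [HD He HS]] := @hopf_of_coefficients K A eps D S.
{ move=> P P1 PG PD PM PZ; apply: ind => // [i j|i j|i|i]; apply: PG.
  - by exists N, L, i, j.
  - by exists N, M, i, j.
  - exact: (grouplike_coefficient (DLV i) (eLV i) (SLV i) (Vp i) (pV i)).
  - exact: (grouplike_coefficient (DMV i) (eMV i) (SMV i) (Vm i) (mV i)). }
have HSE : (antipode H : A -> A) = S by apply/funext.
exists H; split=> [i j|i j||].
- by rewrite !HD; split; [apply: DL | apply: DM].
- by rewrite !He epsL epsM.
- by rewrite HSE SLE.
- by rewrite HSE SME.
Qed.

End FrtHopf.

Lemma UR_hopf (K : fieldType) (n : nat) (r s : K) : s != 0 ->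
  exists H : hopf (UR (Rmx n.+1 r s)), UR_hopf_spec H.
Proof.
move=> s0.
have [|H [HD He HL HM]] := frt_hopf (UR_frt_rels n.+1 r s) _ (@UR_ind K n.+1 r s).
  exact: UR_lift.
exists H; constructor.
- exact: (fun i j => proj1 (HD i j)).
- exact: (fun i j => proj2 (HD i j)).
- exact: (fun i j => proj1 (He i j)).
- exact: (fun i j => proj2 (He i j)).
- exact: HL.
- exact: HM.
Qed.

Lemma borelL_hom (K : fieldType) (A B : algType K) (phi : A -> B) (r s : K)
    (x t : nat -> A) :
  linear phi -> {morph phi : u v / u * v} ->
  forall i j, phi (borelL r s x t i j)
    = borelL r s (fun k => phi (x k)) (fun k => phi (t k)) i j.
Proof.
move=> pl pM i j; have pZ := linear_funZ pl.
have pB u v : phi (u - v) = phi u - phi v.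
  by rewrite -scaleN1r (linear_funD pl) pZ scaleN1r.
have rv k l : phi (rootvec r x k l) = rootvec r (fun k => phi (x k)) k l.
  by rewrite /rootvec; elim: (_.-1) => //= m IH; rewrite pB pZ !pM IH.
rewrite /borelL; case: ifP => // _; case: ifP => _; last exact: linear_fun0.
by rewrite pZ pM rv.
Qed.

Lemma natfun_hom (K : fieldType) (A B : algType K) (phi : A -> B) m
    (f : 'I_m -> A) (i : nat) :
  phi 0 = 0 -> phi (natfun f i) = natfun (fun k => phi (f k)) i.
Proof. by move=> p0; rewrite /natfun; case: insub. Qed.

Lemma inv_unique (R : pzRingType) (a b c : R) : a * b = 1 -> c * a = 1 -> b = c.
Proof. by move=> ab ca; rewrite -[b]mul1r -ca -mulrA ab mulr1. Qed.

(** * Grouplike and skew primitive elements *)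

Section HopfGenerators.
Variables (K : fieldType) (A : algType K) (H : hopf A).
Local Notation d := (comul H).

Lemma comulM x y : d (x * y) = d x * d y.
Proof. exact: (comul_mult H).2. Qed.

Lemma comulZ c x : d (c *: x) = c *: d x.
Proof. exact: linearZ. Qed.

Lemma comul1 : d 1 = tpure 1 1.
Proof. exact: (comul_mult H).1. Qed.

Lemma grouplike_inv (x xV : A) :
  x * xV = 1 -> xV * x = 1 -> d x = tpure x x -> d xV = tpure xV xV.
Proof.
move=> e1 e2 dx.
have h1 : d x * d xV = 1 by rewrite -comulM e1 comul1.
have h2 : tpure xV xV * d x = 1 by rewrite dx tens_mulpE e2.
exact: inv_unique h1 h2.
Qed.

Lemma grouplike_mul x y :
  d x = tpure x x -> d y = tpure y y -> d (x * y) = tpure (x * y) (x * y).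
Proof. by move=> dx dy; rewrite comulM dx dy tens_mulpE. Qed.

Let bil_cl := counit_l_bil (linearP (counit H) : linear (counit H : A -> K^o)).

Let bil_cr := counit_r_bil (linearP (counit H) : linear (counit H : A -> K^o)).

Let bil_Sl := antipode_l_bil (linearP (antipode H) : linear (antipode H : A -> A)).

Let bil_Sr := antipode_r_bil (linearP (antipode H) : linear (antipode H : A -> A)).

Lemma counit1 : counit H 1 = 1.
Proof. exact: (counit_mult H).1. Qed.

Lemma grouplike_counit x xV : x * xV = 1 -> d x = tpure x x -> counit H x = 1.
Proof.
move=> e1 dx; have := counit_l H x; rewrite dx (tliftE bil_cl).
move/(congr1 (fun y => y * xV)); rewrite -scalerAl e1 => /eqP.
rewrite -[X in _ == X]scale1r -subr_eq0 -scalerBl scaler_eq0 oner_eq0 orbF.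
by rewrite subr_eq0 => /eqP.
Qed.

Lemma grouplike_antipode x xV : x * xV = 1 -> d x = tpure x x ->
  antipode H x = xV.
Proof.
move=> e1 dx; have := antipode_l H x.
rewrite dx (tliftE bil_Sl) (grouplike_counit e1 dx) scale1r => e.
transitivity (antipode H x * x * xV); first by rewrite -mulrA e1 mulr1.
by rewrite e mul1r.
Qed.

Lemma grouplike_neq0 (x xV : A) : x * xV = 1 -> x != 0.
Proof. by move=> e1; apply/eqP => x0; move/eqP: e1; rewrite x0 mul0r eq_sym oner_eq0. Qed.

Section SkewPrimitive.
Variables w wV : A.
Hypotheses (wwV : w * wV = 1) (wVw : wV * w = 1) (dw : d w = tpure w w).

(** One counit axiom reads x + eps(x) w = x with w nonzero, so eps(x) = 0; the antipode axiom then
    reads S(x) + w^-1 x = 0. *)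
Lemma skew_left x : d x = tpure x 1 + tpure w x ->
  counit H x = 0 /\ antipode H x = - (wV * x).
Proof.
move=> dx; have cx : counit H x = 0.
  have := counit_r H x; have l := tlift_linear bil_cr.
  rewrite dx (linear_funD l) !(tliftE bil_cr) counit1 scale1r => /eqP.
  rewrite -[X in _ == X]addr0 (inj_eq (addrI _)) scaler_eq0.
  by rewrite (negbTE (grouplike_neq0 wwV)) orbF => /eqP.
split=> //; have := antipode_l H x; have l := tlift_linear bil_Sl.
rewrite dx (linear_funD l) !(tliftE bil_Sl) cx scale0r mulr1.
by rewrite (grouplike_antipode wwV dw) => /eqP; rewrite addr_eq0 => /eqP.
Qed.

Lemma skew_right x : d x = tpure 1 x + tpure x w ->
  counit H x = 0 /\ antipode H x = - (x * wV).
Proof.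
move=> dx; have cx : counit H x = 0.
  have := counit_l H x; have l := tlift_linear bil_cl.
  rewrite dx (linear_funD l) !(tliftE bil_cl) counit1 scale1r => /eqP.
  rewrite -[X in _ == X]addr0 (inj_eq (addrI _)) scaler_eq0.
  by rewrite (negbTE (grouplike_neq0 wwV)) orbF => /eqP.
split=> //; have := antipode_r H x; have l := tlift_linear bil_Sr.
rewrite dx (linear_funD l) !(tliftE bil_Sr) cx scale0r mul1r.
by rewrite (grouplike_antipode wwV dw) => /eqP; rewrite addr_eq0 => /eqP.
Qed.

End SkewPrimitive.

Section FrtGenerators.
Variables (n : nat) (r s : K) (L M : 'M[A]_n.+1) (LV MV : 'I_n.+1 -> A).
Hypothesis rels : frt_rels r s L M LV MV.
Hypothesis dL : forall i j, d (L i j) = \sum_k tpure (L i k) (L k j).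
Hypothesis dM : forall i j, d (M i j) = \sum_k tpure (M i k) (M k j).

Let tp0l (y : A) : tpure (0 : A) y = 0 := linear_fun0 (tpure_linl y).
Let tp0r (x : A) : tpure x (0 : A) = 0 := linear_fun0 (tpure_linr x).

Lemma comul_LV j : d (LV j) = tpure (LV j) (LV j).
Proof.
apply: (grouplike_inv (frt_rel_pV rels j) (frt_rel_Vp rels j)).
rewrite dL (bigD1 j) //= big1 ?addr0 // => k kj.
case: (ltngtP k j) => [{}kj|jk|e]; last by case/eqP: kj; apply: val_inj.
  by rewrite (frt_rel_lower rels kj) tp0r.
by rewrite (frt_rel_lower rels jk) tp0l.
Qed.

Lemma comul_MV j : d (MV j) = tpure (MV j) (MV j).
Proof.
apply: (grouplike_inv (frt_rel_mV rels j) (frt_rel_Vm rels j)).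
rewrite dM (bigD1 j) //= big1 ?addr0 // => k kj.
case: (ltngtP k j) => [{}kj|jk|e]; last by case/eqP: kj; apply: val_inj.
  by rewrite (frt_rel_upper rels kj) tp0l.
by rewrite (frt_rel_upper rels jk) tp0r.
Qed.

Let sum_lo_hi (i : 'I_n) (F : 'I_n.+1 -> tens A A) :
  (forall k : 'I_n.+1, (k < i)%N || (i.+1 < k)%N -> F k = 0) ->
  \sum_k F k = F (lo i) + F (hi i).
Proof.
move=> F0; rewrite (bigD1 (lo i)) //= (bigD1 (hi i)) /=; last first.
  by rewrite -val_eqE /= /bump leq0n add1n gtn_eqF.
rewrite big1 ?addr0 // => k /andP[k1 k2].
by have [e|e|/F0 //] := lo_hi_far k i; rewrite e eqxx in k1 k2.
Qed.

(** By triangularity only k = i and k = i+1 contribute to the coproduct of L (hi i) (lo i);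
    multiplying by the grouplike LV (lo i) turns the two terms into those of a skew primitive
    element. *)
Lemma comul_frt_e i : L (hi i) (hi i) * LV (lo i) = LV (lo i) * L (hi i) (hi i) ->
  d (frt_e r s L LV i)
  = tpure (frt_e r s L LV i) 1 + tpure (LV (lo i) * L (hi i) (hi i)) (frt_e r s L LV i).
Proof.
move=> C; rewrite /frt_e comulZ comulM comul_LV dL (@sum_lo_hi i); last first.
{ move=> k /orP[ki|ik].
  - by rewrite (frt_rel_lower (i:=k) (j:=lo i) rels ki) tp0r.
  - by rewrite (frt_rel_lower (i:=hi i) (j:=k) rels ik) tp0l. }
rewrite mulrDl !tens_mulpE (frt_rel_pV rels) C scalerDr.
rewrite -(linear_funZ (tpure_linl 1)) /=.
by rewrite -(linear_funZ (tpure_linr (LV (lo i) * L (hi i) (hi i)))).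
Qed.

Lemma comul_frt_f i : d (frt_f r s M MV i)
  = tpure 1 (frt_f r s M MV i) + tpure (frt_f r s M MV i) (MV (lo i) * M (hi i) (hi i)).
Proof.
rewrite /frt_f comulZ comulM comul_MV dM (@sum_lo_hi i); last first.
{ move=> k /orP[ki|ik].
  - by rewrite (frt_rel_upper (i:=lo i) (j:=k) rels ki) tp0l.
  - by rewrite (frt_rel_upper (i:=k) (j:=hi i) rels ik) tp0r. }
rewrite mulrDr !tens_mulpE (frt_rel_Vm rels) scalerDr.
rewrite -(linear_funZ (tpure_linr 1)) /=.
by rewrite -(linear_funZ (tpure_linl (MV (lo i) * M (hi i) (hi i)))).
Qed.

End FrtGenerators.
End HopfGenerators.

(** * Functoriality of the tensor product *)

Section TensorFunctor.
Variable K : fieldType.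

Lemma tmap_comp (V V' V'' W W' W'' : lmodType K) (f : V -> V') (f' : V' -> V'')
    (g : W -> W') (g' : W' -> W'') :
  linear f -> linear f' -> linear g -> linear g' ->
  forall u, tmap f' g' (tmap f g u) = tmap (fun x => f' (f x)) (fun x => g' (g x)) u.
Proof.
move=> fl fl' gl gl'.
apply: tens_linear_eq => [||v w].
- exact: comp_lin (tmap_lin fl gl) (tmap_lin fl' gl').
- exact: tmap_lin (comp_lin fl fl') (comp_lin gl gl').
- by rewrite tmapE // (tmapE _ _ fl' gl') (tmapE _ _ (comp_lin fl fl') (comp_lin gl gl')).
Qed.

Lemma tmap_ext (V V' W W' : lmodType K) (f f' : V -> V') (g g' : W -> W') :
  f =1 f' -> g =1 g' -> forall u, tmap f g u = tmap f' g' u.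
Proof. by move=> /funext -> /funext ->. Qed.

Lemma tmap_id (V W : lmodType K) (f : V -> V) (g : W -> W) :
  f =1 id -> g =1 id -> forall u : tens V W, tmap f g u = u.
Proof.
move=> fE gE; have -> : f = id by apply/funext.
have -> : g = id by apply/funext.
apply: tens_linear_eq => [||v w] //; first exact: tmap_lin.
by rewrite tmapE.
Qed.

Lemma tassoc_natural (V V' W W' X X' : lmodType K)
    (f : V -> V') (g : W -> W') (h : X -> X') :
  linear f -> linear g -> linear h -> forall u,
  tassoc (tmap (tmap f g) h u) = tmap f (tmap g h) (tassoc u).
Proof.
move=> fl gl hl; have fg := tmap_lin fl gl; have gh := tmap_lin gl hl.
have l := comp_lin (tmap_lin fg hl) (@tassoc_lin K V' W' X').
have l' := comp_lin (@tassoc_lin K V W X) (tmap_lin fl gh).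
apply: (tens_linear_eq l l') => vw x.
have m := comp_lin (tpure_linl x) l; have m' := comp_lin (tpure_linl x) l'.
apply: (tens_linear_eq m m') => v w.
rewrite (tmapE _ _ fg hl) (tmapE _ _ fl gl) !tassocE.
by rewrite (tmapE _ _ fl gh) (tmapE _ _ gl hl).
Qed.

Lemma tlift_tmap (V V' W W' Z Z' : lmodType K) (f : V -> V') (g : W -> W')
    (h : Z -> Z') (p : V -> W -> Z) (p' : V' -> W' -> Z') :
  linear f -> linear g -> linear h ->
  bilinear_for *:%R *:%R p -> bilinear_for *:%R *:%R p' ->
  (forall v w, p' (f v) (g w) = h (p v w)) ->
  forall u, tlift p' (tmap f g u) = h (tlift p u).
Proof.
move=> fl gl hl pb pb' E; have m := tliftE pb; have m' := tliftE pb'.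
have l := tlift_linear pb; have l' := tlift_linear pb'.
move: (tlift p) (tlift p') m m' l l' => q q' m m' l l'.
apply: tens_linear_eq => [||v w].
- exact: comp_lin (tmap_lin fl gl) l'.
- exact: comp_lin l hl.
- by rewrite tmapE // m' m E.
Qed.

End TensorFunctor.

(** * Transport of a Hopf structure along an algebra isomorphism *)

Section Transport.
Variables (K : fieldType) (A B : algType K).
Variables (th : {lrmorphism A -> B}) (et : {lrmorphism B -> A}).
Hypotheses (thK : cancel th et) (etK : cancel et th).
Variable H : hopf B.

Let thl : linear (th : A -> B) := linearP th.
Let etl : linear (et : B -> A) := linearP et.
Let dl : linear (comul H) := linearP (comul H).
Let el : linear (counit H : B -> K^o) := linearP (counit H).
Let Sl : linear (antipode H) := linearP (antipode H).

Let d x := tmap et et (comul H (th x)).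
Let d_lin : linear d := comp_lin (comp_lin thl dl) (tmap_lin etl etl).
Let dE : d =1 fun x => tmap et et (comul H (th x)). Proof. by []. Qed.

Let d_mul : {morph d : x y / x * y}.
Proof.
have M := tmap_mul etl etl (rmorphM et) (rmorphM et).
have c := (comul_mult H).2; have t := rmorphM th.
by move=> x y; rewrite /d t c M.
Qed.

Let d1 : d 1 = tpure 1 1.
Proof.
by rewrite /d rmorph1 (comul_mult H).1 (tmapE 1 1 etl etl) rmorph1.
Qed.

Let det u : d (et u) = tmap et et (comul H u). Proof. by rewrite /d etK. Qed.

Let idl (V : lmodType K) : linear (id : V -> V). Proof. by []. Qed.

(** Naturality of the associator moves the three copies of [et] outside, where coassociativity in B
    applies. *)
Let coassoc x : tassoc (tmap d id (d x)) = tmap id d (d x).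
Proof.
have e := tmap_lin etl etl.
transitivity (tassoc (tmap (tmap et et) et (tmap (comul H) id (comul H (th x))))).
  congr tassoc; rewrite {2}/d (tmap_comp etl d_lin etl (@idl A)).
  rewrite (tmap_comp dl e (@idl B) etl).
  by apply: (tmap_ext det (frefl _)).
rewrite (tassoc_natural etl etl etl) comul_coassoc (tmap_comp (@idl B) etl dl e).
rewrite {2}/d (tmap_comp etl (@idl A) etl d_lin).
by apply: (tmap_ext (frefl _) (fsym det)).
Qed.

Let c x : K^o := counit H (th x).
Let c_lin : linear c := comp_lin thl el.
Let S x := et (antipode H (th x)).
Let S_lin : linear S := comp_lin (comp_lin thl Sl) etl.

Let counit_l' x : tlift (fun a b => c a *: b) (d x) = x.
Proof.
rewrite -[RHS]thK -[in RHS](counit_l H (th x)).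
apply: tlift_tmap => //.
- exact: counit_l_bil el.
- exact: counit_l_bil c_lin.
- by move=> v w; rewrite /c etK linearZ.
Qed.

Let counit_r' x : tlift (fun a b => c b *: a) (d x) = x.
Proof.
rewrite -[RHS]thK -[in RHS](counit_r H (th x)).
apply: tlift_tmap => //.
- exact: counit_r_bil el.
- exact: counit_r_bil c_lin.
- by move=> v w; rewrite /c etK linearZ.
Qed.

Let antipode_l' x : tlift (fun a b => S a * b) (d x) = (c x)%:A.
Proof.
have -> : (c x)%:A = et ((counit H (th x))%:A) by rewrite linearZ /= rmorph1.
rewrite -(antipode_l H (th x)); apply: tlift_tmap => //.
- exact: antipode_l_bil Sl.
- exact: antipode_l_bil S_lin.
- by move=> v w; rewrite /S etK rmorphM.
Qed.

Let antipode_r' x : tlift (fun a b => a * S b) (d x) = (c x)%:A.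
Proof.
have -> : (c x)%:A = et ((counit H (th x))%:A) by rewrite linearZ /= rmorph1.
rewrite -(antipode_r H (th x)); apply: tlift_tmap => //.
- exact: antipode_r_bil Sl.
- exact: antipode_r_bil S_lin.
- by move=> v w; rewrite /S etK rmorphM.
Qed.

Lemma hopf_transport : exists HA : hopf A,
  hopf_isomorphism HA H th /\ forall x, comul HA (et x) = tmap et et (comul H x).
Proof.
have [D DE] := linear_of d_lin; have [e eE] := scalar_of c_lin.
have [s sE] := linear_of S_lin.
have H1 : monoid_morphism D.
  by split=> [|x y]; rewrite !DE; [exact: d1 | exact: d_mul].
have H2 : monoid_morphism e.
  have [c1 cM] := counit_mult H.
  by split=> [|x y]; rewrite !eE /c ?rmorph1 ?rmorphM ?c1 ?cM.
have ED : (D : A -> _) = d by apply/funext.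
have Ee : (e : A -> K) = c by apply/funext.
have ES : (s : A -> A) = S by apply/funext.
have H3 x : tassoc (tmap D id (D x)) = tmap id D (D x).
  by rewrite ED; apply: coassoc.
have H4 x : tlift (fun a b => e a *: b) (D x) = x.
  by rewrite ED Ee; apply: counit_l'.
have H5 x : tlift (fun a b => e b *: a) (D x) = x.
  by rewrite ED Ee; apply: counit_r'.
have H6 x : tlift (fun a b => s a * b) (D x) = (e x)%:A.
  by rewrite ED Ee ES; apply: antipode_l'.
have H7 x : tlift (fun a b => a * s b) (D x) = (e x)%:A.
  by rewrite ED Ee ES; apply: antipode_r'.
exists (Hopf H1 H2 H3 H4 H5 H6 H7); split=> [|x]; last by rewrite /= ED det.
split=> [|x|x|x] /=.
- by exists et.
- by rewrite ED /d (tmap_comp etl thl etl thl) tmap_id.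
- by rewrite Ee.
- by rewrite ES /S etK.
Qed.

End Transport.

(** * The isomorphism *)

Lemma transcendental_neq0 (K : fieldType) (x : K) : transcendental x -> x != 0.
Proof.
move=> /(_ 'X); rewrite map_polyX rootX => h; apply/negP => /h /eqP.
by rewrite polyX_eq0.
Qed.

Section Isomorphism.
Variables (K : fieldType) (n : nat) (r s : K).
Hypotheses (r0 : r != 0) (s0 : s != 0) (rs0 : r - s != 0) (rs1 : r + s != 0).
Variables (U B : algType K).
Variables (e f : 'I_n -> U) (a aV a' a'V : 'I_n.+1 -> U).
Hypothesis relU : gl_rels r s e f a aV a' a'V.
Variables (L M : 'M[B]_n.+1) (LV MV : 'I_n.+1 -> B).
Hypothesis relB : frt_rels r s L M LV MV.
Hypothesis indU : forall P : U -> Prop, P 1 ->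
  (forall i, P (e i)) -> (forall i, P (f i)) ->
  (forall j, P (a j)) -> (forall j, P (aV j)) ->
  (forall j, P (a' j)) -> (forall j, P (a'V j)) ->
  (forall u v, P u -> P v -> P (u + v)) ->
  (forall u v, P u -> P v -> P (u * v)) ->
  (forall c u, P u -> P (c *: u)) ->
  forall z, P z.
Hypothesis indB : forall P : B -> Prop,
  P 1 -> (forall i j, P (L i j)) -> (forall i j, P (M i j)) ->
  (forall i, P (LV i)) -> (forall i, P (MV i)) ->
  (forall u v, P u -> P v -> P (u + v)) ->
  (forall u v, P u -> P v -> P (u * v)) ->
  (forall c u, P u -> P (c *: u)) ->
  forall z, P z.
Variables (th : {lrmorphism U -> B}) (et : {lrmorphism B -> U}).
Hypotheses (thE : forall i, th (e i) = frt_e r s L LV i)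
  (thF : forall i, th (f i) = frt_f r s M MV i)
  (thA : forall j, th (a j) = LV j) (thAV : forall j, th (aV j) = L j j)
  (thA' : forall j, th (a' j) = MV j) (thA'V : forall j, th (a'V j) = M j j).
Hypotheses (etL : map_mx et L = gl_Lp r s e aV) (etM : map_mx et M = gl_Lm r s f a'V)
  (etLV : forall j, et (LV j) = a j) (etMV : forall j, et (MV j) = a' j).

Let etZ c x : et (c *: x) = c *: et x. Proof. exact: linearZ. Qed.

Let etX x y : et (x * y) = et x * et y. Proof. exact: rmorphM. Qed.

Let etD x y : et (x + y) = et x + et y. Proof. exact: raddfD. Qed.

Let thZ c x : th (c *: x) = c *: th x. Proof. exact: linearZ. Qed.

Let thX x y : th (x * y) = th x * th y. Proof. exact: rmorphM. Qed.

Let thD x y : th (x + y) = th x + th y. Proof. exact: raddfD. Qed.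

Let etLE i j : et (L i j) = gl_Lp r s e aV i j.
Proof. by have := congr1 (fun X : 'M_n.+1 => X i j) etL; rewrite [LHS]mxE. Qed.

Let etME i j : et (M i j) = gl_Lm r s f a'V i j.
Proof. by have := congr1 (fun X : 'M_n.+1 => X i j) etM; rewrite [LHS]mxE. Qed.

Lemma iso_thK : cancel th et.
Proof.
apply: indU => [|i|i|j|j|j|j|u v hu hv|u v hu hv|c u hu].
- by rewrite !rmorph1.
- rewrite thE /frt_e etZ etX etLE etLV.
  exact: (frt_e_of_gl rs0 relU i).
- rewrite thF /frt_f etZ etX etME etMV.
  exact: (frt_f_of_gl rs0 relU i).
- by rewrite thA etLV.
- by rewrite thAV etLE gl_Lp_diag.
- by rewrite thA' etMV.
- by rewrite thA'V etME gl_Lm_diag.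
- by rewrite (thD, etD) (thD, etD) hu hv.
- by rewrite (thX, etX) (thX, etX) hu hv.
- by rewrite (thZ, etZ) (thZ, etZ) hu.
Qed.

(** Both L and its image under the composite are matrices [borelL] with the same diagonal and the
    same simple root vectors. *)
Lemma iso_etK : cancel et th.
Proof.
apply: indB => [|i j|i j|j|j|u v hu hv|u v hu hv|c u hu].
- by rewrite !rmorph1.
- rewrite etLE mxE (borelL_hom (phi := th) _ _ _ _ (linearP th) (rmorphM th)).
  rewrite -natmxE -(borelL_of_frt_p r0 s0 rs0 relB); last by rewrite -ltnS.
  congr (borelL _ _ _ _ _ _); apply/funext => k.
    by rewrite natfun_hom ?raddf0 //; congr (natfun _ _); apply/funext => i'.
  by rewrite natfun_hom ?raddf0 //; congr (natfun _ _); apply/funext => i'.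
- rewrite etME mxE.
  (* For ell^- the root vectors are formed in the opposite algebras, between which th is
     multiplicative as well. *)
  have thM : {morph (th : opalg U -> opalg B) : u v / u * v}.
    by move=> u v; apply: (rmorphM th v u).
  rewrite (borelL_hom (A := opalg U) (B := opalg B) (phi := th) s r _ _ (linearP th) thM).
  rewrite -natmxE -(borelL_of_frt_m r0 s0 rs0 relB); last by rewrite -ltnS.
  congr (borelL (A := opalg B) _ _ _ _ _ _); apply/funext => k.
    by rewrite natfun_hom ?raddf0 //; congr (natfun _ _); apply/funext => i'.
  by rewrite natfun_hom ?raddf0 //; congr (natfun _ _); apply/funext => i'.
- by rewrite etLV thA.
- by rewrite etMV thA'.
- by rewrite (thD, etD) (thD, etD) hu hv.
- by rewrite (thX, etX) (thX, etX) hu hv.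
- by rewrite (thZ, etZ) (thZ, etZ) hu.
Qed.

Lemma iso_unique (th' : {lrmorphism U -> B}) :
  (forall i, th' (e i) = frt_e r s L LV i) ->
  (forall i, th' (f i) = frt_f r s M MV i) ->
  (forall j, th' (a j) = LV j) -> (forall j, th' (a' j) = MV j) -> th' =1 th.
Proof.
move=> hE hF hA hA'.
have inv (phi : {lrmorphism U -> B}) x y : x * y = 1 -> phi x * phi y = 1.
  by move=> xy; rewrite -rmorphM xy rmorph1.
apply: indU => [|i|i|j|j|j|j|u v hu hv|u v hu hv|c u hu].
- by rewrite !rmorph1.
- by rewrite hE thE.
- by rewrite hF thF.
- by rewrite hA thA.
- rewrite thAV; apply: (@inv_unique B (LV j)); last exact: (frt_rel_pV relB).
  by rewrite -hA; apply: inv; apply: (rel_aaV relU).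
- by rewrite hA' thA'.
- rewrite thA'V; apply: (@inv_unique B (MV j)); last exact: (frt_rel_mV relB).
  by rewrite -hA'; apply: inv; apply: (rel_a'a'V relU).
- by rewrite raddfD thD /= hu hv.
- by rewrite rmorphM thX /= hu hv.
- by rewrite linearZ thZ /= hu.
Qed.

Variables (HU : hopf U) (HB : hopf B).
Hypothesis HUB : forall x, comul HU (et x) = tmap et et (comul HB x).
Hypotheses (dL : forall i j, comul HB (L i j) = \sum_k tpure (L i k) (L k j))
  (dM : forall i j, comul HB (M i j) = \sum_k tpure (M i k) (M k j)).

Let et_lin : linear (et : B -> U) := linearP et.

Let dUL i j : comul HU (gl_Lp r s e aV i j)
  = \sum_k tpure (gl_Lp r s e aV i k) (gl_Lp r s e aV k j).
Proof.
have tl := tmap_lin et_lin et_lin.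
rewrite -etLE HUB dL (linear_fun_sum _ _ tl); apply: eq_bigr => k _.
by rewrite (tmapE _ _ et_lin et_lin) !etLE.
Qed.

Let dUM i j : comul HU (gl_Lm r s f a'V i j)
  = \sum_k tpure (gl_Lm r s f a'V i k) (gl_Lm r s f a'V k j).
Proof.
have tl := tmap_lin et_lin et_lin.
rewrite -etME HUB dM (linear_fun_sum _ _ tl); apply: eq_bigr => k _.
by rewrite (tmapE _ _ et_lin et_lin) !etME.
Qed.

Let w i := a (lo i) * aV (hi i).
Let wV i := a (hi i) * aV (lo i).
Let w' i := a' (lo i) * a'V (hi i).
Let w'V i := a' (hi i) * a'V (lo i).

(** The matrices [gl_Lp] and [gl_Lm] are the images of L and M under et, so they keep the matrix
    coproduct; the coproducts of e_i and f_i are read off their entries. *)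
Lemma gl_comul : [/\ forall j, comul HU (a j) = tpure (a j) (a j),
  forall j, comul HU (a' j) = tpure (a' j) (a' j),
  forall i, comul HU (e i) = tpure (e i) 1 + tpure (w i) (e i)
  & forall i, comul HU (f i) = tpure 1 (f i) + tpure (f i) (w' i)].
Proof.
have rel := frt_of_gl r0 s0 rs0 rs1 relU.
split=> [j|j|i|i].
- exact: comul_LV rel dUL j.
- exact: comul_MV rel dUM j.
- have := comul_frt_e rel dUL (i := i).
  rewrite gl_Lp_diag (frt_e_of_gl rs0 relU); apply.
  apply: inv_comm (rel_aVa relU _) (rel_aaV relU _) _.
  exact: (rel_aa relU).
- have := comul_frt_f rel dUM i.
  by rewrite gl_Lm_diag (frt_f_of_gl rs0 relU).
Qed.

Let inv_pair (x xV : 'I_n.+1 -> U) :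
  (forall j, x j * xV j = 1) -> (forall j, xV j * x j = 1) -> forall i j,
  x i * xV j * (x j * xV i) = 1.
Proof.
move=> h1 h2 i j; rewrite mulrA -(mulrA (x i)) h2 mulr1; exact: h1.
Qed.

Lemma gl_counit_antipode : [/\
  forall j, counit HU (a j) = 1 /\ antipode HU (a j) = aV j,
  forall j, counit HU (a' j) = 1 /\ antipode HU (a' j) = a'V j,
  forall i, counit HU (e i) = 0 /\ antipode HU (e i) = - (wV i * e i)
  & forall i, counit HU (f i) = 0 /\ antipode HU (f i) = - (f i * w'V i)].
Proof.
have [da da' de df] := gl_comul.
have daV j := grouplike_inv (rel_aaV relU j) (rel_aVa relU j) (da j).
have da'V j := grouplike_inv (rel_a'a'V relU j) (rel_a'Va' relU j) (da' j).
have pa := inv_pair (rel_aaV relU) (rel_aVa relU).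
have pa' := inv_pair (rel_a'a'V relU) (rel_a'Va' relU).
split=> [j|j|i|i].
- split; first exact: grouplike_counit (rel_aaV relU j) (da j).
  exact: grouplike_antipode (rel_aaV relU j) (da j).
- split; first exact: grouplike_counit (rel_a'a'V relU j) (da' j).
  exact: grouplike_antipode (rel_a'a'V relU j) (da' j).
- exact: (skew_left (pa _ _) (grouplike_mul (da _) (daV _)) (de i)).
- exact: (skew_right (pa' _ _) (grouplike_mul (da' _) (da'V _)) (df i)).
Qed.

End Isomorphism.

Theorem theoremA7 (K : closedFieldType) (n : nat) (r s : K)
    (r_trans : transcendental r) (s_trans : transcendental s)
    (rs_not_root : forall m : nat, (0 < m)%N -> (r * s^-1) ^+ m != 1) :
  let U := Ugl n r s in
  let UR := UR (Rmx n.+1 r s) in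
  let ellp := Lp (Rmx n.+1 r s) in
  let ellm := Lm (Rmx n.+1 r s) in
  let ellpV := LpV (Rmx n.+1 r s) in
  let ellmV := LmV (Rmx n.+1 r s) in
  exists (HU : hopf U) (HR : hopf UR),
    [/\ Ugl_hopf_spec HU, UR_hopf_spec HR
      & let P (theta : {lrmorphism U -> UR}) :=
          [/\ hopf_isomorphism HU HR theta,
              forall j, theta (gl_a r s j) = ellpV j,
              forall j, theta (gl_a' r s j) = ellmV j,
              forall i, theta (gl_e r s i)
                = (r - s)^-1 *: (ellp (hi i) (lo i) * ellpV (lo i))
            & forall i, theta (gl_f r s i)
                = (s - r)^-1 *: (ellmV (lo i) * ellm (lo i) (hi i))] in
        exists theta, P theta /\ forall theta', P theta' -> theta' =1 theta].
Proof.
have r0 := transcendental_neq0 r_trans; have s0 := transcendental_neq0 s_trans.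
(* The cases m = 1 and m = 2 of the root of unity hypothesis exclude r = s and r = -s. *)
have rs0 : r - s != 0.
  apply: contra (rs_not_root 1%N isT); rewrite subr_eq0 => /eqP ->.
  by rewrite expr1 divff.
have rs1 : r + s != 0.
  apply: contra (rs_not_root 2%N isT); rewrite addr_eq0 => /eqP ->.
  by rewrite mulNr divff // sqrrN expr1n.
move=> U UR ellp ellm ellpV ellmV.
have relU := Ugl_rels n r0 s0 rs0 rs1.
have relB := UR_frt_rels n.+1 r s.
have [th thX] := Ugl_lift r0 s0 rs0 rs1 (gl_of_frt r0 s0 rs0 relB).
have [et [etL etM etLV etMV]] := UR_lift (frt_of_gl r0 s0 rs0 rs1 relU).
have indU (P : U -> Prop) : P 1 ->
  (forall i, P (gl_e r s i)) -> (forall i, P (gl_f r s i)) ->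
  (forall j, P (gl_a r s j)) -> (forall j, P (gl_aV r s j)) ->
  (forall j, P (gl_a' r s j)) -> (forall j, P (gl_a'V r s j)) ->
  (forall u v, P u -> P v -> P (u + v)) ->
  (forall u v, P u -> P v -> P (u * v)) ->
  (forall c u, P u -> P (c *: u)) -> forall z, P z.
{ by move=> P1 Pe Pf Pa PaV Pa' Pa'V; apply: Ugl_ind => // -[]. }
have indB := @UR_ind K n.+1 r s.
have thE i : th (gl_e r s i) = frt_e r s ellp ellpV i := thX (Ge i).
have thF i : th (gl_f r s i) = frt_f r s ellm ellmV i := thX (Gf i).
have thA j : th (gl_a r s j) = ellpV j := thX (Ga j).
have thAV j : th (gl_aV r s j) = ellp j j := thX (GaV j).
have thA' j : th (gl_a' r s j) = ellmV j := thX (Ga' j).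
have thA'V j : th (gl_a'V r s j) = ellm j j := thX (Ga'V j).
have thK := iso_thK rs0 relU indU thE thF thA thAV thA' thA'V etL etM etLV etMV.
have etK := iso_etK r0 s0 rs0 relB indB thE thF thA thAV thA' thA'V etL etM etLV etMV.
have uniq := iso_unique relU relB indU thE thF thA thAV thA' thA'V.
have [HR specR] := UR_hopf n r s0.
(* The Hopf structure of U is defined through theta; what remains is to recognise its values on the
   generators. *)
have [HU [isoUR HUB]] := hopf_transport thK etK HR.
have [ca ca' ce cf] := gl_comul r0 s0 rs0 rs1 relU etL etM HUB
  (comul_Lp specR) (comul_Lm specR).
have [aa aa' ae af] := gl_counit_antipode r0 s0 rs0 rs1 relU etL etM HUB
  (comul_Lp specR) (comul_Lm specR).
exists HU, HR; split; [|exact: specR|].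
- constructor.
  + exact: ca.
  + exact: ca'.
  + exact: ce.
  + exact: cf.
  + exact: (fun j => proj1 (aa j)).
  + exact: (fun j => proj1 (aa' j)).
  + exact: (fun j => proj1 (ae j)).
  + exact: (fun j => proj1 (af j)).
  + exact: (fun j => proj2 (aa j)).
  + exact: (fun j => proj2 (aa' j)).
  + exact: (fun j => proj2 (ae j)).
  + exact: (fun j => proj2 (af j)).
- move=> P; exists th; split.
    by split; [exact: isoUR|exact: thA|exact: thA'|exact: thE|exact: thF].
  by move=> th' [_ hA hA' hE hF]; exact: (uniq th' hE hF hA hA').
Qed.
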